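(* Let $(\mathcal X,d,m)$ be a metric measure space with a strongly local regular Dirichlet form $(\mathcal E,\mathcal F)$ on $L^2(\mathcal X,m)$. Let $(D_n)_{n\ge1}$ be an increasing sequence of open sets with compact closure, with $\overline{D_n}\subset D_{n+1}$, such that $\bigcup_nD_n=\mathcal X$. Write $U_n=D_{n+1}-D_n$. Let $\theta_n>0$ be such that $\mathrm{CSD}(D_n,D_{n+1},\theta_n)$ holds for each $n$. (a) Suppose that there is a constant $c_1$ with $\theta_n\le c_1$ for all $n$. If $$\liminf_{n\to\infty}\frac{\theta_n\,m(U_n)}{4^n}=0,$$ then stochastic completeness holds. (b) Suppose $\theta_n=c_0^2n^2$ for all $n$ (for some constant $c_0>0$), and there exists a constant $b>0$ such that $$m(U_n)\le e^{2b(\log n)^2}\quad\text{for all }n.$$ Then stochastic completeness holds.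
   Context: Setting. $(\mathcal X,d)$ is a locally compact metric space and $m$ is a positive Radon measure on $\mathcal X$ with $\operatorname{supp}[m]=\mathcal X$; $(\mathcal E,\mathcal F)$ is a regular, strongly local Dirichlet form on $L^2(\mathcal X,m)$ with associated semigroup $(P_t)_{t\ge0}$ (extended to $L^\infty$ as usual). Functions $f\in\mathcal F$ are always represented by quasi-continuous versions. Stochastic completeness means $P_t1=1$ $m$-a.e. for some (equivalently all) $t>0$. Energy measure. For essentially bounded $f\in\mathcal F$, $\Gamma(f,f)$ is the unique Borel measure with $\int g\,d\Gamma(f,f)=\mathcal E(f,fg)-\tfrac12\mathcal E(f^2,g)$ for all essentially bounded $g\in\mathcal F$; it is extended to all of $\mathcal F$ by truncation, and $\Gamma(f,g)$ is defined by polarization, so that $\mathcal E(f,g)=\int_{\mathcal X}d\Gamma(f,g)$. By strong locality $\Gamma(\varphi,\varphi)$ is also defined for functions $\varphi$ that are locally in $\mathcal F$ (i.e. agree $m$-a.e. on each relatively compact open set with an element of $\mathcal F$). Cutoff functions and CSD. For open $U\subset\overline U\subset V$, a cutoff function for $U\subset V$ is a continuous function $\varphi$ (locally in $\mathcal F$, $0\le\varphi\le1$) with $\varphi=1$ on $U$ and $\varphi=0$ on $V^c$. For open $D_0\subset\overline{D_0}\subset D_1$ and $\theta>0$, with $U=D_1-\overline{D_0}$, condition $\mathrm{CSD}(D_0,D_1,\theta)$ holds if there is a cutoff function $\varphi$ for $D_0\subset D_1$ such that for all $f\in\mathcal F$ $$\int_Uf^2\,d\Gamma(\varphi,\varphi)\le\tfrac18\int_U\varphi^2\,d\Gamma(f,f)+\theta\int_Uf^2\,dm.$$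 *)

(* Defs.v *)
From HB Require Import structures.
From mathcomp Require Import all_boot all_order all_algebra.
From mathcomp Require Import all_classical all_reals all_analysis.

Set Implicit Arguments.
Unset Strict Implicit.
Unset Printing Implicit Defensive.
Import Order.TTheory GRing.Theory Num.Theory.
Import numFieldNormedType.Exports.

Local Open Scope classical_set_scope.
Local Open Scope ring_scope.

(* In the library measurable types are pointed, hence the base point here; only
   the empty space is excluded. *)
#[short(type="pmetricType")]
HB.structure Definition PointedMetricSpace (R : numDomainType) :=
  {M of Metric R M & isPointed M}.

(* X itself, carrying its Borel sigma-algebra. *)
Notation borel X := (g_sigma_algebraType (@open X)).

Notation borel_measure X R := {measure set (borel X) -> \bar R}.

Section measure_notions.
Context {R : realType} {X : pmetricType R}.
Implicit Types (m : borel_measure X R) (f g : X -> R).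

Definition radon_measure m : Prop :=
  [/\ forall K : set X, compact K -> (m K < +oo)%E,
      forall A : set (borel X), measurable A ->
        m A = ereal_inf [set m V | V in [set V : set X | open V /\ A `<=` V]]
    & forall V : set X, open V ->
        m V = ereal_sup [set m K | K in [set K : set X | compact K /\ K `<=` V]]].

Definition full_support m : Prop :=
  forall V : set X, open V -> V !=set0 -> (0 < m V)%E.

Definition ae_eq_on m (V : set X) f g : Prop :=
  {ae m, forall x, V x -> f x = g x}.

(* L^2(X, m) is represented by square-integrable Borel functions; equality
   m-a.e. is handled explicitly. *)
Definition L2 m f : Prop := f \in Lfun m 2%:E.

Definition Linfty m f : Prop := f \in Lfun m +oo%E.

Definition inner m f g : R := \int[m]_x (f x * g x).

Definition Cc f : Prop :=
  continuous f /\ compact (closure [set x | f x != 0]).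

(* Support of the measure |f| m. *)
Definition msupport m f : set X :=
  ~` \bigcup_(V in [set V : set X | open V /\ ae_eq_on m V f (cst 0)]) V.

Definition truncate (n : nat) f : X -> R :=
  fun x => Num.max (- n%:R) (Num.min (f x) n%:R).

End measure_notions.

Section dirichlet_forms.
Context {R : realType} {X : pmetricType R}.
Variables (m : borel_measure X R).
(* E is only meaningful on F. *)
Variables (F : set (X -> R)) (E : (X -> R) -> (X -> R) -> R).
Implicit Types (f g h : X -> R) (V W : set X).

Definition E1 f g : R := E f g + inner m f g.

Record dirichlet_form : Prop := DirichletForm {
  form_L2 : forall f, F f -> L2 m f ;
  form_ae : forall f g, F f -> L2 m g -> ae_eq_on m setT f g ->
    F g /\ forall h, F h -> E f h = E g h ;
  form_0 : F (cst 0) ;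
  form_lin : forall (a : R) f g, F f -> F g -> F (fun x => a * f x + g x) ;
  form_bilin : forall (a : R) f g h, F f -> F g -> F h ->
    E (fun x => a * f x + g x) h = a * E f h + E g h ;
  form_sym : forall f g, F f -> F g -> E f g = E g f ;
  form_ge0 : forall f, F f -> 0 <= E f f ;
  form_dense : forall f (e : R), L2 m f -> 0 < e ->
    exists2 g, F g & inner m (f \- g) (f \- g) < e ;
  form_closed : forall u : nat -> X -> R, (forall n, F (u n)) ->
    (forall e : R, 0 < e -> exists N, forall i j, (N <= i)%N -> (N <= j)%N ->
      E1 (u i \- u j) (u i \- u j) < e) ->
    exists2 v, F v & (fun n => E1 (u n \- v) (u n \- v)) @ \oo --> (0 : R) ;
  form_markov : forall f, F f ->
    let f1 := fun x => Num.min (Num.max (f x) 0) 1 in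
    F f1 /\ E f1 f1 <= E f f
}.

Definition regular_form : Prop :=
  (forall f (e : R), F f -> 0 < e ->
     exists g, [/\ F g, Cc g & E1 (f \- g) (f \- g) < e]) /\
  (forall f (e : R), Cc f -> 0 < e ->
     exists g, [/\ F g, Cc g & forall x, `|f x - g x| < e]).

Definition strongly_local : Prop :=
  forall f g W (c : R), F f -> F g ->
    compact (msupport m f) -> compact (msupport m g) ->
    open W -> msupport m f `<=` W -> ae_eq_on m W g (cst c) ->
    E f g = 0.

(* The correspondence between closed forms and strongly continuous symmetric
   contraction semigroups on L^2: E(f, g) = lim_(t -> 0) <f - P_t f, g> / t, and
   F is the set of f for which the limit exists when g = f. *)
Record associated_semigroup (P : R -> (X -> R) -> (X -> R)) : Prop :=
  AssociatedSemigroup {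
  sg_L2 : forall (t : R) f, 0 <= t -> L2 m f -> L2 m (P t f) ;
  sg_ae : forall (t : R) f g, 0 <= t -> L2 m f -> L2 m g ->
    ae_eq_on m setT f g -> ae_eq_on m setT (P t f) (P t g) ;
  sg_lin : forall (t a : R) f g, 0 <= t -> L2 m f -> L2 m g ->
    ae_eq_on m setT (P t (fun x => a * f x + g x))
                    (fun x => a * P t f x + P t g x) ;
  sg_sym : forall (t : R) f g, 0 <= t -> L2 m f -> L2 m g ->
    inner m (P t f) g = inner m f (P t g) ;
  sg_contraction : forall (t : R) f, 0 <= t -> L2 m f ->
    inner m (P t f) (P t f) <= inner m f f ;
  sg_0 : forall f, L2 m f -> ae_eq_on m setT (P 0 f) f ;
  sg_add : forall (s t : R) f, 0 <= s -> 0 <= t -> L2 m f ->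
    ae_eq_on m setT (P (s + t) f) (P s (P t f)) ;
  sg_continuous : forall f, L2 m f ->
    inner m (P t f \- f) (P t f \- f) @[t --> 0^'+] --> (0 : R) ;
  sg_domain : forall f, L2 m f ->
    (F f <-> cvg (t^-1 * inner m (f \- P t f) f @[t --> 0^'+])) ;
  sg_form : forall f g, F f -> F g ->
    t^-1 * inner m (f \- P t f) g @[t --> 0^'+] --> E f g
}.

(* h is the value at f >= 0 of the extension of P_t to nonnegative functions
   by monotone limits; the sequence is arbitrary because the limit does not
   depend on it. *)
Definition monotone_extension (P : R -> (X -> R) -> (X -> R)) (t : R) f h :
    Prop :=
  forall u : nat -> X -> R,
    (forall n, L2 m (u n) /\ {ae m, forall x, 0 <= u n x}) ->
    {ae m, forall x, nondecreasing_seq (fun n => u n x)} ->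
    {ae m, forall x, (fun n => u n x) @ \oo --> f x} ->
    {ae m, forall x, (fun n => P t (u n) x) @ \oo --> h x}.

Definition stochastically_complete (P : R -> (X -> R) -> (X -> R)) : Prop :=
  forall t : R, 0 < t -> monotone_extension P t (cst 1) (cst 1).

Definition capacity_open V : \bar R :=
  ereal_inf [set (E1 f f)%:E | f in
    [set f | F f /\ {ae m, forall x, V x -> 1 <= f x}]].

Definition quasi_continuous f : Prop :=
  forall e : R, 0 < e ->
    exists V, [/\ open V, (capacity_open V < e%:E)%E
                & {within ~` V, continuous f}].

Definition locally_in_form f : Prop :=
  measurable_fun [set: borel X] f /\
  forall V, open V -> compact (closure V) ->
    exists2 g, F g & ae_eq_on m V f g.

(* Gamma f stands for the energy measure Gamma(f, f). In energy_bounded both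
   sides are finite: an extended integral equal to a real number converges. *)
Record energy_measure (Gamma : (X -> R) -> borel_measure X R) : Prop :=
  EnergyMeasure {
  energy_bounded : forall f g, F f -> Linfty m f -> F g -> Linfty m g ->
    quasi_continuous g ->
    (\int[Gamma f]_x (g x)%:E =
      (E f (f \* g) - 2^-1 * E (f \* f) g)%:E)%E ;
  energy_truncate : forall f (A : set (borel X)), F f -> measurable A ->
    (fun n => Gamma (truncate n f) A) @ \oo --> Gamma f A ;
  energy_local : forall f g V (A : set (borel X)),
    locally_in_form f -> F g -> open V -> compact (closure V) ->
    ae_eq_on m V f g -> measurable A -> A `<=` V -> Gamma f A = Gamma g A
}.

Definition cutoff (U V : set X) (phi : X -> R) : Prop :=
  [/\ continuous phi, locally_in_form phi, forall x, 0 <= phi x <= 1,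
      forall x, U x -> phi x = 1 & forall x, ~ V x -> phi x = 0].

Definition CSD (Gamma : (X -> R) -> borel_measure X R)
    (D0 D1 : set X) (theta : R) : Prop :=
  let U : set (borel X) := D1 `\` closure D0 in
  exists2 phi : X -> R, cutoff D0 D1 phi &
    forall f, F f -> quasi_continuous f ->
      (\int[Gamma phi]_(x in U) (f x ^+ 2)%:E <=
         (8^-1)%:E * \int[Gamma f]_(x in U) (phi x ^+ 2)%:E
         + theta%:E * \int[m]_(x in U) (f x ^+ 2)%:E)%E.

End dirichlet_forms.

(* Main.v *)
Require Import Defs.
From mathcomp Require Import all_boot all_order all_algebra.
From mathcomp Require Import all_classical all_reals all_analysis.
From mathcomp Require Import measurable_realfun ess_sup_inf ring lra.
Set Implicit Arguments.
Unset Strict Implicit.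
Import Order.TTheory GRing.Theory Num.Theory.
Import numFieldNormedType.Exports.
Local Open Scope classical_set_scope.
Local Open Scope ring_scope.

(** With a cutoff [eta] equal to 1 near [D n.+1], the function [v_t = eta - P_t eta]
    vanishes at [t = 0] and satisfies [d/dt v_t = - L (P_t eta)], where [L] is the
    generator. Testing against [psi^2 v_t], with [psi = sum_(k <= i <= n) w_i phi_i]
    built from the CSD cutoffs, a Caccioppoli inequality and CSD on each annulus give
    [d/dt int psi^2 v^2 <= 4 sum_i w_i^2 theta_i int_(U_i) v^2]. Since [psi >= sum_(l >
    i) w_l] on the [i]-th annulus, weights growing like [prod (1 + sqrt (lambda / (2
    theta_i)))] absorb every term but the last into [2 lambda int psi^2 v^2], and
    Gronwall's lemma gives [prod^2 * int_(D k) (1 - P_t eta)^2 <= 2 theta_n m(U_n) /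
    lambda * exp (2 lambda t)]. In (a) take [lambda = 2 c1], so that each factor is at
    least 2. In (b) take [lambda] of order [(log n)^2], so that [exp (2 lambda t)] is
    harmless for small [t]; the semigroup property then covers all [t]. *)

(** * Positive semidefinite forms and L^2 *)

(** The energy measures come with an integral identity but with no Leibniz or chain rule. Such rules
    are therefore proved for [carre], the form expression of the integral, and they come from the
    semigroup: [E f g] is the limit of [t^-1 * inner m (f - P t f) g], and a pointwise quadratic
    inequality between values at [x] and at [y] can be averaged in [y] using positivity, the
    sub-Markov property and L^1 contractivity, although [P t] has no kernel. The constants then fit:
    the Leibniz inequality has [1/2] and [2], and [2 * 1/8 < 1/2], so the energy on the right of CSD
    is absorbed.

    Two gaps shape the rest. CSD and the energy identity test quasi-continuous functions, so the
    Caccioppoli inequality is proved first for continuous [v] with compact support and then extended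
    by strong approximation. And CSD integrates over the open annulus only, so the energy of a
    cutoff must be compared with its part on [0 < phi < 1]. Time derivatives are replaced by
    one-sided Dini estimates, since only right difference quotients are controlled by the form. *)

Section psd_forms.
Context {R : realType} {X : Type}.
Implicit Types (f g h : X -> R).

(** One interface serves [E] on [F], the L^2 inner product, the approximating forms, their defect
    from [E] and the weighted inner products. Membership in [V] is carried along because [E] is
    meaningful on [F] alone. *)
Record psd (V : set (X -> R)) (B : (X -> R) -> (X -> R) -> R) : Prop := Psd {
  psd_lin : forall (a : R) f g, V f -> V g -> V (fun x => a * f x + g x) ;
  psd_bilin : forall (a : R) f g h, V f -> V g -> V h ->
    B (fun x => a * f x + g x) h = a * B f h + B g h ;
  psd_sym : forall f g, V f -> V g -> B f g = B g f ;
  psd_ge0 : forall f, V f -> 0 <= B f f }.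

Variables (V : set (X -> R)) (B : (X -> R) -> (X -> R) -> R).
Hypothesis psdB : psd V B.

Lemma psdV_sub f g : V f -> V g -> V (fun x => f x - g x).
Proof.
move=> Vf Vg; have := psd_lin psdB (-1) Vg Vf.
by congr V; apply/funext => x; ring.
Qed.

Lemma psdV_add f g : V f -> V g -> V (fun x => f x + g x).
Proof.
move=> Vf Vg; have := psd_lin psdB 1 Vf Vg.
by congr V; apply/funext => x; ring.
Qed.

Lemma psdV_0 f : V f -> V (fun=> 0).
Proof.
move=> Vf; have := psd_lin psdB (-1) Vf Vf.
by congr V; apply/funext => x; ring.
Qed.

Lemma psdV_scale a f : V f -> V (fun x => a * f x).
Proof.
move=> Vf; have := psd_lin psdB a Vf (psdV_0 Vf).
by congr V; apply/funext => x; ring.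
Qed.

Lemma psdD f g h : V f -> V g -> V h -> B (fun x => f x + g x) h = B f h + B g h.
Proof.
move=> Vf Vg Vh; rewrite -(mul1r (B f h)) -(psd_bilin psdB) //.
by congr B; apply/funext => x; ring.
Qed.

Lemma psdN1 f g h : V f -> V g -> V h -> B (fun x => f x - g x) h = B f h - B g h.
Proof.
move=> Vf Vg Vh; have -> : B f h - B g h = -1 * B g h + B f h by ring.
by rewrite -(psd_bilin psdB) //; congr B; apply/funext => x; ring.
Qed.

Lemma psd0 h : V h -> B (fun=> 0) h = 0.
Proof.
move=> Vh; have := psdN1 Vh Vh Vh.
by rewrite subrr => e; rewrite -[RHS]e; congr B; apply/funext => x; ring.
Qed.

Lemma psdZ a f h : V f -> V h -> B (fun x => a * f x) h = a * B f h.
Proof.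
move=> Vf Vh; have -> : a * B f h = a * B f h + B (fun=> 0) h by rewrite psd0 // addr0.
rewrite -(psd_bilin psdB) //; last exact: psdV_0 Vf.
by congr B; apply/funext => x; ring.
Qed.

Lemma psdDr f g h : V f -> V g -> V h -> B h (fun x => f x + g x) = B h f + B h g.
Proof.
move=> Vf Vg Vh; rewrite (psd_sym psdB) ?psdD ?(psd_sym psdB Vh) //.
exact: psdV_add.
Qed.

Lemma psdBr f g h : V f -> V g -> V h -> B h (fun x => f x - g x) = B h f - B h g.
Proof.
move=> Vf Vg Vh; rewrite (psd_sym psdB) ?psdN1 ?(psd_sym psdB Vh) //.
exact: psdV_sub.
Qed.

Lemma psd0r h : V h -> B h (fun=> 0) = 0.
Proof. by move=> Vh; rewrite (psd_sym psdB) ?psd0//; exact: psdV_0 Vh. Qed.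

Lemma psdZr a f h : V f -> V h -> B h (fun x => a * f x) = a * B h f.
Proof.
move=> Vf Vh; rewrite (psd_sym psdB) ?psdZ ?(psd_sym psdB Vh) //.
exact: psdV_scale.
Qed.

Lemma psd_sqrD f g : V f -> V g ->
  B (fun x => f x + g x) (fun x => f x + g x) = B f f + 2 * B f g + B g g.
Proof.
move=> Vf Vg; have Vfg := psdV_add Vf Vg.
rewrite psdD // !psdDr // (psd_sym psdB Vg Vf); ring.
Qed.

Lemma psd_sqrB f g : V f -> V g ->
  B (fun x => f x - g x) (fun x => f x - g x) = B f f - 2 * B f g + B g g.
Proof.
move=> Vf Vg; have Vfg := psdV_sub Vf Vg.
rewrite psdN1 // !psdBr // (psd_sym psdB Vg Vf); ring.
Qed.

Lemma psd_le_add f g : V f -> V g ->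
  B (fun x => f x + g x) (fun x => f x + g x) <= 2 * B f f + 2 * B g g.
Proof.
move=> Vf Vg; have := psd_ge0 psdB (psdV_sub Vf Vg).
by rewrite psd_sqrB // psd_sqrD // => ?; lra.
Qed.

Lemma psd_le_sub f g : V f -> V g ->
  B (fun x => f x - g x) (fun x => f x - g x) <= 2 * B f f + 2 * B g g.
Proof.
move=> Vf Vg; have := psd_ge0 psdB (psdV_add Vf Vg).
by rewrite psd_sqrB // psd_sqrD // => ?; lra.
Qed.

Lemma psd_young (e : R) f g : 0 < e -> V f -> V g ->
  2 * `|B f g| <= e * B f f + e^-1 * B g g.
Proof.
move=> e0 Vf Vg.
have Hs (s : R) : 0 <= e^-1 * (s ^+ 2 * B g g + 2 * s * e * B f g + e ^+ 2 * B f f).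
  apply: mulr_ge0; first by rewrite invr_ge0 ltW.
  have := psd_ge0 psdB (psdV_add (psdV_scale s Vg) (psdV_scale e Vf)).
  rewrite psd_sqrD ?psdZ ?psdZr; try (by apply: psdV_scale) ; try by [].
  by rewrite (psd_sym psdB Vg Vf) => ?; lra.
have e1 : e^-1 * e = 1 by rewrite mulVf ?gt_eqF.
have H (s : R) : 0 <= s ^+ 2 * (e^-1 * B g g) + 2 * s * B f g + e * B f f.
  have := Hs s; move: (e^-1) e1 => ei e1.
  rewrite (_ : ei * _ = s ^+ 2 * (ei * B g g) + (ei * e) * (2 * s * B f g) +
    (ei * e) * (e * B f f)); last by ring.
  by rewrite e1 !mul1r.
have := H 1; have := H (-1); rewrite expr1n sqrrN expr1n.
by case: (ger0P (B f g)) => ? ? ?; lra.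
Qed.

(** In the nondegenerate case the vector [B g g * f - B f g * g] is tested. If [B g g = 0], Young's
    inequality with a small parameter forces [B f g = 0]. *)
Lemma psd_CS f g : V f -> V g -> B f g ^+ 2 <= B f f * B g g.
Proof.
move=> Vf Vg; have := psd_ge0 psdB Vf; have := psd_ge0 psdB Vg.
set p := B f f; set q := B g g; set r := B f g => q0 p0.
have H (e : R) : 0 < e -> 2 * `|r| <= e * p + e^-1 * q by move=> e0; exact: psd_young.
have [q00|q00] := eqVneq q 0.
  have r0 : r = 0.
    apply/eqP; rewrite -normr_eq0 eq_le normr_ge0 andbT.
    apply/ler_addgt0Pr => e e0; rewrite add0r.
    have := H (e / (p + 1)) ; rewrite q00 mulr0 addr0 => /(_ _).
    have p1 : 0 < p + 1 by lra.
    rewrite divr_gt0 // => /(_ isT) Hr.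
    have : e / (p + 1) * p <= e.
      by rewrite mulrAC ler_pdivrMr // ler_pM2l//; lra.
    by have := normr_ge0 r; lra.
  by rewrite r0 expr0n /= q00 mulr0.
have q1 : 0 < q by rewrite lt_neqAle eq_sym q00.
have := psd_ge0 psdB (psdV_sub (psdV_scale q Vf) (psdV_scale r Vg)).
rewrite psd_sqrB ?psdZ ?psdZr; try (by apply: psdV_scale) ; try by [].
rewrite -/p -/q -/r => Hq.
have : 0 <= q * (p * q - r ^+ 2) by move: Hq => ?; lra.
by rewrite pmulr_rge0 // subr_ge0.
Qed.

Lemma psd_subC f g : V f -> V g ->
  B (fun x => f x - g x) (fun x => f x - g x) = B (fun x => g x - f x) (fun x => g x - f x).
Proof. by move=> Vf Vg; rewrite !psd_sqrB // (psd_sym psdB Vf Vg); ring. Qed.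

End psd_forms.

Section L2_theory.
Context {R : realType} {X : pmetricType R} (m : borel_measure X R).
Implicit Types (f g h : X -> R).

Notation meas f := (measurable_fun [set: borel X] (f : borel X -> R)).

Lemma ae_imp (P Q : X -> Prop) : (forall x, P x -> Q x) ->
  {ae m, forall x, P x} -> {ae m, forall x, Q x}.
Proof. by move=> PQ; have FF := ae_filter_ringOfSetsType m; apply: filterS. Qed.

Lemma ae_imp2 (P Q S : X -> Prop) : (forall x, P x -> Q x -> S x) ->
  {ae m, forall x, P x} -> {ae m, forall x, Q x} -> {ae m, forall x, S x}.
Proof. by move=> PQ; have FF := ae_filter_ringOfSetsType m; apply: filterS2. Qed.

Lemma ae_all (P : X -> Prop) : (forall x, P x) -> {ae m, forall x, P x}.
Proof. by move=> PT; have FF := ae_filter_ringOfSetsType m; apply: filterE. Qed.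

Lemma ae_forall_nat (P : nat -> X -> Prop) : (forall n, {ae m, forall x, P n x}) ->
  {ae m, forall x, forall n, P n x}.
Proof. exact: (@ae_foralln _ _ _ m). Qed.

Lemma L2_meas f : L2 m f -> meas f.
Proof. by move=> /andP[]; rewrite inE. Qed.

Lemma L2_sqr f : L2 m f -> m.-integrable setT (fun x : borel X => (f x ^+ 2)%:E).
Proof. exact: Lfun2_integrable_sqr. Qed.

Lemma sqr_L2 f : meas f -> m.-integrable setT (fun x : borel X => (f x ^+ 2)%:E) -> L2 m f.
Proof.
move=> mf /integrableP[_ If]; apply/andP; split; first by rewrite inE.
rewrite inE/= /finite_norm unlock/=; apply: poweR_lty.
rewrite (eq_integral (fun x : borel X => `|(f x ^+ 2)%:E|)%E)// => x _.
by rewrite -[RHS]/(`|f x ^+ 2|%:E) normrX powR_mulrn.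
Qed.

Lemma L2_le f g : meas f -> (forall x, `|f x| <= `|g x|) -> L2 m g -> L2 m f.
Proof.
move=> mf fg Lg; apply: sqr_L2 => //.
apply: (le_integrable _ _ _ (L2_sqr Lg)) => //.
  by apply/measurable_EFinP; exact: measurable_funX.
move=> x _; rewrite lee_fin !normrX ler_pXn2r // ?nnegrE //.
Qed.

Lemma L2_int f g : L2 m f -> L2 m g -> m.-integrable setT (fun x : borel X => (f x * g x)%:E).
Proof. by move=> Lf Lg; apply/Lfun1_integrable; exact: Lfun2_mul_Lfun1. Qed.

Lemma L2_lin a f g : L2 m f -> L2 m g -> L2 m (fun x => a * f x + g x).
Proof.
move=> Lf Lg; apply: sqr_L2.
  apply: measurable_funD; last exact: L2_meas.
  by apply: measurable_funM => //; exact: L2_meas.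
have -> : (fun x : borel X => ((a * f x + g x) ^+ 2)%:E) =
  (fun x : borel X => ((a ^+ 2)%:E * (f x ^+ 2)%:E +
     ((2 * a)%:E * (f x * g x)%:E + (g x ^+ 2)%:E))%E).
  by apply/funext => x; rewrite -!EFinM -!EFinD; congr EFin; ring.
apply: integrableD => //; first by apply: integrableZl => //; exact: L2_sqr.
apply: integrableD => //; last exact: L2_sqr.
by apply: integrableZl => //; exact: L2_int.
Qed.

Lemma L2_mul f g (M : R) : L2 m f -> meas g -> (forall x, `|g x| <= M) ->
  L2 m (fun x => f x * g x).
Proof.
move=> Lf mg gM; apply: (@L2_le _ (fun x => M * f x + 0)).
- by apply: measurable_funM => //; exact: L2_meas.
- move=> x; rewrite addr0 !normrM mulrC ler_wpM2r //.
  by rewrite (le_trans (gM x)) // ler_norm.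
- apply: L2_lin => //; apply: (@L2_le _ f) => // x; by rewrite normr0.
Qed.

Lemma inner_psd : psd (L2 m) (inner m).
Proof.
split.
- by move=> a f g; exact: L2_lin.
- move=> a f g h Lf Lg Lh; rewrite /inner.
  have -> : (fun x => (a * f x + g x) * h x) = (fun x => a * (f x * h x) + g x * h x).
    by apply/funext => x; ring.
  rewrite RintegralD ?RintegralZl //; try exact: L2_int.
  by apply: (integrableZl measurableT a (L2_int Lf Lh)).
- move=> f g Lf Lg; rewrite /inner; congr Rintegral; apply/funext => x.
  by rewrite mulrC.
- by move=> f Lf; apply: Rintegral_ge0 => x _; rewrite -expr2 sqr_ge0.
Qed.

Lemma ae_eq_Rintegral (f g : X -> R) : meas f -> meas g ->
  {ae m, forall x, f x = g x} -> \int[m]_x f x = \int[m]_x g x.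
Proof.
move=> mf mg fg; rewrite /Rintegral; congr fine.
apply: ae_eq_integral => //; try exact/measurable_EFinP.
by apply: ae_imp fg => x /= ->.
Qed.

Lemma ae_le_Rintegral (f g : X -> R) :
  m.-integrable setT (EFin \o (f : borel X -> R)) ->
  m.-integrable setT (EFin \o (g : borel X -> R)) ->
  {ae m, forall x, f x <= g x} -> \int[m]_x f x <= \int[m]_x g x.
Proof.
move=> If Ig fg.
have mf : meas f by apply/measurable_EFinP; exact: measurable_int If.
have mg : meas g by apply/measurable_EFinP; exact: measurable_int Ig.
rewrite -subr_ge0 -RintegralB //.
(* The absolute value makes the integrand nonnegative everywhere rather than almost everywhere. *)
rewrite (@ae_eq_Rintegral _ (fun x => `|g x - f x|)).
- by apply: Rintegral_ge0 => x _.
- exact: measurable_funB.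
- by apply: measurableT_comp => //; exact: measurable_funB.
- by apply: ae_imp fg => x fgx /=; rewrite ger0_norm // subr_ge0.
Qed.

Lemma inner_ae_le f1 g1 f2 g2 : L2 m f1 -> L2 m g1 -> L2 m f2 -> L2 m g2 ->
  {ae m, forall x, f1 x * g1 x <= f2 x * g2 x} -> inner m f1 g1 <= inner m f2 g2.
Proof. by move=> ????; apply: ae_le_Rintegral; exact: L2_int. Qed.

Lemma inner_ae f f' g : L2 m f -> L2 m f' -> L2 m g ->
  {ae m, forall x, f x = f' x} -> inner m f g = inner m f' g.
Proof.
move=> Lf Lf' Lg ff'; apply/eqP; rewrite eq_le; apply/andP; split;
  apply: inner_ae_le => //; by apply: ae_imp ff' => x ->.
Qed.

Lemma inner_eq0 f : L2 m f -> inner m f f = 0 -> {ae m, forall x, f x = 0}.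
Proof.
move=> Lf H0.
have If := L2_int Lf Lf.
have : (\int[m]_(x in [set: borel X]) `|(f x * f x)%:E| = 0)%E.
  rewrite (eq_integral (fun x : borel X => (f x * f x)%:E)).
    by rewrite -(@fineK _ (integral _ _ _)) ?integrable_fin_num // -[fine _]/(inner m f f) H0.
  by move=> x _; rewrite gee0_abs // lee_fin -expr2 sqr_ge0.
move/(ae_eq_integral_abs _ measurableT (measurable_int _ If)).
by apply: ae_imp => x /(_ I) [] /eqP; rewrite mulf_eq0 orbb => /eqP.
Qed.

Lemma inner_mulA f g h : inner m (fun x => f x * h x) g = inner m f (fun x => h x * g x).
Proof. by rewrite /inner; congr Rintegral; apply/funext => x; ring. Qed.

End L2_theory.

(** * The approximating forms of the semigroup *)

Section at_right_zero.
Context {R : realType}.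

Lemma cvg_at_right0P (g : R -> R) (l : R) :
  (g t @[t --> 0^'+] --> l) <->
  forall e, 0 < e -> exists2 d, 0 < d & forall t, 0 < t -> t < d -> `|g t - l| < e.
Proof.
split.
- move=> /cvgrPdist_lt H e e0; have := H e e0.
  rewrite near_withinE => /nbhs_ballP[d /= d0 Hd].
  exists d => // t t0 td; rewrite distrC; apply: Hd => //=.
  by rewrite /ball /= sub0r normrN gtr0_norm.
- move=> H; apply/cvgrPdist_lt => e e0; have [d d0 Hd] := H e e0.
  rewrite near_withinE; apply/nbhs_ballP; exists d => //= t.
  rewrite /ball /= sub0r normrN => td t0; rewrite distrC; apply: Hd => //.
  by rewrite gtr0_norm in td.
Qed.

(** This closes a doubling argument: an excess with [a t <= a (2 t) / 2] and [a <= M] satisfies the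
    hypothesis by iteration. *)
Lemma le_geometric (x M : R) : (forall k, x <= (2 ^+ k)^-1 * M) -> x <= 0.
Proof.
move=> H; rewrite leNgt; apply/negP => x0.
have Mx : 0 < M by have := H 0%N; rewrite expr0 invr1 mul1r; apply: lt_le_trans.
have [k Hk] : exists k : nat, M / x < k%:R.
  by exists (Num.truncn (M / x)).+1; exact: truncnS_gt.
have : M / x < 2 ^+ k.
  by apply: lt_trans Hk _; rewrite -natrX ltr_nat ltn_expl.
rewrite ltr_pdivrMr // => H1.
have := H k; rewrite mulrC ler_pdivlMr ?exprn_gt0 // mulrC => H2.
by have := lt_le_trans H1 H2; rewrite ltxx.
Qed.

End at_right_zero.

Section dirichlet_semigroup.
Context {R : realType} {X : pmetricType R} (m : borel_measure X R).
Context (F : set (X -> R)) (E : (X -> R) -> (X -> R) -> R).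
Context (P : R -> (X -> R) -> (X -> R)).
Hypothesis form : dirichlet_form m F E.
Hypothesis sg : associated_semigroup m F E P.
Implicit Types (f g h u v : X -> R) (s t : R).

Let ipsd := inner_psd m.

Lemma sgL t f : 0 <= t -> L2 m f -> L2 m (P t f).
Proof. exact: (sg_L2 sg). Qed.

Lemma ae_eq_onT f g : ae_eq_on m setT f g -> {ae m, forall x, f x = g x}.
Proof. by apply: ae_imp => x; apply. Qed.

Lemma form_psd : psd F E.
Proof.
split.
- exact: form_lin form.
- exact: form_bilin form.
- exact: form_sym form.
- exact: form_ge0 form.
Qed.


Lemma inner_sgD s t f g : 0 <= s -> 0 <= t -> L2 m f -> L2 m g ->
  inner m (P (s + t) f) g = inner m (P s f) (P t g).
Proof.
move=> s0 t0 Lf Lg; rewrite addrC.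
rewrite (@inner_ae _ _ _ _ (P t (P s f))).
- rewrite (sg_sym sg) //; exact: sgL.
- by apply: sgL => //; rewrite addr_ge0.
- by apply: sgL => //; apply: sgL.
- by [].
- exact/ae_eq_onT/(sg_add sg).
Qed.

(** This is [t] times the usual approximating form. Without the factor [t^-1] it is subadditive in
    [t] and makes sense at [t = 0]. *)
Definition sg_form_at t f g := inner m (fun x => f x - P t f x) g.

Lemma sg_form_atE t f g : 0 <= t -> L2 m f -> L2 m g ->
  sg_form_at t f g = inner m f g - inner m (P t f) g.
Proof. by move=> t0 Lf Lg; rewrite /sg_form_at (psdN1 ipsd) //; exact: (sg_L2 sg). Qed.

Lemma sg_form_at_half t f : 0 <= t -> L2 m f ->
  sg_form_at t f f = inner m f f - inner m (P (t / 2) f) (P (t / 2) f).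
Proof.
move=> t0 Lf; rewrite sg_form_atE // -inner_sgD ?divr_ge0 //.
by rewrite -splitr.
Qed.

Lemma sg_form_at_psd t : 0 <= t -> psd (L2 m) (sg_form_at t).
Proof.
move=> t0; split.
- exact: psd_lin ipsd.
- move=> a f g h Lf Lg Lh; have Lfg := L2_lin a Lf Lg; rewrite !sg_form_atE //.
  rewrite (psd_bilin ipsd) //.
  have -> : inner m (P t (fun x => a * f x + g x)) h =
            a * inner m (P t f) h + inner m (P t g) h.
    rewrite -(psd_bilin ipsd) //; try exact: sgL.
    apply: inner_ae => //; do ?[exact: sgL | by apply: L2_lin; exact: sgL].
    exact/ae_eq_onT/(sg_lin sg).
  by ring.
- move=> f g Lf Lg; rewrite !sg_form_atE // (sg_sym sg) //.
  by rewrite (psd_sym ipsd Lf Lg) (psd_sym ipsd Lf (sgL t0 Lg)).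
- move=> f Lf; rewrite sg_form_at_half // subr_ge0.
  by apply: (sg_contraction sg) => //; rewrite divr_ge0.
Qed.

Lemma sg_form_at_le t f : 0 <= t -> L2 m f -> sg_form_at t f f <= inner m f f.
Proof.
move=> t0 Lf; rewrite sg_form_at_half // lerBlDr lerDl.
by apply: (psd_ge0 ipsd); apply: (sg_L2 sg) => //; rewrite divr_ge0.
Qed.

Lemma sg_form_at_sgD s t (h : R) f : 0 <= s -> 0 <= t -> 0 <= h -> L2 m f ->
  sg_form_at h (P s f) (P t f) = sg_form_at h (P (s + t) f) f.
Proof.
move=> s0 t0 h0 Lf;
have st0 : 0 <= s + t by exact: addr_ge0.
have LPs := sgL s0 Lf; have LPt := sgL t0 Lf; have LPst := sgL st0 Lf.
rewrite !sg_form_atE //.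
rewrite inner_sgD //; congr (_ - _).
have PP a b g : 0 <= a -> 0 <= b -> L2 m g -> inner m (P a (P b f)) g = inner m (P (a + b) f) g.
  move=> a0 b0 Lg; apply/esym/inner_ae => //.
  - by apply: sgL => //; exact: addr_ge0.
  - by apply: sgL => //; apply: sgL.
  - exact/ae_eq_onT/(sg_add sg).
rewrite PP //.
have hs0 : 0 <= h + s by exact: addr_ge0.
by rewrite PP // [in RHS]addrA -inner_sgD.
Qed.

(* [t |-> sg_form_at h (P t f) (P t f)] is bounded and satisfies [b t <= (b 0 + b (2 t)) / 2]. *)
Lemma sg_form_at_contraction (h : R) t f : 0 <= h -> 0 <= t -> L2 m f ->
  sg_form_at h (P t f) (P t f) <= sg_form_at h f f.
Proof.
move=> h0 t0 Lf; have bpsd := sg_form_at_psd h0.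
rewrite -subr_le0; apply: (@le_geometric _ _ (inner m f f)) => k.
elim: k t t0 => [|k IH] t t0.
  rewrite expr0 invr1 mul1r lerBlDr.
  apply: (@le_trans _ _ (inner m f f)).
    by apply: le_trans (sg_form_at_le h0 (sgL t0 Lf)) _; exact: (sg_contraction sg).
  by rewrite lerDl; exact: (psd_ge0 bpsd).
have t2 : 0 <= t + t by rewrite addr_ge0.
have := IH _ t2; rewrite (sg_form_at_sgD t0 t0 h0 Lf).
have := psd_ge0 bpsd (psdV_sub ipsd (sgL t2 Lf) Lf).
rewrite (psd_sqrB bpsd (sgL t2 Lf) Lf).
rewrite exprS invfM -mulrA => H1 H2.
have : sg_form_at h (P (t + t) f) f - sg_form_at h f f <=
  2^-1 * (sg_form_at h (P (t + t) f) (P (t + t) f) - sg_form_at h f f) by lra.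
by move=> /le_trans; apply; rewrite ler_pM2l // invr_gt0.
Qed.

(** By symmetry the increment between times [s] and [s + t] is the form at [t] evaluated on
    [P (s / 2) f], and the semigroup contracts that form. *)
Lemma sg_form_at_add s t f : 0 <= s -> 0 <= t -> L2 m f ->
  sg_form_at (s + t) f f <= sg_form_at s f f + sg_form_at t f f.
Proof.
move=> s0 t0 Lf;
have s2 : 0 <= s / 2 by rewrite divr_ge0.
have := sg_form_at_contraction t0 s2 Lf.
have LPs := sgL s0 Lf.
rewrite (sg_form_at_sgD s2 s2 t0 Lf) -splitr.
rewrite !sg_form_atE ?addr_ge0 //.
rewrite (_ : inner m (P t (P s f)) f = inner m (P (s + t) f) f); first by lra.
apply/esym; apply: inner_ae => //.
- by apply: sgL => //; exact: addr_ge0.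
- by apply: sgL => //; apply: sgL.
- by rewrite addrC; exact/ae_eq_onT/(sg_add sg).
Qed.

Lemma sg_form_at0 f : L2 m f -> sg_form_at 0 f f = 0.
Proof.
move=> Lf; rewrite sg_form_atE // (@inner_ae _ _ _ _ f) ?subrr //.
- exact: (sg_L2 sg).
- exact/ae_eq_onT/(sg_0 sg).
Qed.

Lemma sg_form_at_natmul n t f : 0 <= t -> L2 m f ->
  sg_form_at (n%:R * t) f f <= n%:R * sg_form_at t f f.
Proof.
move=> t0 Lf; elim: n => [|n IH]; first by rewrite !mul0r sg_form_at0.
rewrite -natr1 !mulrDl !mul1r.
apply: (le_trans (sg_form_at_add _ _ _)) => //; first by rewrite mulr_ge0.
by rewrite lerD2r.
Qed.

Lemma sg_form_cvg f g : F f -> F g -> forall e, 0 < e -> exists2 d, 0 < d &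
  forall t, 0 < t -> t < d -> `|t^-1 * sg_form_at t f g - E f g| < e.
Proof. by move=> Ff Fg; apply/cvg_at_right0P; exact: (sg_form sg). Qed.

(** Subadditivity bounds the quotient at [t] by the one at [t / k.+1], and the latter tends to
    [E f f]. *)
Lemma sg_form_at_le_form t f : F f -> 0 < t -> sg_form_at t f f <= t * E f f.
Proof.
move=> Ff t0; have Lf := form_L2 form Ff.
rewrite -ler_pdivrMl //; apply/ler_addgt0Pr => e e0.
have [d d0 Hd] := sg_form_cvg Ff Ff e0.
have [k Hk] : exists k : nat, t / d < k.+1%:R.
  by exists (Num.truncn (t / d)); exact: truncnS_gt.
have k0 : (0 : R) < k.+1%:R by rewrite ltr0n.
have tk0 : 0 < t / k.+1%:R by rewrite divr_gt0.
have tk : t / k.+1%:R < d.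
  by rewrite ltr_pdivrMr // mulrC -ltr_pdivrMr.
have := Hd _ tk0 tk; rewrite ltr_distl => /andP[_ /ltW]; apply: le_trans.
have := sg_form_at_natmul k.+1 (ltW tk0) Lf.
rewrite mulrC divfK ?gt_eqF // invfM invrK => H.
by rewrite -mulrA ler_pM2l ?invr_gt0.
Qed.

(** Subadditivity makes the quotients converge to their supremum as [t] tends to 0 (Fekete's
    argument), and by [sg_domain] a finite limit means membership in [F]. *)
Lemma form_of_sg_form_at f C : L2 m f -> 0 <= C ->
  (forall t, 0 < t -> sg_form_at t f f <= t * C) -> F f /\ E f f <= C.
Proof.
move=> Lf C0 HC.
set q := fun t => t^-1 * sg_form_at t f f.
have qC t : 0 < t -> q t <= C by move=> t0; rewrite /q ler_pdivrMl // HC.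
set S := [set q t | t in [set t | 0 < t]].
have S0 : S !=set0 by exists (q 1); exists 1 => //=.
have Sub : has_ubound S by exists C => _ [t t0 <-]; exact: qC.
have cq : q t @[t --> 0^'+] --> sup S.
  apply/cvg_at_right0P => e e0.
  have [_ [t0 /= t00 <-] Ht0] := sup_adherent e0 (conj S0 Sub).
  (* [t0] nearly attains the supremum. Cutting [t0] into steps of length [t] leaves a remainder
     shorter than [t], which contributes at most [C * t]; this [d] makes that loss negligible. *)
  have [d d0 Hd] : exists2 d, 0 < d & forall t, 0 < t -> t < d -> C * t < t0 * (q t0 - (sup S - e)).
    exists (t0 * (q t0 - (sup S - e)) / (C + 1)).
      by rewrite divr_gt0 ?mulr_gt0 //; lra.
    move=> t tp; rewrite ltr_pdivlMr; last by lra.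
    by move=> H; apply: le_lt_trans H; rewrite mulrC ler_pM2l //; lra.
  exists d => // t tp td.
  rewrite ltr_distl; apply/andP; split; last first.
    apply: (@le_lt_trans _ _ (sup S)); last by lra.
    by apply: ub_le_sup => //; exists t.
  set n := Num.truncn (t0 / t).
  have nle : n%:R * t <= t0.
    by rewrite -ler_pdivlMr // truncn_le // divr_ge0 // ltW.
  have nlt : t0 < n%:R * t + t.
    by have := truncnS_gt (t0 / t); rewrite -/n ltr_pdivrMr // -natr1 mulrDl mul1r.
  have r0 : 0 <= t0 - n%:R * t by lra.
  have Hsub := sg_form_at_add (mulr_ge0 (ler0n _ n) (ltW tp)) r0 Lf.
  have Hn := sg_form_at_natmul n (ltW tp) Lf.
  have Hr : sg_form_at (t0 - n%:R * t) f f <= C * t.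
    move: r0; rewrite le_eqVlt => /orP[/eqP <-|r0].
      by rewrite sg_form_at0 // mulr_ge0 // ltW.
    by apply: le_trans (HC _ r0) _; rewrite mulrC ler_wpM2l //; lra.
  have qt : sg_form_at t f f = t * q t by rewrite /q mulrA divff ?gt_eqF // mul1r.
  have qt0 : sg_form_at t0 f f = t0 * q t0 by rewrite /q mulrA divff ?gt_eqF // mul1r.
  have q0 : 0 <= q t.
    rewrite /q; apply: mulr_ge0; first by rewrite invr_ge0 ltW.
    exact: (psd_ge0 (sg_form_at_psd (ltW tp))).
  move: Hsub; rewrite addrC subrK qt0 => Hsub.
  have H1 : n%:R * sg_form_at t f f <= t0 * q t.
    by rewrite qt mulrA ler_wpM2r.
  have := Hd _ tp td => H2.
  have : t0 * (sup S - e) < t0 * q t.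
    by rewrite mulrBr in H2; lra.
  by rewrite ltr_pM2l.
have Ff : F f by apply/(sg_domain sg Lf); apply/cvg_ex; exists (sup S).
split=> //; have -> : E f f = sup S.
  by apply: (cvg_unique _ (sg_form sg Ff Ff) cq).
by apply: ge_sup => // _ [t t0 <-]; exact: qC.
Qed.

Lemma sg_F t f : 0 <= t -> F f -> F (P t f) /\ E (P t f) (P t f) <= E f f.
Proof.
move=> t0 Ff; have Lf := form_L2 form Ff; apply: form_of_sg_form_at.
- exact: (sg_L2 sg).
- exact: (form_ge0 form).
- move=> h h0; apply: le_trans (sg_form_at_le_form Ff h0).
  by apply: sg_form_at_contraction => //; exact: ltW.
Qed.

End dirichlet_semigroup.

(** * Real analysis: null sequences and one-sided Dini estimates *)

Section real_lemmas.
Context {R : realType}.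

Lemma cvg_seqP (a : nat -> R) (l : R) :
  (a n @[n --> \oo] --> l) <->
  forall e, 0 < e -> exists N, forall n, (N <= n)%N -> `|a n - l| < e.
Proof.
split.
- move=> /cvgrPdist_lt H e e0; have [N _ HN] := H e e0.
  by exists N => n Nn; rewrite distrC; exact: HN.
- move=> H; apply/cvgrPdist_lt => e e0; have [N HN] := H e e0.
  by exists N => // n /= Nn; rewrite distrC; exact: HN.
Qed.

Lemma sqr_cvg0 (a b : nat -> R) (c : R) : (forall n, a n ^+ 2 <= b n * c) ->
  b n @[n --> \oo] --> 0 -> a n @[n --> \oo] --> 0.
Proof.
move=> ab /cvg_seqP b0; apply/cvg_seqP => e e0.
have c1 : 0 < `|c| + 1 by rewrite ltr_wpDl.
have [N HN] := b0 (e ^+ 2 / (`|c| + 1)) (divr_gt0 (exprn_gt0 2 e0) c1).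
exists N => n Nn; have := HN n Nn; rewrite !subr0 ltr_pdivlMr // => H.
rewrite -(@ltr_pXn2r _ 2) // ?nnegrE ?ltW // -normrX.
apply: le_lt_trans H; rewrite ger0_norm ?sqr_ge0 //.
apply: le_trans (ab n) _; apply: le_trans (ler_norm _) _; rewrite normrM.
by rewrite ler_wpM2l // lerDl.
Qed.

Lemma squeeze_cvg0 (a b : nat -> R) : (forall n, 0 <= a n <= b n) ->
  b n @[n --> \oo] --> 0 -> a n @[n --> \oo] --> 0.
Proof.
move=> ab b0; apply: (squeeze_cvgr _ (cvg_cst 0) b0).
by apply: nearW => n; exact: ab.
Qed.

(** For fixed [e], the times up to which [w r <= w 0 + e * r] holds form an interval. The left
    condition puts its supremum into it, and the right condition pushes past any supremum below
    [t]. *)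
Lemma dini_nonincreasing (w : R -> R) :
  (forall t e, 0 < t -> 0 < e -> exists2 d, 0 < d &
     forall s, 0 <= s -> t - d < s -> s < t -> w t <= w s + e) ->
  (forall t e, 0 <= t -> 0 < e -> exists2 d, 0 < d &
     forall h, 0 < h -> h < d -> w (t + h) <= w t + e * h) ->
  forall t, 0 <= t -> w t <= w 0.
Proof.
move=> wl wr t t0; apply/ler_addgt0Pr => e' e'0.
have [e e0 het] : exists2 e, 0 < e & e * t <= e'.
  exists (e' / (t + 1)); first by rewrite divr_gt0 //; lra.
  by rewrite mulrAC ler_pdivrMr ?ler_pM2l //; lra.
apply: (@le_trans _ _ (w 0 + e * t)); last by rewrite lerD2l.
set S := [set s | 0 <= s <= t /\ forall r, 0 <= r <= s -> w r <= w 0 + e * r].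
have S0 : S 0.
  split; first by rewrite lexx.
  by move=> r /le_anti <-; rewrite mulr0 addr0.
have Sne : S !=set0 by exists 0.
have Sub : has_ubound S by exists t => s [/andP[]].
set s := sup S.
have st : s <= t by apply: sup_le_ub => // r [/andP[]].
have s0 : 0 <= s by apply: ub_le_sup.
have Slt r : 0 <= r -> r < s -> w r <= w 0 + e * r.
  move=> r0 rs; have [q [_ Hq] rq] := sup_gt Sne rs.
  by apply: Hq; rewrite r0 ltW.
have ws : w s <= w 0 + e * s.
  move: s0; rewrite le_eqVlt => /orP[/eqP <-|s0]; first by rewrite mulr0 addr0.
  apply/ler_addgt0Pr => e1 e10; have [d d0 Hd] := wl s e1 s0 e10.
  set r := Num.max (s / 2) (s - d / 2).
  have r0 : 0 <= r by rewrite le_max divr_ge0 // ltW.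
  have rs : r < s by rewrite gt_max; apply/andP; split; lra.
  have rd : s - d < r by rewrite lt_max; apply/orP; right; lra.
  have := Hd r r0 rd rs; have := Slt r r0 rs.
  have : e * r <= e * s by rewrite ler_pM2l // ltW.
  by lra.
have Ss : S s.
  split; first by rewrite s0.
  move=> r /andP[r0]; rewrite le_eqVlt => /orP[/eqP -> //|]; exact: (Slt r r0).
move: st; rewrite le_eqVlt => /orP[/eqP <- //|st].
have [d d0 Hd] := wr s e s0 e0.
set h := Num.min (d / 2) (t - s).
have h0 : 0 < h by rewrite lt_min; apply/andP; split; lra.
have hd : h < d by rewrite gt_min; apply/orP; left; lra.
have ht : s + h <= t.
  have : h <= t - s by rewrite ge_min lexx orbT.
  by lra.
suff : S (s + h) by move=> /(ub_le_sup Sub); rewrite -/s; lra.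
split; first by rewrite ht andbT; lra.
move=> r /andP[r0 rsh]; case: (leP r s) => [rs|sr].
  by case: Ss => _; apply; rewrite r0.
have := Hd (r - s); rewrite [s + _]addrC subrK => /(_ _ _) H.
have : w r <= w s + e * (r - s) by apply: H; lra.
by rewrite mulrBr; lra.
Qed.

(** [expR (- (A * t)) * (w t + C / A)] is nonincreasing; the shift by [C / A] makes the differential
    inequality homogeneous. *)
Lemma dini_gronwall (w : R -> R) (A C : R) : 0 < A -> 0 <= C ->
  (forall t, 0 <= t -> 0 <= w t) -> w 0 = 0 ->
  (forall t e, 0 < t -> 0 < e -> exists2 d, 0 < d &
     forall s, 0 <= s -> t - d < s -> s < t -> w t <= w s + e) ->
  (forall t e, 0 <= t -> 0 < e -> exists2 d, 0 < d &
     forall h, 0 < h -> h < d -> w (t + h) <= w t + (A * w t + C + e) * h) ->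
  forall t, 0 <= t -> w t <= C / A * expR (A * t).
Proof.
move=> A0 C0 w0 w00 wl wr t t0.
set W := fun t => expR (- (A * t)) * (w t + C / A).
have CA : 0 <= C / A by rewrite divr_ge0 // ltW.
have AC : A * (C / A) = C by rewrite mulrC divfK // gt_eqF.
have e1 r : 0 <= r -> expR (- (A * r)) <= 1.
  by move=> r0; rewrite -expR0 ler_expR oppr_le0 mulr_ge0 // ltW.
suff : W t <= W 0.
  rewrite /W w00 add0r mulr0 oppr0 expR0 mul1r expRN mulrC ler_pdivrMr ?expR_gt0 //.
  by lra.
apply: dini_nonincreasing t0 => {t} t e t0 e0.
- have e20 : 0 < e / 2 by lra.
  have [d1 d10 Hd1] := wl _ _ t0 e20.
  exists d1 => // s s0 sd st.
  have Hw := Hd1 s s0 sd st.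
  have ts : expR (- (A * t)) <= expR (- (A * s)).
    by rewrite ler_expR lerN2 ler_pM2l // ltW.
  have H1 : expR (- (A * t)) * (w t + C / A) <= expR (- (A * t)) * (w s + C / A + e).
    by rewrite ler_wpM2l ?expR_ge0 //; lra.
  have H2 : expR (- (A * t)) * (w s + C / A) <= expR (- (A * s)) * (w s + C / A).
    by rewrite ler_wpM2r // addr_ge0 // w0.
  have H3 : expR (- (A * t)) * e <= 1 * e by apply: ler_wpM2r; [exact: ltW | exact: e1 (ltW t0)].
  by rewrite /W; rewrite mulrDr in H1; lra.
- have [d d0 Hd] := wr _ _ t0 e0.
  exists d => // h h0 hd; have := Hd h h0 hd => H.
  have H1 : w (t + h) + C / A <= (1 + A * h) * (w t + C / A) + e * h.
    apply: (@le_trans _ _ (w t + (A * w t + C + e) * h + C / A)); first by rewrite lerD2r.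
    by rewrite -{1}AC; rewrite le_eqVlt; apply/orP; left; apply/eqP; ring.
  have H2 : expR (- (A * (t + h))) = expR (- (A * t)) * expR (- (A * h)).
    by rewrite -expRD; congr expR; ring.
  have H3 : expR (- (A * h)) * (1 + A * h) <= 1.
    rewrite expRN mulrC ler_pdivrMr ?expR_gt0 // mul1r.
    exact: expR_ge1Dx.
  have w1 : 0 <= w t + C / A by rewrite addr_ge0 // w0.
  rewrite /W H2.
  apply: (@le_trans _ _ (expR (- (A * t)) * (expR (- (A * h)) *
     ((1 + A * h) * (w t + C / A) + e * h)))).
    by rewrite -mulrA ler_wpM2l ?expR_ge0 // ler_wpM2l ?expR_ge0.
  rewrite mulrDr mulrA mulrDr lerD //.
    by rewrite ler_wpM2l ?expR_ge0 // -[leRHS]mul1r ler_wpM2r.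
  rewrite mulrA -[leRHS]mul1r; apply: ler_wpM2r; first by apply: mulr_ge0; exact: ltW.
  by rewrite -expRD -opprD -mulrDr; apply: e1; lra.
Qed.

End real_lemmas.

(** * Weak and strong convergence with respect to the forms *)

Section psd_limits.
Context {R : realType} {X : Type}.
Context (V : set (X -> R)) (B : (X -> R) -> (X -> R) -> R).
Hypothesis psdB : psd V B.

Lemma psd_cvg0 (u : nat -> X -> R) g : (forall n, V (u n)) -> V g ->
  B (u n) (u n) @[n --> \oo] --> 0 -> B (u n) g @[n --> \oo] --> 0.
Proof. by move=> Vu Vg; apply: sqr_cvg0 => n; exact: (psd_CS psdB). Qed.

Lemma psd_cvg (u : nat -> X -> R) f g : (forall n, V (u n)) -> V f -> V g ->
  B (fun x => u n x - f x) (fun x => u n x - f x) @[n --> \oo] --> 0 ->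
  B (u n) g @[n --> \oo] --> B f g.
Proof.
move=> Vu Vf Vg u0; apply/subr_cvg0.
have : B (fun x => u n x - f x) g @[n --> \oo] --> 0.
  by apply: (@psd_cvg0 (fun n x => u n x - f x)) => // n; exact: (psdV_sub psdB).
apply: cvg_trans; apply: near_eq_cvg; apply: nearW => n.
by rewrite (psdN1 psdB).
Qed.

Lemma psd_cvg_sqr (u : nat -> X -> R) f : (forall n, V (u n)) -> V f ->
  B (fun x => u n x - f x) (fun x => u n x - f x) @[n --> \oo] --> 0 ->
  B (u n) (u n) @[n --> \oo] --> B f f.
Proof.
move=> Vu Vf u0.
have H1 := psd_cvg Vu Vf Vf u0.
have : B (fun x => u n x - f x) (fun x => u n x - f x) + 2 * B (u n) f - B f f
   @[n --> \oo] --> 0 + 2 * B f f - B f f.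
  apply: cvgB; last exact: cvg_cst.
  by apply: cvgD => //; apply: cvgMl_tmp.
rewrite (_ : 0 + _ - _ = B f f); last by ring.
apply: cvg_trans; apply: near_eq_cvg; apply: nearW => n.
by rewrite (psd_sqrB psdB) //; ring.
Qed.

End psd_limits.

Section form_limits.
Context {R : realType} {X : pmetricType R} (m : borel_measure X R).
Context (F : set (X -> R)) (E : (X -> R) -> (X -> R) -> R).
Context (P : R -> (X -> R) -> (X -> R)).
Hypothesis form : dirichlet_form m F E.
Hypothesis sg : associated_semigroup m F E P.
Implicit Types (f g h u v : X -> R) (s t : R).

Let ipsd := inner_psd m.
Let epsd := form_psd form.
Let FL2 := form_L2 form.
Let bpsd t (t0 : 0 <= t) := sg_form_at_psd sg t0.

Definition L2_cvg (u : nat -> X -> R) f :=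
  inner m (fun x => u n x - f x) (fun x => u n x - f x) @[n --> \oo] --> 0.

Lemma form_defect_psd t : 0 < t -> psd F (fun f g => t * E f g - sg_form_at m P t f g).
Proof.
move=> t0; have bt := bpsd (ltW t0); split.
- exact: (form_lin form).
- move=> a f g h Ff Fg Fh.
  rewrite (psd_bilin epsd) // (psd_bilin bt) //; do ?exact: FL2.
  by ring.
- by move=> f g Ff Fg; rewrite (psd_sym epsd Ff Fg) (psd_sym bt (FL2 Ff) (FL2 Fg)).
- by move=> f Ff; rewrite subr_ge0; exact: (sg_form_at_le_form form sg).
Qed.

(* The nonnegative form [E - E^t] is small on [g] for small [t], and [E^t] is
   continuous on [L^2]. *)
Lemma form_weak_cvg0 (u : nat -> X -> R) g (C : R) : (forall n, F (u n)) ->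
  (forall n, E (u n) (u n) <= C) -> F g ->
  inner m (u n) (u n) @[n --> \oo] --> 0 -> E (u n) g @[n --> \oo] --> 0.
Proof.
move=> Fu EC Fg u0; apply/cvg_seqP => e e0.
have C0 : 0 <= C by apply: le_trans (EC 0%N); exact: (form_ge0 form).
(* Cauchy-Schwarz for the defect form bounds a square by [(t * C) * (t * dl)]; this [dl] brings it
   below [(t * (e / 2)) ^+ 2]. *)
pose dl := (e / 2) ^+ 2 / (C + 1).
have C1 : 0 < C + 1 by lra.
have dl0 : 0 < dl by rewrite divr_gt0 // exprn_gt0 // divr_gt0.
have [d d0 Hd] := sg_form_cvg sg Fg Fg dl0.
pose t := d / 2.
have t0 : 0 < t by rewrite divr_gt0.
have td : t < d by rewrite /t; lra.
have gdl : t * E g g - sg_form_at m P t g g <= t * dl.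
  have := Hd t t0 td; rewrite distrC ltr_distlC => /andP[H _].
  have -> : sg_form_at m P t g g = t * (t^-1 * sg_form_at m P t g g).
    by rewrite mulrA divff ?mul1r // gt_eqF.
  by rewrite -mulrBr ler_pM2l //; lra.
have bt := bpsd (ltW t0).
have b0 : sg_form_at m P t (u n) g @[n --> \oo] --> 0.
  apply: (psd_cvg0 bt) => [n||]; [exact: FL2 | exact: FL2 |].
  apply: (squeeze_cvg0 _ u0) => n; rewrite (psd_ge0 bt (FL2 (Fu n))) /=.
  exact: (sg_form_at_le sg (ltW t0) (FL2 (Fu n))).
have te0 : 0 < t * (e / 2) by rewrite mulr_gt0 // divr_gt0.
have /cvg_seqP/(_ _ te0)[N HN] := b0.
exists N => n Nn; rewrite subr0 -(ltr_pM2l t0) -{1}(gtr0_norm t0) -normrM.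
have D1 : `|t * E (u n) g - sg_form_at m P t (u n) g| <= t * (e / 2).
  have tp : 0 <= t * (e / 2) by exact: ltW.
  rewrite -(@ler_pXn2r _ 2) // ?nnegrE // -normrX ger0_norm ?sqr_ge0 //.
  apply: le_trans (psd_CS (form_defect_psd t0) (Fu n) Fg) _.
  apply: (@le_trans _ _ ((t * C) * (t * dl))).
    apply: ler_pM; do ?exact: (psd_ge0 (form_defect_psd t0)); last by [].
    rewrite lerBlDr; apply: (@le_trans _ _ (t * C)); first by rewrite ler_pM2l.
    by rewrite lerDl; exact/(psd_ge0 bt)/FL2.
  have -> : t * C * (t * dl) = (t * (e / 2)) ^+ 2 * (C / (C + 1)).
    by rewrite /dl; field; rewrite gt_eqF.
  by rewrite -[leRHS]mulr1 ler_wpM2l ?sqr_ge0 // ler_pdivrMr //; lra.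
have := HN n Nn; rewrite subr0 => D2.
have := ler_normD (t * E (u n) g - sg_form_at m P t (u n) g) (sg_form_at m P t (u n) g).
by rewrite subrK; lra.
Qed.

Lemma form_weak_cvg (u : nat -> X -> R) f g (C : R) : (forall n, F (u n)) ->
  (forall n, E (u n) (u n) <= C) -> F f -> F g -> L2_cvg u f ->
  E (u n) g @[n --> \oo] --> E f g.
Proof.
move=> Fu EC Ff Fg uf; apply/subr_cvg0.
have : E (fun x => u n x - f x) g @[n --> \oo] --> 0.
  apply: (@form_weak_cvg0 (fun n x => u n x - f x) g (2 * C + 2 * E f f)) => //.
  - by move=> n; exact: (psdV_sub epsd).
  - move=> n; apply: le_trans (psd_le_sub epsd (Fu n) Ff) _.
    by rewrite lerD2r ler_pM2l.
apply: cvg_trans; apply: near_eq_cvg; apply: nearW => n.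
by rewrite (psdN1 epsd).
Qed.

(** As in a Hilbert space, weak convergence and energies not exceeding the limit energy give strong
    convergence. The bounds [c n] are there because contractions yield inequalities for the
    energies, not their values. *)
Lemma form_strong_cvg (u : nat -> X -> R) f (c : nat -> R) (C : R) : (forall n, F (u n)) ->
  (forall n, E (u n) (u n) <= c n) -> (forall n, c n <= C) -> F f -> L2_cvg u f ->
  c n @[n --> \oo] --> E f f ->
  E (fun x => u n x - f x) (fun x => u n x - f x) @[n --> \oo] --> 0.
Proof.
move=> Fu Ec cC Ff uf cE.
have w : E (u n) f @[n --> \oo] --> E f f.
  by apply: (@form_weak_cvg _ f f C) => // n; exact: le_trans (Ec n) (cC n).
apply: (@squeeze_cvg0 _ _ (fun n => c n - 2 * E (u n) f + E f f)).
  move=> n; rewrite (psd_ge0 epsd) /=; last exact: (psdV_sub epsd).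
  by rewrite (psd_sqrB epsd) // lerD2r lerD2r.
have -> : 0 = E f f - 2 * E f f + E f f by ring.
apply: cvgD; last exact: cvg_cst.
by apply: cvgB => //; apply: cvgMl_tmp.
Qed.

(** The squared increment equals [2 * sg_form_at t f f - sg_form_at (t + t) f f], and the linear
    parts [2 * t * E f f] cancel. Quadratic terms thus disappear from right Dini derivatives. *)
Lemma sg_increment_small f (e : R) : F f -> 0 < e -> exists2 d, 0 < d &
  forall t, 0 < t -> t < d ->
    inner m (fun x => f x - P t f x) (fun x => f x - P t f x) <= e * t.
Proof.
move=> Ff e0; have Lf := FL2 Ff.
have e4 : 0 < e / 4 by rewrite divr_gt0.
have [d d0 Hd] := sg_form_cvg sg Ff Ff e4.
exists (d / 2); first by rewrite divr_gt0.
move=> t t0 td; have tn := ltW t0.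
have LP := sgL sg tn Lf.
rewrite (psd_sqrB ipsd) // -(inner_sgD sg) //.
have := Hd t t0; have := Hd (t + t).
rewrite !(sg_form_atE sg) ?addr_ge0 // => H2 H1.
have {}H1 : `|t^-1 * (inner m f f - inner m (P t f) f) - E f f| < e / 4 by apply: H1; lra.
have {}H2 : `|(t + t)^-1 * (inner m f f - inner m (P (t + t) f) f) - E f f| < e / 4.
  by apply: H2; lra.
rewrite (psd_sym ipsd Lf LP).
move: H1 H2; move: (inner m f f) (inner m (P t f) f) (inner m (P (t + t) f) f) => a b c.
rewrite !ltr_distl => /andP[_ H1] /andP[H2 _].
have {}H1 : a - b < t * (E f f + e / 4).
  by rewrite -ltr_pdivrMl.
have {}H2 : (t + t) * (E f f - e / 4) < a - c.
  by rewrite -ltr_pdivlMl // addr_gt0.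
by lra.
Qed.

Lemma sg_cvg0 f (e : R) : L2 m f -> 0 < e -> exists2 d, 0 < d &
  forall t, 0 < t -> t < d ->
    inner m (fun x => P t f x - f x) (fun x => P t f x - f x) < e.
Proof.
move=> Lf e0.
have /cvg_at_right0P/(_ _ e0)[d d0 Hd] := sg_continuous sg Lf.
exists d => // t t0 td; have := Hd t t0 td; rewrite subr0.
exact/le_lt_trans/ler_norm.
Qed.

(** [P t f - P s f] is [P s] applied to [P (t - s) f - f], so contractivity makes [d] independent of
    [s]. *)
Lemma sg_left_cvg f t (e : R) : L2 m f -> 0 < e -> exists2 d, 0 < d &
  forall s, 0 <= s -> t - d < s -> s < t ->
    inner m (fun x => P t f x - P s f x) (fun x => P t f x - P s f x) < e.
Proof.
move=> Lf e0; have [d d0 Hd] := sg_cvg0 Lf e0; exists d => // s s0 sd st.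
have ts : 0 <= t - s by lra.
have t0 : 0 <= t by lra.
have Lts := sgL sg ts Lf.
have tsp : 0 < t - s by lra.
have tsd : t - s < d by lra.
apply: le_lt_trans (Hd (t - s) tsp tsd).
have Ld := psdV_sub ipsd Lts Lf.
apply: le_trans (sg_contraction sg s0 Ld).
rewrite le_eqVlt; apply/orP; left; apply/eqP.
have Ltt := psdV_sub ipsd (sgL sg t0 Lf) (sgL sg s0 Lf).
have LPd := sgL sg s0 Ld.
have ae : {ae m, forall x, P t f x - P s f x = P s (fun x => P (t - s) f x - f x) x}.
  have H1 := ae_eq_onT (sg_lin sg (-1) s0 Lf Lts).
  have H2 := ae_eq_onT (sg_add sg s0 ts Lf).
  apply: ae_imp2 H2 H1 => x; rewrite addrC subrK => ->.
  rewrite (_ : (fun x0 => -1 * f x0 + P (t - s) f x0) = (fun x0 => P (t - s) f x0 - f x0)).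
    by move=> ->; ring.
  by apply/funext => y; ring.
by rewrite (inner_ae Ltt LPd Ltt ae) (psd_sym ipsd LPd Ltt) (inner_ae Ltt LPd LPd ae).
Qed.

End form_limits.

(** * Markov property of the semigroup *)

Section markov.
Context {R : realType} {X : pmetricType R} (m : borel_measure X R).
Context (F : set (X -> R)) (E : (X -> R) -> (X -> R) -> R).
Context (P : R -> (X -> R) -> (X -> R)).
Hypothesis form : dirichlet_form m F E.
Hypothesis sg : associated_semigroup m F E P.
Implicit Types (f g h u v : X -> R) (s t : R).

Let ipsd := inner_psd m.
Let epsd := form_psd form.
Let FL2 := form_L2 form.
Let sgL2 t f (t0 : 0 <= t) (Lf : L2 m f) := sgL sg t0 Lf.

Definition clip01 (r : R) := Num.min (Num.max r 0) 1.

Lemma clip01_itv r : 0 <= clip01 r <= 1.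
Proof. by rewrite /clip01 ge_min lexx orbT andbT le_min le_max lexx orbT ler01. Qed.

Lemma clip01_id r : 0 <= r <= 1 -> clip01 r = r.
Proof. by move=> /andP[r0 r1]; rewrite /clip01 max_l // min_l. Qed.

Lemma clip01_0 r : r <= 0 -> clip01 r = 0.
Proof. by move=> r0; rewrite /clip01 max_r // min_l. Qed.

Lemma clip01_1 r : 1 <= r -> clip01 r = 1.
Proof. by move=> r1; rewrite /clip01 max_l ?min_r // (le_trans ler01). Qed.

Lemma clip01_homo (a b : R) : a <= b -> clip01 a <= clip01 b.
Proof.
move=> ab; rewrite /clip01 le_min [X in _ && X]ge_min lexx orbT andbT ge_min.
by apply/orP; left; rewrite ge_max !le_max ab lexx orbT.
Qed.

Lemma clip01_le r : `|clip01 r| <= `|r|.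
Proof.
case/andP: (clip01_itv r) => c0 _; rewrite (ger0_norm c0) /clip01 ge_min ge_max.
by rewrite ler_norm normr_ge0.
Qed.

Lemma clip01_proj (a c : R) : 0 <= c <= 1 -> (a - clip01 a) ^+ 2 <= (a - c) ^+ 2.
Proof.
move=> /andP[c0 c1]; rewrite /clip01; case: (ltP a 0) => a0.
  by rewrite min_l ?ler01 // subr0 -sqrrN -[leRHS]sqrrN ler_pXn2r // ?nnegrE; lra.
case: (leP a 1) => a1; first by rewrite subrr expr0n /= sqr_ge0.
by rewrite ler_pXn2r // ?nnegrE; lra.
Qed.

Lemma measurable_clip01 f : measurable_fun [set: borel X] (f : borel X -> R) ->
  measurable_fun [set: borel X] ((fun x => clip01 (f x)) : borel X -> R).
Proof.
move=> mf; apply: measurable_minr => //; exact: measurable_maxr.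
Qed.

Lemma L2_clip01 f : L2 m f -> L2 m (fun x => clip01 (f x)).
Proof.
move=> Lf; apply: (L2_le _ _ Lf) => [|x]; last exact: clip01_le.
exact: (measurable_clip01 (L2_meas Lf)).
Qed.

Lemma form_clip01 f : F f -> F (fun x => clip01 (f x)).
Proof. by move=> /(form_markov form)[]. Qed.

Lemma form_clip01_le f : F f ->
  E (fun x => clip01 (f x)) (fun x => clip01 (f x)) <= E f f.
Proof. by move=> /(form_markov form)[]. Qed.

(* [clip01 f + e (f - clip01 f)] has the same truncation as [f] for [0 <= e <= 1]. *)
Lemma form_clip01_ge0 f : F f ->
  0 <= E (fun x => clip01 (f x)) (fun x => f x - clip01 (f x)).
Proof.
move=> Ff; have FT := form_clip01 Ff; have FD := psdV_sub epsd Ff FT.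
set a := E _ _; set b := E (fun x => f x - clip01 (f x)) (fun x => f x - clip01 (f x)).
have H (e : R) : 0 < e <= 1 -> 0 <= 2 * a + e * b.
  move=> /andP[e0 e1].
  have FG := psdV_add epsd FT (psdV_scale epsd e FD).
  have := form_clip01_le FG.
  rewrite (_ : (fun x => clip01 (clip01 (f x) + e * (f x - clip01 (f x)))) =
               (fun x => clip01 (f x))); last first.
    apply/funext => x; move: (f x) => r.
    case: (leP r 0) => r0.
      by rewrite (clip01_0 r0) add0r subr0 clip01_0 // pmulr_rle0.
    case: (leP r 1) => r1.
      by rewrite (@clip01_id r) ?subrr ?mulr0 ?addr0 ?clip01_id // (ltW r0).
    have er : 0 <= e * (r - 1) by rewrite mulr_ge0 //; lra.
    by rewrite (clip01_1 (ltW r1)) clip01_1 // lerDl.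
  rewrite (psd_sqrD epsd) //; last exact: (psdV_scale epsd).
  rewrite (psdZr epsd) // (psdZ epsd) //; last exact: (psdV_scale epsd).
  rewrite (psdZr epsd) // -/a -/b => H.
  have : 0 <= e * (2 * a + e * b) by lra.
  by rewrite pmulr_rge0.
have b0 : 0 <= b by exact: (psd_ge0 epsd).
rewrite leNgt; apply/negP => a0.
have b1 : 0 < b + 1 by lra.
pose e := Num.min 1 (- a / (b + 1)).
have e0 : 0 < e by rewrite lt_min ltr01 divr_gt0 // oppr_gt0.
have e1 : e <= 1 by rewrite ge_min lexx.
have := H e; rewrite e0 e1 => /(_ isT).
have : e * b <= - a.
  apply: (@le_trans _ _ (- a / (b + 1) * b)).
    by rewrite ler_wpM2r // ge_min lexx orbT.
  by rewrite mulrAC ler_pdivrMr // ler_wpM2l //; lra.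
by lra.
Qed.

(** This is the squared L^2 distance from [P t f] to the convex set of functions with values in
    [[0, 1]]; clipping is the projection onto that set. *)
Let dist t f := inner m (fun x => P t f x - clip01 (P t f x)) (fun x => P t f x - clip01 (P t f x)).

Lemma L2_sub_clip01 f : L2 m f -> L2 m (fun x => f x - clip01 (f x)).
Proof. by move=> Lf; apply: (psdV_sub ipsd) => //; exact: L2_clip01. Qed.

Lemma dist_le u v : L2 m u -> L2 m v -> {ae m, forall x, 0 <= v x <= 1} ->
  inner m (fun x => u x - clip01 (u x)) (fun x => u x - clip01 (u x)) <=
  inner m (fun x => u x - v x) (fun x => u x - v x).
Proof.
move=> Lu Lv v01; have Lc := L2_sub_clip01 Lu; have Ld := psdV_sub ipsd Lu Lv.
apply: inner_ae_le => //; apply: ae_imp v01 => x v01x; rewrite -!expr2.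
exact: clip01_proj.
Qed.

(** The distance to the convex set starts at 0. Taking the projection of [P t f] as competitor for
    [P (t + r) f] bounds its right derivative by [-2 * E u (u - clip01 u)] at [u = P t f], which is
    nonpositive. *)
Lemma sg_markov_F t f : 0 <= t -> F f -> (forall x, 0 <= f x <= 1) ->
  {ae m, forall x, 0 <= P t f x <= 1}.
Proof.
move=> t0 Ff f01; have Lf := FL2 Ff.
have clipae s : {ae m, forall x, 0 <= clip01 (P s f x) <= 1}.
  by apply: ae_all => x; exact: clip01_itv.
suff : dist t f <= 0.
  move=> H; have L := L2_sub_clip01 (sgL2 t0 Lf).
  have := inner_eq0 L; rewrite -/(dist t f) => /(_ _).
  have -> : dist t f = 0 by apply/eqP; rewrite eq_le H (psd_ge0 ipsd).
  move=> /(_ erefl); apply: ae_imp => x /eqP; rewrite subr_eq0 => /eqP ->.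
  exact: clip01_itv.
have d0 : dist 0 f = 0.
  apply/eqP; rewrite eq_le (psd_ge0 ipsd) ?andbT; last exact/L2_sub_clip01/sgL2.
  have L0 := sgL2 (lexx 0) Lf.
  apply: (@le_trans _ _ (inner m (fun x => P 0 f x - f x) (fun x => P 0 f x - f x))).
    by apply: dist_le => //; exact: ae_all.
  rewrite (@inner_ae _ _ _ _ (fun=> 0)).
  - by rewrite (psd0 ipsd) //; exact: (psdV_sub ipsd).
  - exact: (psdV_sub ipsd).
  - exact: (psdV_0 ipsd Lf).
  - exact: (psdV_sub ipsd).
  - by apply: ae_imp (ae_eq_onT (sg_0 sg Lf)) => x ->; rewrite subrr.
rewrite -d0; apply: (@dini_nonincreasing _ (fun t => dist t f)) t0 => {t} t e t0 e0.
- set M := inner m f f + 1.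
  have M0 : 0 < M by have := psd_ge0 ipsd Lf; rewrite /M; lra.
  (* [dist s f] is at most [inner m f f < M], so Young's inequality with this parameter costs at
     most [e / 2]. *)
  set e1 := e / (2 * M).
  have e10 : 0 < e1 by rewrite divr_gt0 // mulr_gt0.
  have K0 : 0 < e1^-1 + 1 by rewrite addr_gt0 // invr_gt0.
  have e20 : 0 < e / 2 / (e1^-1 + 1) by rewrite !divr_gt0.
  have [d d0' Hd] := sg_left_cvg sg t Lf e20.
  exists d => // s s0 sd st; have := Hd s s0 sd st.
  have Lt := sgL2 (ltW t0) Lf; have Ls := sgL2 s0 Lf.
  have Lc := L2_sub_clip01 Ls; have Ld := psdV_sub ipsd Lt Ls.
  move=> H; rewrite ltr_pdivlMr // in H.
  have := dist_le Lt (L2_clip01 Ls) (clipae s).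
  rewrite (_ : (fun x => P t f x - clip01 (P s f x)) =
    (fun x => (P s f x - clip01 (P s f x)) + (P t f x - P s f x))); last first.
    by apply/funext => x; ring.
  rewrite (psd_sqrD ipsd Lc Ld) -/(dist t f) -/(dist s f) => H1.
  have := psd_young ipsd e10 Lc Ld; rewrite -/(dist s f) => H2.
  have H3 : e1 * dist s f <= e / 2.
    apply: (@le_trans _ _ (e1 * M)).
      rewrite ler_pM2l //; apply: (@le_trans _ _ (inner m f f)); last by rewrite /M; lra.
      apply: le_trans (sg_contraction sg s0 Lf).
      apply: le_trans (dist_le Ls (psdV_0 ipsd Lf) _) _; first by apply: ae_all => x; rewrite lexx ler01.
      by rewrite le_eqVlt; apply/orP; left; apply/eqP; congr inner; apply/funext => x; rewrite subr0.
    by rewrite /e1 le_eqVlt; apply/orP; left; apply/eqP; field; rewrite gt_eqF.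
  have H4 := ler_norm (inner m (fun x => P s f x - clip01 (P s f x)) (fun x => P t f x - P s f x)).
  by lra.
- have [Fu _] := sg_F form sg t0 Ff.
  have Lu := FL2 Fu; have Fc := form_clip01 Fu; have Fd := psdV_sub epsd Fu Fc.
  have Ld := FL2 Fd.
  have e2 : 0 < e / 2 by rewrite divr_gt0.
  have e4 : 0 < e / 4 by rewrite divr_gt0.
  have [d1 d10 Hd1] := sg_increment_small form sg Fu e2.
  have [d2 d20 Hd2] := sg_form_cvg sg Fu Fd e4.
  exists (Num.min d1 d2) => [|r r0]; first by rewrite lt_min d10.
  rewrite lt_min => /andP[rd1 rd2].
  have := Hd1 r r0 rd1; have := Hd2 r r0 rd2.
  have tr : 0 <= t + r by rewrite addr_ge0 // ltW.
  have Lr := sgL2 (ltW r0) Lu; have Ltr := sgL2 tr Lf; have Lc := FL2 Fc.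
  have Li := psdV_sub ipsd Lu Lr.
  (* [E u (u - clip01 u)] is the sum of [E (clip01 u) (u - clip01 u)] and the energy of
     [u - clip01 u], both nonnegative. *)
  have Ege : 0 <= E (P t f) (fun x => P t f x - clip01 (P t f x)).
    have := form_clip01_ge0 Fu; have := psd_ge0 epsd Fd.
    by rewrite {1}(psdN1 epsd) //; lra.
  rewrite ltr_distl => /andP[H1 _] H2.
  have {}H1 : - (e / 4) * r < sg_form_at m P r (P t f) (fun x => P t f x - clip01 (P t f x)).
    by rewrite mulrC -ltr_pdivlMl //; apply: le_lt_trans H1; lra.
  have := dist_le Ltr Lc (clipae t); rewrite -/(dist (t + r) f).
  have Lq := psdV_sub ipsd Ltr Lc; have Lq' := psdV_sub ipsd Lr Lc.
  have ae : {ae m, forall x, P (t + r) f x - clip01 (P t f x) = P r (P t f) x - clip01 (P t f x)}.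
    by rewrite addrC; apply: ae_imp (ae_eq_onT (sg_add sg (ltW r0) t0 Lf)) => x ->.
  rewrite (inner_ae Lq Lq' Lq ae) (psd_sym ipsd Lq' Lq) (inner_ae Lq Lq' Lq' ae).
  rewrite (_ : (fun x => P r (P t f) x - clip01 (P t f x)) =
    (fun x => (P t f x - clip01 (P t f x)) - (P t f x - P r (P t f) x))); last first.
    by apply/funext => x; ring.
  rewrite (psd_sqrB ipsd Ld Li) -/(dist t f) (psd_sym ipsd Ld Li).
  rewrite -[inner m _ (fun x => P t f x - clip01 (P t f x))]/(sg_form_at m P r (P t f) _).
  by lra.
Qed.

Lemma sgB t f g : 0 <= t -> L2 m f -> L2 m g ->
  {ae m, forall x, P t (fun x => f x - g x) x = P t f x - P t g x}.
Proof.
move=> t0 Lf Lg; apply: ae_imp (ae_eq_onT (sg_lin sg (-1) t0 Lg Lf)) => x.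
rewrite (_ : (fun x0 => -1 * g x0 + f x0) = (fun x0 => f x0 - g x0)).
  by move=> ->; ring.
by apply/funext => y; ring.
Qed.

Lemma sg_norm_sub t f g : 0 <= t -> L2 m f -> L2 m g ->
  inner m (fun x => P t f x - P t g x) (fun x => P t f x - P t g x) <=
  inner m (fun x => f x - g x) (fun x => f x - g x).
Proof.
move=> t0 Lf Lg; have Ld := psdV_sub ipsd Lf Lg.
apply: le_trans (sg_contraction sg t0 Ld).
apply: inner_ae_le; do ?[exact: sgL2 | by apply: (psdV_sub ipsd); exact: sgL2].
by apply: ae_imp (sgB t0 Lf Lg) => x ->.
Qed.

(** By density [f] is approximated in L^2 by elements of [F]. Since [f] has values in [[0, 1]],
    clipping these brings them closer to [f]. *)
Lemma sg_markov t f : 0 <= t -> L2 m f -> {ae m, forall x, 0 <= f x <= 1} ->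
  {ae m, forall x, 0 <= P t f x <= 1}.
Proof.
move=> t0 Lf f01; have LP := sgL2 t0 Lf.
suff : dist t f <= 0.
  move=> H; have L := L2_sub_clip01 LP.
  have := inner_eq0 L; rewrite -/(dist t f) => /(_ _).
  have -> : dist t f = 0 by apply/eqP; rewrite eq_le H (psd_ge0 ipsd).
  move=> /(_ erefl); apply: ae_imp => x /eqP; rewrite subr_eq0 => /eqP ->.
  exact: clip01_itv.
apply/ler_addgt0Pr => e e0; rewrite add0r.
have [g Fg fg] := form_dense form Lf e0.
have Fc := form_clip01 Fg; have Lc := FL2 Fc; have Lg := FL2 Fg.
apply: (@le_trans _ _ (inner m (fun x => P t f x - P t (fun x => clip01 (g x)) x)
   (fun x => P t f x - P t (fun x => clip01 (g x)) x))).
  apply: dist_le => //; first exact: sgL2.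
  by apply: sg_markov_F => // x; exact: clip01_itv.
apply: le_trans (sg_norm_sub t0 Lf Lc) _; apply: le_trans (ltW fg).
apply: inner_ae_le; do ?exact: (psdV_sub ipsd).
apply: ae_imp f01 => x /= /andP[f0 f1].
rewrite -!expr2 /clip01; case: (ltP (g x) 0) => g0.
  by rewrite min_l ?ler01 // subr0 ler_pXn2r // ?nnegrE //; lra.
case: (leP (g x) 1) => // g1.
by rewrite -sqrrN -[leRHS]sqrrN ler_pXn2r // ?nnegrE; lra.
Qed.

End markov.

(** * Positivity, monotonicity and L^1 contractivity of the semigroup *)

Section positivity.
Context {R : realType} {X : pmetricType R} (m : borel_measure X R).
Context (F : set (X -> R)) (E : (X -> R) -> (X -> R) -> R).
Context (P : R -> (X -> R) -> (X -> R)).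
Hypothesis form : dirichlet_form m F E.
Hypothesis sg : associated_semigroup m F E P.
Implicit Types (f g h u v : X -> R) (s t : R).

Let ipsd := inner_psd m.
Let sgL2 t f (t0 : 0 <= t) (Lf : L2 m f) := sgL sg t0 Lf.
Notation meas f := (measurable_fun [set: borel X] (f : borel X -> R)).
Notation intble f := (m.-integrable [set: borel X] (fun x : borel X => (f x)%:E)).

Lemma L2_cvg_dominated (u : nat -> X -> R) f g : (forall n, L2 m (u n)) -> L2 m f ->
  L2 m g -> {ae m, forall x, forall n, `|u n x - f x| <= `|g x|} ->
  {ae m, forall x, u n x @[n --> \oo] --> f x} -> L2_cvg m u f.
Proof.
move=> Lu Lf Lg ug uf.
have Ld n := psdV_sub ipsd (Lu n) Lf.
have := @dominated_convergence _ _ _ m setT measurableT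
  (fun n (x : borel X) => ((u n x - f x) * (u n x - f x))%:E) (fun=> 0%E)
  (fun x : borel X => (g x ^+ 2)%:E).
have H1 n : measurable_fun setT (fun x : borel X => ((u n x - f x) * (u n x - f x))%:E).
  by apply/measurable_EFinP; apply: measurable_funM; exact: L2_meas.
have H2 : measurable_fun setT (fun x : borel X => 0%E : \bar R) by exact: measurable_cst.
have H3 : {ae m, forall x : borel X, setT x ->
    ((u n x - f x) * (u n x - f x))%:E @[n --> \oo] --> (0%E : \bar R)}.
  apply: ae_imp uf => x ux _; apply: cvg_EFin; first exact: nearW.
  have /subr_cvg0 ux0 := ux.
  by rewrite -(mulr0 0); exact: cvgM.
have H4 : {ae m, forall x : borel X, forall n, setT x ->
    (`|((u n x - f x) * (u n x - f x))%:E| <= (g x ^+ 2)%:E)%E}.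
  apply: ae_imp ug => x ux n _.
  rewrite lee_fin -expr2 ger0_norm ?sqr_ge0 // -(@ger0_norm _ (g x ^+ 2)) ?sqr_ge0 //.
  rewrite normrX -[leLHS]ger0_norm ?sqr_ge0 // normrX.
  by rewrite ler_pXn2r ?nnegrE.
move=> /(_ H1 H2 H3 (L2_sqr Lg) H4)[_ _].
rewrite integral0 => /(@fine_cvg _ _ _ _ _ 0); exact.
Qed.

Lemma L2_cvg_ge0 (u : nat -> X -> R) f : (forall n, L2 m (u n)) -> L2 m f ->
  (forall n, {ae m, forall x, 0 <= u n x}) -> L2_cvg m u f -> {ae m, forall x, 0 <= f x}.
Proof.
move=> Lu Lf u0 uf; pose g x := Num.max (- f x) 0.
have Lg : L2 m g.
  apply: (L2_le _ _ Lf) => [|x].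
    by apply: measurable_maxr => //; apply: measurable_funN; exact: (L2_meas Lf).
  by rewrite /g; case: (leP (- f x) 0) => _; rewrite ?normr0 ?normrN ?normr_ge0.
have H : inner m g g <= 0.
  apply: (cvgr_to_ge uf); apply: nearW => n.
  have Ld := psdV_sub ipsd (Lu n) Lf.
  apply: inner_ae_le => //; apply: ae_imp (u0 n) => x ux; rewrite /g -!expr2.
  case: (leP (- f x) 0) => [_|fx]; first by rewrite expr0n sqr_ge0.
  by rewrite ler_pXn2r // ?nnegrE; lra.
have H0 : inner m g g = 0 by apply/eqP; rewrite eq_le H (psd_ge0 ipsd).
apply: ae_imp (inner_eq0 Lg H0) => x; rewrite /g; case: (leP (- f x) 0); last by lra.
by rewrite oppr_le0.
Qed.

Lemma sg_cvg t (u : nat -> X -> R) f : 0 <= t -> (forall n, L2 m (u n)) -> L2 m f ->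
  L2_cvg m u f -> L2_cvg m (fun n => P t (u n)) (P t f).
Proof.
move=> t0 Lu Lf uf; apply: squeeze_cvg0 uf => n.
rewrite (sg_norm_sub sg) // andbT; apply: (psd_ge0 ipsd); apply: (psdV_sub ipsd);
  exact: sgL2.
Qed.

Lemma sgZ t (a : R) f : 0 <= t -> L2 m f ->
  {ae m, forall x, P t (fun x => a * f x) x = a * P t f x}.
Proof.
move=> t0 Lf; have L0 := psdV_0 ipsd Lf.
have H := ae_eq_onT (sg_lin sg a t0 Lf L0).
have H0 := sgB sg t0 Lf Lf.
apply: ae_imp2 H H0 => x.
rewrite (_ : (fun x0 => a * f x0 + 0) = (fun x0 => a * f x0)); last first.
  by apply/funext => y; rewrite addr0.
rewrite (_ : (fun x0 => f x0 - f x0) = (fun=> 0)); last first.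
  by apply/funext => y; rewrite subrr.
by move=> -> ->; rewrite subrr addr0.
Qed.

Lemma L2_minr f (c : R) : 0 <= c -> L2 m f -> L2 m (fun x => Num.min (f x) c).
Proof.
move=> c0 Lf; apply: (L2_le _ _ Lf) => [|x].
  by apply: measurable_minr => //; exact: (L2_meas Lf).
by case: (leP (f x) c) => // cf; rewrite !ger0_norm //; lra.
Qed.

(** The Markov property concerns values in [[0, 1]]: [f] is truncated at [n.+1], divided by [n.+1],
    and recovered as an L^2 limit. *)
Lemma sg_ge0 t f : 0 <= t -> L2 m f -> {ae m, forall x, 0 <= f x} ->
  {ae m, forall x, 0 <= P t f x}.
Proof.
move=> t0 Lf f0.
pose u (n : nat) x := Num.min (f x) n.+1%:R.
have Lu n : L2 m (u n) by apply: L2_minr.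
have uf : L2_cvg m u f.
  apply: (@L2_cvg_dominated _ _ f) => //.
    apply: ae_imp f0 => x fx n; rewrite /u; case: (leP (f x) n.+1%:R) => ?; first by rewrite subrr normr0 normr_ge0.
    have : (0 : R) <= n.+1%:R by [].
    by rewrite (ger0_norm fx) ler0_norm; lra.
  apply: ae_all => x; apply: cvg_near_cst.
  exists (Num.truncn (f x)) => // n /= nx; rewrite /u min_l //.
  apply/ltW/(lt_le_trans (truncnS_gt _)); by rewrite ler_nat ltnS.
apply: (L2_cvg_ge0 _ _ _ (sg_cvg t0 Lu Lf uf)) => [n||n]; do ?exact: sgL2.
have n0 : (0 : R) < n.+1%:R by [].
have Ln : L2 m (fun x => n.+1%:R^-1 * u n x) by exact: (psdV_scale ipsd).
have M : {ae m, forall x, 0 <= P t (fun x => n.+1%:R^-1 * u n x) x <= 1}.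
  apply: (sg_markov form sg) => //; apply: ae_imp f0 => x fx.
  rewrite mulrC ler_pdivrMr // mul1r ge_min lexx orbT andbT.
  by apply: divr_ge0 => //; rewrite le_min fx ler0n.
apply: ae_imp2 M (sgZ n.+1%:R^-1 t0 (Lu n)) => x /andP[+ _] E1.
by rewrite E1 pmulr_rge0 // invr_gt0.
Qed.

Lemma sg_mono t f g : 0 <= t -> L2 m f -> L2 m g -> {ae m, forall x, f x <= g x} ->
  {ae m, forall x, P t f x <= P t g x}.
Proof.
move=> t0 Lf Lg fg; have Ld := psdV_sub ipsd Lg Lf.
have d0 : {ae m, forall x, 0 <= g x - f x} by apply: ae_imp fg => x; rewrite subr_ge0.
by apply: ae_imp2 (sg_ge0 t0 Ld d0) (sgB sg t0 Lg Lf) => x + E1; rewrite E1 subr_ge0.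
Qed.

(** A constant need not lie in L^2. Its role is taken by the negative part of [f], which does and
    which stays below [c]. *)
Lemma sg_geN t f (c : R) : 0 <= t -> 0 <= c -> L2 m f -> {ae m, forall x, - c <= f x} ->
  {ae m, forall x, - c <= P t f x}.
Proof.
move=> t0; rewrite le_eqVlt => /orP[/eqP <-|c0] Lf fc.
  by rewrite oppr0 in fc *; exact: sg_ge0.
pose g x := Num.max (- f x) 0.
have Lg : L2 m g.
  apply: (L2_le _ _ Lf) => [|x].
    by apply: measurable_maxr => //; apply: measurable_funN; exact: (L2_meas Lf).
  by rewrite /g; case: (leP (- f x) 0) => _; rewrite ?normr0 ?normrN ?normr_ge0.
have Lc : L2 m (fun x => c^-1 * g x) by exact: (psdV_scale ipsd).
have Lcg : L2 m (fun x => (- c) * (c^-1 * g x)) by exact: (psdV_scale ipsd).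
have M : {ae m, forall x, 0 <= P t (fun x => c^-1 * g x) x <= 1}.
  apply: (sg_markov form sg) => //; apply: ae_imp fc => x fx.
  rewrite mulrC ler_pdivrMr // mul1r divr_ge0 ?(ltW c0) //=; last by rewrite le_max lexx orbT.
  by rewrite ge_max (ltW c0) andbT; lra.
have le : {ae m, forall x, (- c) * (c^-1 * g x) <= f x}.
  apply: ae_all => x; rewrite mulrA mulNr divff ?gt_eqF // mulN1r /g.
  by case: (leP (- f x) 0) => ?; lra.
have H := ae_imp2 _ (sg_mono t0 Lcg Lf le) (sgZ (- c) t0 Lc).
apply: ae_imp2 M (H _ (fun x A B => conj A B)) => x /andP[_ M1] [+ E1].
rewrite E1; apply: le_trans.
by rewrite mulNr lerN2 -[leRHS]mulr1 ler_pM2l.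
Qed.

(** The functions [h n] lie in L^2, take values in [[0, 1]] and increase to the indicator of
    [{q > 0}]. Symmetry moves [P t] onto [h n], where the Markov property bounds it by 1; monotone
    convergence concludes. *)
Lemma sg_L1 t w : 0 <= t -> L2 m w -> (forall x, 0 <= w x) -> intble w ->
  intble (P t w) /\ \int[m]_x P t w x <= \int[m]_x w x.
Proof.
move=> t0 Lw w0 Iw.
have LP := sgL2 t0 Lw.
have P0 := sg_ge0 t0 Lw (ae_all _ w0).
pose q x := `|P t w x|.
have mP := L2_meas LP.
have mq : meas q by exact: measurableT_comp.
have Lq : L2 m q by apply: (L2_le mq _ LP) => x; rewrite normr_id.
have qP : {ae m, forall x, q x = P t w x}.
  by apply: ae_imp P0 => x; rewrite /q => /ger0_norm.
pose h (n : nat) x := clip01 (n%:R * q x).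
have Lh n : L2 m (h n) by apply: L2_clip01; exact: (psdV_scale ipsd).
have hq n : (\int[m]_x (h n x * q x)%:E <= (\int[m]_x w x)%:E)%E.
  have -> : (\int[m]_x (h n x * q x)%:E)%E = (inner m (h n) q)%:E.
    by rewrite /inner /Rintegral fineK // integrable_fin_num // L2_int.
  rewrite lee_fin (psd_sym ipsd) // (inner_ae Lq LP (Lh n) qP) (sg_sym sg) //.
  apply: ae_le_Rintegral => //; first by apply: L2_int => //; exact: sgL2.
  have M : {ae m, forall x, 0 <= P t (h n) x <= 1}.
    by apply: (sg_markov form sg) => //; apply: ae_all => x; exact: clip01_itv.
  by apply: ae_imp M => x /andP[_ M1]; rewrite -[leRHS]mulr1 ler_wpM2l.
have Iq : (\int[m]_x (q x)%:E <= (\int[m]_x w x)%:E)%E.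
  have q0 x : 0 <= q x by exact: normr_ge0.
  have hc x : (h n x * q x)%:E @[n --> \oo] --> (q x)%:E.
    apply: cvg_near_cst; have := q0 x; rewrite le_eqVlt => /orP[/eqP <-|qx].
      by exists 0%N => // n _; rewrite mulr0.
    exists (Num.truncn (q x)^-1).+1 => // n /= Hn; rewrite /h clip01_1 ?mul1r //.
    rewrite -ler_pdivrMr // div1r; apply/ltW/(lt_le_trans (truncnS_gt _)).
    by rewrite ler_nat.
  rewrite (eq_integral (fun x : borel X => limn (fun n => (h n x * q x)%:E))); last first.
    by move=> x _; apply/esym/cvg_lim => //; exact: hc.
  have : (\int[m]_x (h n x * q x)%:E @[n --> \oo] -->
      \int[m]_x (limn (fun n => (h n x * q x)%:E)))%E.
    apply: cvg_monotone_convergence => //.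
    - move=> n; apply/measurable_EFinP; apply: measurable_funM => //.
      exact: (L2_meas (Lh n)).
    - move=> n x _; rewrite lee_fin mulr_ge0 // /h; by case/andP: (clip01_itv (n%:R * q x)).
    - move=> x _ i j ij; rewrite lee_fin ler_wpM2r // /h clip01_homo //.
      by rewrite ler_wpM2r // ler_nat.
  by move=> H; apply: (cvge_to_le H); apply: nearW => n; exact: hq.
have Iq' : intble q.
  apply/integrableP; split; first exact/measurable_EFinP.
  rewrite (eq_integral (fun x : borel X => (q x)%:E)) ?(le_lt_trans Iq) ?ltry //.
  by move=> x _; rewrite gee0_abs // lee_fin normr_ge0.
have IP : intble (P t w).
  apply/integrableP; split; first exact/measurable_EFinP.
  by rewrite (le_lt_trans Iq) ?ltry.
split => //.
rewrite -(ae_eq_Rintegral mq mP qP) /Rintegral.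
by rewrite -lee_fin fineK // integrable_fin_num.
Qed.

End positivity.

(** * Averaging pointwise inequalities under the semigroup *)

Section frozen_constants.
Context {R : realType} {X : pmetricType R} (m : borel_measure X R).
Context (F : set (X -> R)) (E : (X -> R) -> (X -> R) -> R).
Context (P : R -> (X -> R) -> (X -> R)).
Hypothesis form : dirichlet_form m F E.
Hypothesis sg : associated_semigroup m F E P.
Implicit Types (f g h u v : X -> R) (s t : R).

Let ipsd := inner_psd m.

Lemma continuous_ge0_rat (f : R -> R) : continuous f -> (forall q : rat, 0 <= f (ratr q)) ->
  forall x, 0 <= f x.
Proof.
move=> cf fq x; rewrite leNgt; apply/negP => fx.
have /cvgrPdist_lt/(_ (- f x)) H := cf x.
have fx' : 0 < - f x by rewrite oppr_gt0.
have [d /= d0 Hd] := H fx'.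
have [q] : exists q : rat, ratr q \in `]x - d, x + d[.
  by apply: rat_in_itvoo; rewrite ltrBlDr -addrA ltrDl addr_gt0.
rewrite in_itv /= => /andP[q1 q2].
have := Hd (ratr q); rewrite /ball_ /= ltr_distlC q1 q2 => /(_ isT).
rewrite ltr_distlC => /andP[_]; rewrite subrr.
by rewrite ltNge fq.
Qed.

Lemma continuous_sum (r : nat) (g : nat -> R -> R) : (forall k, continuous (g k)) ->
  continuous (fun p => \sum_(k < r) g k p).
Proof.
move=> cg; elim: r => [|r IH].
  rewrite (_ : (fun p => _) = cst 0); first by move=> p; exact: cvg_cst.
  by apply/funext => p; rewrite big_ord0.
rewrite (_ : (fun p => _) = (fun p => \sum_(k < r) g k p + g r p)).
  by move=> p; apply: cvgD; [exact: IH | exact: cg].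
by apply/funext => p; rewrite big_ord_recr.
Qed.

Lemma sg_sum t (r : nat) (a : nat -> R) (b : nat -> X -> R) : 0 <= t ->
  (forall k, L2 m (b k)) -> L2 m (fun x => \sum_(k < r) a k * b k x) /\
  {ae m, forall x, P t (fun x => \sum_(k < r) a k * b k x) x = \sum_(k < r) a k * P t (b k) x}.
Proof.
move=> t0 Lb; elim: r => [|r [Lr IH]].
  have -> : (fun x : X => \sum_(k < 0) a k * b k x) = (fun x => b 0%N x - b 0%N x).
    by apply/funext => x; rewrite big_ord0 subrr.
  split; first exact: (psdV_sub ipsd).
  by apply: ae_imp (sgB sg t0 (Lb 0%N) (Lb 0%N)) => x ->; rewrite big_ord0 subrr.
have -> : (fun x => \sum_(k < r.+1) a k * b k x) =
  (fun x => a r * b r x + \sum_(k < r) a k * b k x).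
  by apply/funext => x; rewrite big_ord_recr /= addrC.
split; first exact: (psd_lin ipsd).
apply: ae_imp2 IH (ae_eq_onT (sg_lin sg (a r) t0 (Lb r) Lr)) => x H1 ->.
by rewrite H1 big_ord_recr /= addrC.
Qed.

(* A pointwise inequality [0 <= c p + sum_k a_k p * b_k y] may be integrated in
   [y] against the (nonexistent) kernel of [P t] with [p] frozen; rational [p]
   suffice, so that [p] may then depend on [x]. *)
Lemma sg_frozen t (r : nat) (c : R -> R -> R) (a : nat -> R -> R -> R) (b : nat -> X -> R) :
  0 <= t -> (forall k, L2 m (b k)) ->
  (forall p q, 0 <= c p q) ->
  (forall p, continuous (c p)) -> (forall q, continuous (c^~ q)) ->
  (forall k p, continuous (a k p)) -> (forall k q, continuous (fun p => a k p q)) ->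
  (forall p q y, 0 <= c p q + \sum_(k < r) a k p q * b k y) ->
  {ae m, forall x, forall p q, 0 <= c p q + \sum_(k < r) a k p q * P t (b k) x}.
Proof.
move=> t0 Lb c0 cc1 cc2 ca1 ca2 H.
have Hpq p q : {ae m, forall x, 0 <= c p q + \sum_(k < r) a k p q * P t (b k) x}.
  have [Ls Es] := sg_sum r (fun k => a k p q) t0 Lb.
  have le : {ae m, forall x, - c p q <= \sum_(k < r) a k p q * b k x}.
    by apply: ae_all => x; rewrite -subr_ge0 opprK addrC.
  (* The sub-Markov property enters here: the term [c p q], constant in [y], survives averaging
     because it is nonnegative. *)
  apply: ae_imp2 Es (sg_geN form sg t0 (c0 p q) Ls le) => x ->.
  by rewrite -subr_ge0 opprK addrC.
(* Pairs of rationals are enumerated, so that a single null set serves all of them. *)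
have : {ae m, forall x, forall n : nat,
    if (unpickle n : option (rat * rat)) is Some w then
      0 <= c (ratr w.1) (ratr w.2) + \sum_(k < r) a k (ratr w.1) (ratr w.2) * P t (b k) x
    else true}.
  apply: ae_forall_nat => n; case: (unpickle n) => [w|]; last exact: ae_all.
  exact: Hpq.
apply: ae_imp => x Hx.
have Hq (w1 w2 : rat) : 0 <= c (ratr w1) (ratr w2) +
    \sum_(k < r) a k (ratr w1) (ratr w2) * P t (b k) x.
  by have := Hx (pickle (w1, w2)); rewrite pickleK.
have csum (g : nat -> R -> R) : (forall k, continuous (g k)) ->
    continuous (fun p => \sum_(k < r) g k p * P t (b k) x).
  move=> cg; apply: (@continuous_sum r (fun k p => g k p * P t (b k) x)) => k p.
  by apply: cvgMr_tmp; exact: cg.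
move=> p q; move: p.
apply: (@continuous_ge0_rat (fun p => c p q + \sum_(k < r) a k p q * P t (b k) x)).
  move=> p; apply: cvgD; first exact: cc2.
  by apply: (csum (fun k p => a k p q)).
move=> w1; move: q.
apply: (@continuous_ge0_rat (fun q => c (ratr w1) q +
  \sum_(k < r) a k (ratr w1) q * P t (b k) x)); last exact: Hq.
move=> q; apply: cvgD; first exact: cc1.
by apply: (csum (fun k q => a k (ratr w1) q)).
Qed.

End frozen_constants.

(** * Contractions and the carre du champ *)

Section contractions.
Context {R : realType} {X : pmetricType R} (m : borel_measure X R).
Context (F : set (X -> R)) (E : (X -> R) -> (X -> R) -> R).
Context (P : R -> (X -> R) -> (X -> R)).
Hypothesis form : dirichlet_form m F E.
Hypothesis sg : associated_semigroup m F E P.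
Implicit Types (f g h u v : X -> R) (s t : R).

Let ipsd := inner_psd m.
Let epsd := form_psd form.
Let FL2 := form_L2 form.
Let sgL2 t f (t0 : 0 <= t) (Lf : L2 m f) := sgL sg t0 Lf.
Notation intble f := (m.-integrable [set: borel X] (fun x : borel X => (f x)%:E)).

Lemma Rint_lin (a : R) f g : intble f -> intble g ->
  intble (fun x => a * f x + g x) /\
  \int[m]_x (a * f x + g x) = a * \int[m]_x f x + \int[m]_x g x.
Proof.
move=> If Ig; have Iaf : intble (fun x => a * f x).
  exact: (integrableZl measurableT a If).
split; first exact: (integrableD measurableT Iaf Ig).
by rewrite RintegralD ?RintegralZl.
Qed.

Definition lipschitz0 (L : R) (T : R -> R) :=
  T 0 = 0 /\ forall a b, `|T a - T b| <= L * `|a - b|.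

Lemma lipschitz0_le L T a : lipschitz0 L T -> `|T a| <= L * `|a|.
Proof. by move=> [T0 TL]; have := TL a 0; rewrite T0 !subr0. Qed.

Lemma lipschitz0_continuous L T : lipschitz0 L T -> continuous T.
Proof.
move=> [_ TL] a; apply/cvgrPdist_lt => e e0.
have L0 : 0 < `|L| + 1 by rewrite ltr_wpDl.
near=> b.
apply: le_lt_trans (TL a b) _.
apply: (@le_lt_trans _ _ ((`|L| + 1) * `|a - b|)).
  by rewrite ler_wpM2r // (le_trans (ler_norm L)) // lerDl.
rewrite mulrC -ltr_pdivlMr //; near: b.
by apply: cvgr_dist_lt => //; rewrite divr_gt0.
Unshelve. all: by end_near. Qed.

Lemma L2_lipschitz L T f : lipschitz0 L T -> L2 m f -> L2 m (fun x => T (f x)).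
Proof.
move=> TL Lf; apply: (@L2_le _ _ _ _ (fun x => L * f x)).
- apply: (measurableT_comp (f := T)); last exact: (L2_meas Lf).
  exact: (continuous_measurable_fun (lipschitz0_continuous TL)).
- move=> x; apply: le_trans (lipschitz0_le (f x) TL) _.
  by rewrite normrM ler_wpM2r // ler_norm.
- exact: (psdV_scale ipsd).
Qed.

Lemma L2_bmul f g M : L2 m f -> L2 m g -> (forall x, `|g x| <= M) ->
  L2 m (fun x => f x * g x).
Proof. by move=> Lf Lg; apply: L2_mul => //; exact: (L2_meas Lg). Qed.

Section contraction_of_f.
Variables (L M : R) (T : R -> R) (f : X -> R).
Hypothesis TL : lipschitz0 L T.
Hypothesis Lf : L2 m f.
Hypothesis fM : forall x, `|f x| <= M.

Let L0 : 0 <= L.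
Proof. by have := TL.2 1 0; rewrite subr0 normr1 mulr1; apply: le_trans. Qed.

Let defect x := L ^+ 2 * (f x * f x) - T (f x) * T (f x).

Let LTf : L2 m (fun x => T (f x)) := L2_lipschitz TL Lf.
Let Lff : L2 m (fun x => f x * f x) := L2_bmul Lf Lf fM.

Let TfM x : `|T (f x)| <= L * M.
Proof. by apply: le_trans (lipschitz0_le _ TL) _; rewrite ler_wpM2l. Qed.

Let LTff : L2 m (fun x => T (f x) * T (f x)) := L2_bmul LTf LTf TfM.

Let Ldefect : L2 m defect.
Proof. by apply: (psdV_sub ipsd) => //; exact: (psdV_scale ipsd). Qed.

Let defect_ge0 p : 0 <= L ^+ 2 * (p * p) - T p * T p.
Proof.
rewrite subr_ge0 -!expr2 -exprMn -(@ger0_norm _ (T p ^+ 2)) ?sqr_ge0 //.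
rewrite -[leRHS]ger0_norm ?sqr_ge0 // !normrX ler_pXn2r ?nnegrE // normrM (ger0_norm L0).
exact: lipschitz0_le.
Qed.

(** The inequality [(T (f x) - T (f y))^2 <= L^2 * (f x - f y)^2] is expanded and averaged in [y];
    the terms depending on one point alone make up [defect]. *)
Lemma sg_contraction_ae t : 0 <= t -> {ae m, forall x, 0 <= defect x + P t defect x
   - 2 * L ^+ 2 * (f x * P t f x) + 2 * (T (f x) * P t (fun x => T (f x)) x)}.
Proof.
move=> t0.
pose c (p q : R) := L ^+ 2 * (p * p) - T p * T p.
pose a k (p q : R) := nth 0 [:: 1; - (2 * L ^+ 2) * p; 2 * T p] k.
pose b k := nth (fun=> 0) [:: defect; f; (fun x => T (f x))] k.
have cT := lipschitz0_continuous TL.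
have Lb k : L2 m (b k).
  case: k => [|[|[|k]]] //=; rewrite /b /= nth_nil; exact: (psdV_0 ipsd Lf).
have H := @sg_frozen _ _ _ _ _ _ form sg t 3 c a b t0 Lb.
apply: ae_imp (H _ _ _ _ _ _) => [x /(_ (f x) 0)||p||k p|k q|p q y].
- rewrite !big_ord_recr big_ord0 /= /a /b /= /c /defect /=.
  by congr (is_true (0 <= _)); ring.
- by move=> p q; exact: defect_ge0.
- by move=> q; exact: cvg_cst.
- move=> q p; apply: cvgB; first by apply: cvgMl_tmp; exact: cvgM.
  by apply: cvgM; exact: cT.
- by case: k => [|[|[|k]]] q; exact: cvg_cst.
- case: k => [|[|[|k]]] p /=; rewrite /a /= ?nth_nil; do ?exact: cvg_cst.
    by apply: cvgMl_tmp.
  by apply: cvgMl_tmp; exact: cT.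
- rewrite !big_ord_recr big_ord0 /= /a /b /= /c /defect /=.
  have := defect_ge0 (p - f y).
  have [T0 TLe] := TL.
  have H1 : (T p - T (f y)) ^+ 2 <= L ^+ 2 * (p - f y) ^+ 2.
    rewrite -exprMn -(@ger0_norm _ (_ ^+ 2)) ?sqr_ge0 //.
    rewrite -[leRHS]ger0_norm ?sqr_ge0 // !normrX ler_pXn2r ?nnegrE // normrM (ger0_norm L0).
    exact: TLe.
  move=> _; move: H1; rewrite -subr_ge0.
  by congr (is_true (0 <= _)); ring.
Qed.

Lemma intble_defect : intble defect.
Proof.
have [+ _] := Rint_lin (- 1) (L2_int LTf LTf) (integrableZl measurableT (L ^+ 2) (L2_int Lf Lf)).
by congr (integrable _ _ _); apply/funext => x; congr EFin; rewrite /defect; ring.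
Qed.

(** On integrating the pointwise inequality, L^1 contractivity bounds the integral of [P t defect]
    by that of [defect], and what remains is twice the difference of the two sides. *)
Lemma sg_form_at_lipschitz t : 0 <= t ->
  sg_form_at m P t (fun x => T (f x)) (fun x => T (f x)) <= L ^+ 2 * sg_form_at m P t f f.
Proof.
move=> t0; have LP := sgL2 t0 Lf; have LPT := sgL2 t0 LTf.
have [IP PL] := sg_L1 form sg t0 Ldefect (fun x => defect_ge0 (f x)) intble_defect.
have Id := intble_defect.
have [I1 E1] := Rint_lin 1 IP Id.
have [I2 E2] := Rint_lin (- (2 * L ^+ 2)) (L2_int Lf LP) I1.
have [I3 E3] := Rint_lin 2 (L2_int LTf LPT) I2.
have : 0 <= \int[m]_x (2 * (T (f x) * P t (fun x => T (f x)) x) +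
  (- (2 * L ^+ 2) * (f x * P t f x) + (1 * P t defect x + defect x))).
  rewrite -[leLHS](_ : \int[m]_(x in [set: borel X]) 0 = 0); last first.
    by rewrite Rintegral_cst ?mul0r.
  apply: ae_le_Rintegral => //.
    exact: integrable0.
  apply: ae_imp (sg_contraction_ae t0) => x.
  by congr (is_true (0 <= _)); ring.
rewrite E3 E2 E1.
have Ed : \int[m]_x defect x = L ^+ 2 * inner m f f - inner m (fun x => T (f x)) (fun x => T (f x)).
  have [_ +] := Rint_lin (- 1) (L2_int LTf LTf) (integrableZl measurableT (L ^+ 2) (L2_int Lf Lf)).
  rewrite RintegralZl //; last exact: L2_int.
  rewrite -/(inner m f f) -/(inner m (fun x => T (f x)) (fun x => T (f x))) => H.
  have -> : defect = (fun x => -1 * (T (f x) * T (f x)) + L ^+ 2 * (f x * f x)).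
    by apply/funext => x; rewrite /defect; ring.
  by rewrite H; ring.
rewrite !(sg_form_atE sg) //.
rewrite (psd_sym ipsd LPT LTf) (psd_sym ipsd LP Lf).
rewrite -/(inner m f (P t f)) -/(inner m (fun x => T (f x)) (P t (fun x => T (f x)))).
by lra.
Qed.

(** The pointwise inequality is multiplied by [h >= 0] before it is integrated. Each side has the
    shape of [carre] with the approximating form in place of [E]. *)
Lemma sg_carre_lipschitz t h : 0 <= t -> L2 m h -> (forall x, 0 <= h x) ->
  (exists N, forall x, `|h x| <= N) ->
  sg_form_at m P t (fun x => T (f x)) (fun x => T (f x) * h x) -
    2^-1 * sg_form_at m P t (fun x => T (f x) * T (f x)) h <=
  L ^+ 2 * (sg_form_at m P t f (fun x => f x * h x) -
    2^-1 * sg_form_at m P t (fun x => f x * f x) h).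
Proof.
move=> t0 Lh h0 [N hN].
have LP := sgL2 t0 Lf; have LPT := sgL2 t0 LTf; have LPd := sgL2 t0 Ldefect.
have Lfh := L2_bmul Lf Lh hN; have LTh := L2_bmul LTf Lh hN.
have LPff := sgL2 t0 Lff; have LPTT := sgL2 t0 LTff.
have : 0 <= inner m defect h + inner m (P t defect) h
     - 2 * L ^+ 2 * inner m (P t f) (fun x => f x * h x)
     + 2 * inner m (P t (fun x => T (f x))) (fun x => T (f x) * h x).
  have [I1 E1] := Rint_lin 1 (L2_int LPd Lh) (L2_int Ldefect Lh).
  have [I2 E2] := Rint_lin (- (2 * L ^+ 2)) (L2_int LP Lfh) I1.
  have [I3 E3] := Rint_lin 2 (L2_int LPT LTh) I2.
  rewrite (_ : _ + _ = \int[m]_x (2 * (P t (fun x => T (f x)) x * (T (f x) * h x)) +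
    (- (2 * L ^+ 2) * (P t f x * (f x * h x)) + (1 * (P t defect x * h x) + defect x * h x)))).
    rewrite -[leLHS](_ : \int[m]_(x in [set: borel X]) 0 = 0); last first.
      by rewrite Rintegral_cst ?mul0r.
    apply: ae_le_Rintegral => //.
      exact: integrable0.
    apply: ae_imp (sg_contraction_ae t0) => x H.
    have := mulr_ge0 (h0 x) H.
    by congr (is_true (0 <= _)); ring.
  by rewrite E3 E2 E1 /inner; ring.
have -> : inner m (P t defect) h = L ^+ 2 * inner m (P t (fun x => f x * f x)) h -
    inner m (P t (fun x => T (f x) * T (f x))) h.
  rewrite -(psdZ ipsd) // -(psdN1 ipsd) //; last exact: (psdV_scale ipsd).
  apply: inner_ae => //.
    by apply: (psdV_sub ipsd) => //; exact: (psdV_scale ipsd).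
  have Lsc := psdV_scale ipsd (L ^+ 2) Lff.
  by apply: ae_imp2 (sgB sg t0 Lsc LTff) (sgZ sg (L ^+ 2) t0 Lff) => x + <-.
have -> : inner m defect h = L ^+ 2 * inner m (fun x => f x * f x) h -
    inner m (fun x => T (f x) * T (f x)) h.
  rewrite -(psdZ ipsd) // -(psdN1 ipsd) //; exact: (psdV_scale ipsd).
rewrite !(sg_form_atE sg) //.
have A1 : inner m f (fun x => f x * h x) = inner m (fun x => f x * f x) h by rewrite inner_mulA.
have A2 : inner m (fun x => T (f x)) (fun x => T (f x) * h x) =
  inner m (fun x => T (f x) * T (f x)) h by rewrite (inner_mulA m (fun x => T (f x))).
by rewrite A1 A2; lra.
Qed.

End contraction_of_f.

Lemma form_lipschitz (L M : R) T f : lipschitz0 L T -> F f -> (forall x, `|f x| <= M) ->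
  F (fun x => T (f x)) /\ E (fun x => T (f x)) (fun x => T (f x)) <= L ^+ 2 * E f f.
Proof.
move=> TL Ff fM; apply: (form_of_sg_form_at sg).
- exact: L2_lipschitz TL (FL2 Ff).
- by rewrite mulr_ge0 ?sqr_ge0 //; exact: (form_ge0 form).
- move=> t t0; apply: le_trans (sg_form_at_lipschitz TL (FL2 Ff) fM (ltW t0)) _.
  rewrite mulrCA ler_wpM2l ?sqr_ge0 //; exact: (sg_form_at_le_form form sg).
Qed.

(** Inequalities linear in the approximating forms pass to [E]; four terms cover both the
    contraction and the Leibniz inequality. *)
Lemma form_lim_ge0 (a1 a2 a3 a4 : R) f1 g1 f2 g2 f3 g3 f4 g4 :
  F f1 -> F g1 -> F f2 -> F g2 -> F f3 -> F g3 -> F f4 -> F g4 ->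
  (forall t, 0 < t -> 0 <= a1 * sg_form_at m P t f1 g1 + a2 * sg_form_at m P t f2 g2 +
     a3 * sg_form_at m P t f3 g3 + a4 * sg_form_at m P t f4 g4) ->
  0 <= a1 * E f1 g1 + a2 * E f2 g2 + a3 * E f3 g3 + a4 * E f4 g4.
Proof.
move=> F1 G1 F2 G2 F3 G3 F4 G4 H.
have C f g (a : R) : F f -> F g ->
    a * (t^-1 * sg_form_at m P t f g) @[t --> 0^'+] --> a * E f g.
  by move=> Ff Fg; apply: cvgMl_tmp; exact: (sg_form sg).
have H4 := cvgD (cvgD (cvgD (C _ _ a1 F1 G1) (C _ _ a2 F2 G2)) (C _ _ a3 F3 G3)) (C _ _ a4 F4 G4).
apply: (cvgr_to_ge (H4 _ _ _)).
near=> t.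
have t0 : 0 < t by near: t; exact: nbhs_right_gt.
have : 0 <= t^-1 * (a1 * sg_form_at m P t f1 g1 + a2 * sg_form_at m P t f2 g2 +
     a3 * sg_form_at m P t f3 g3 + a4 * sg_form_at m P t f4 g4).
  by rewrite mulr_ge0 ?invr_ge0 ?(ltW t0) // H.
by rewrite !fctE; congr (is_true (0 <= _)); ring.
Unshelve. all: by end_near. Qed.

(** The form expression of the integral of [g] against the energy measure of [f]. It makes sense for
    bounded [f] and [g] in [F] without continuity, and [energy_carre] identifies it with the
    integral for continuous [g]. *)
Definition carre f g := E f (fun x => f x * g x) - 2^-1 * E (fun x => f x * f x) g.

Definition bounded_by (M : R) f := forall x, `|f x| <= M.

Definition clipM (M r : R) := Num.max (- M) (Num.min r M).

Lemma clipM_le M r : 0 <= M -> `|clipM M r| <= M.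
Proof.
move=> M0; rewrite /clipM ler_norml le_max lexx /= ge_max ge_min lexx orbT andbT.
by lra.
Qed.

Lemma clipM_id M r : `|r| <= M -> clipM M r = r.
Proof. by rewrite ler_norml => /andP[r1 r2]; rewrite /clipM min_l // max_r. Qed.

Lemma clipM_lipschitz M : 0 <= M -> lipschitz0 1 (clipM M).
Proof.
move=> M0; split; first by rewrite clipM_id // normr0.
suff H a b : a <= b -> `|clipM M a - clipM M b| <= 1 * `|a - b|.
  move=> a b; case: (leP a b) => [|/ltW] ab; first exact: H.
  by rewrite distrC [`|a - b|]distrC; exact: H.
move=> ab; rewrite mul1r /clipM.
rewrite [`|a - b|]distrC (@ger0_norm _ (b - a)) ?subr_ge0 // ler_norml.
by case: (leP a M) => aM; case: (leP b M) => bM;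
  do 2?[case: (leP (- M) _) => ?]; apply/andP; split; lra.
Qed.

(** Squaring is not globally Lipschitz; clipping first leaves bounded functions unchanged and makes
    the contraction property apply. *)
Lemma sqr_clipM_lipschitz M : 0 <= M -> lipschitz0 (2 * M) (fun r => clipM M r * clipM M r).
Proof.
move=> M0; have [T0 TL] := clipM_lipschitz M0.
split; first by rewrite T0 mulr0.
move=> a b; have -> : clipM M a * clipM M a - clipM M b * clipM M b =
  (clipM M a + clipM M b) * (clipM M a - clipM M b) by ring.
rewrite normrM; apply: ler_pM => //; last by have := TL a b; rewrite mul1r.
apply: le_trans (ler_normD _ _) _.
by have := clipM_le a M0; have := clipM_le b M0; lra.
Qed.

Lemma form_sqr M f : 0 <= M -> F f -> bounded_by M f ->
  F (fun x => f x * f x) /\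
  E (fun x => f x * f x) (fun x => f x * f x) <= (2 * M) ^+ 2 * E f f.
Proof.
move=> M0 Ff fM; have := form_lipschitz (sqr_clipM_lipschitz M0) Ff fM.
rewrite (_ : (fun x => clipM M (f x) * clipM M (f x)) = (fun x => f x * f x)) //.
by apply/funext => x; rewrite clipM_id.
Qed.

Lemma form_mul M N f g : 0 <= M -> 0 <= N -> F f -> F g -> bounded_by M f -> bounded_by N g ->
  F (fun x => f x * g x) /\
  E (fun x => f x * g x) (fun x => f x * g x) <= (M + N) ^+ 2 * (E f f + E g g).
Proof.
move=> M0 N0 Ff Fg fM gN.
have MN : 0 <= M + N by exact: addr_ge0.
have [Fp Ep] := form_sqr MN (psdV_add epsd Ff Fg)
  (fun x => le_trans (ler_normD _ _) (lerD (fM x) (gN x))).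
have [Fm Em] := form_sqr MN (psdV_sub epsd Ff Fg)
  (fun x => le_trans (ler_normB _ _) (lerD (fM x) (gN x))).
have -> : (fun x => f x * g x) = (fun x => 4^-1 * ((f x + g x) * (f x + g x)) -
   4^-1 * ((f x - g x) * (f x - g x))).
  by apply/funext => x; field.
have Fp4 := psdV_scale epsd 4^-1 Fp; have Fm4 := psdV_scale epsd 4^-1 Fm.
split; first exact: (psdV_sub epsd).
apply: le_trans (psd_le_sub epsd Fp4 Fm4) _.
rewrite !(psdZ epsd) // !(psdZr epsd) //.
have H1 := psd_le_add epsd Ff Fg; have H2 := psd_le_sub epsd Ff Fg.
have S1 := psd_sqrD epsd Ff Fg; have S2 := psd_sqrB epsd Ff Fg.
have K0 : 0 <= (M + N) ^+ 2 by exact: sqr_ge0.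
have K1 : (2 * (M + N)) ^+ 2 * (E (fun x => f x + g x) (fun x => f x + g x) +
   E (fun x => f x - g x) (fun x => f x - g x)) = 8 * ((M + N) ^+ 2 * (E f f + E g g)).
  by rewrite S1 S2; ring.
by rewrite mulrDr in K1; lra.
Qed.

Lemma carre_lipschitz (L M N : R) T f h : lipschitz0 L T -> F f -> bounded_by M f ->
  F h -> bounded_by N h -> (forall x, 0 <= h x) -> 0 <= M -> 0 <= N ->
  carre (fun x => T (f x)) h <= L ^+ 2 * carre f h.
Proof.
move=> TL Ff fM Fh hN h0 M0 N0.
have [FT _] := form_lipschitz TL Ff fM.
have L0 : 0 <= L by have := TL.2 1 0; rewrite subr0 normr1 mulr1; apply: le_trans.
have LM : 0 <= L * M by exact: mulr_ge0.
have TM : bounded_by (L * M) (fun x => T (f x)).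
  by move=> x; apply: le_trans (lipschitz0_le _ TL) _; rewrite ler_wpM2l.
have [Fff _] := form_sqr M0 Ff fM; have [FTT _] := form_sqr LM FT TM.
have [Ffh _] := form_mul M0 N0 Ff Fh fM hN; have [FTh _] := form_mul LM N0 FT Fh TM hN.
have := @form_lim_ge0 (L ^+ 2) (- (L ^+ 2 / 2)) (- 1) 2^-1 _ _ _ _ _ _ _ _
  Ff Ffh Fff Fh FT FTh FTT Fh.
rewrite /carre => H; rewrite -subr_ge0.
suff : 0 <= L ^+ 2 * E f (fun x => f x * h x) + - (L ^+ 2 / 2) * E (fun x => f x * f x) h +
  -1 * E (fun x => T (f x)) (fun x => T (f x) * h x) +
   2^-1 * E (fun x => T (f x) * T (f x)) h by lra.
apply: H => t t0.
have := sg_carre_lipschitz TL (FL2 Ff) fM (ltW t0) (FL2 Fh) h0 (ex_intro _ N hN).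
by lra.
Qed.

End contractions.

(** * A Leibniz inequality *)

Section leibniz.
Context {R : realType} {X : pmetricType R} (m : borel_measure X R).
Context (F : set (X -> R)) (E : (X -> R) -> (X -> R) -> R).
Context (P : R -> (X -> R) -> (X -> R)).
Hypothesis form : dirichlet_form m F E.
Hypothesis sg : associated_semigroup m F E P.
Implicit Types (f g h u v : X -> R) (s t : R).

Let ipsd := inner_psd m.
Let epsd := form_psd form.
Let FL2 := form_L2 form.
Let sgL2 t f (t0 : 0 <= t) (Lf : L2 m f) := sgL sg t0 Lf.
Notation intble f := (m.-integrable [set: borel X] (fun x : borel X => (f x)%:E)).

Section sg_version.
Variables (M N : R) (v psi : X -> R).
Hypotheses (Lv : L2 m v) (Lpsi : L2 m psi).
Hypotheses (vM : bounded_by M v) (psiN : bounded_by N psi).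

Let v2 x := v x * v x.
Let psi2 x := psi x * psi x.
Let Lv2 : L2 m v2 := L2_bmul Lv Lv vM.
Let Lpsi2 : L2 m psi2 := L2_bmul Lpsi Lpsi psiN.
Let v2M x : `|v2 x| <= M * M.
Proof. by rewrite normrM ler_pM. Qed.
Let psi2N x : `|psi2 x| <= N * N.
Proof. by rewrite normrM ler_pM. Qed.
Let Lvpsi2 : L2 m (fun x => v x * psi2 x) := L2_bmul Lv Lpsi2 psi2N.
Let Lpsiv2 : L2 m (fun x => psi x * v2 x) := L2_bmul Lpsi Lv2 v2M.
Let w x := 7 / 4 * (v2 x * psi2 x).
Let Lw : L2 m w := psdV_scale ipsd (7 / 4) (L2_bmul Lv2 Lpsi2 psi2N).
Let w0 x : 0 <= w x.
Proof. by rewrite /w /v2 /psi2 -!expr2; apply: mulr_ge0; [lra | rewrite mulr_ge0 ?sqr_ge0]. Qed.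
Let Iw : intble w := integrableZl measurableT (7 / 4) (L2_int Lv2 Lpsi2).

(* The integrand is [((p-b)(q+d) + 2(q-d)(p+b))^2 / 8 + 5 (p-b)^2 (q-d)^2 / 8]
   at [p = v x], [q = psi x], [b = v y], [d = psi y]. *)
Let leibniz_ae t : 0 <= t -> {ae m, forall x, 0 <= w x + (P t w x
  + (- 2^-1 * (v x * P t (fun x => v x * psi2 x) x)
  + (- 2^-1 * ((v x * psi2 x) * P t v x)
  + (- 2 * (psi x * P t (fun x => psi x * v2 x) x)
  + (- 2 * ((psi x * v2 x) * P t psi x)
  + (3 / 4 * (v2 x * P t psi2 x)
  + 3 / 4 * (psi2 x * P t v2 x)))))))}.
Proof.
move=> t0.
(* [7/4 = 9/8 + 5/8] is the coefficient of [p^2 * q^2] in the integrand, that is, its value at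
   [b = d = 0]. *)
pose c (p q : R) := 7 / 4 * ((p * p) * (q * q)).
pose a k (p q : R) := nth 0 [:: 1; - 2^-1 * p; - 2^-1 * (p * (q * q)); - 2 * q;
  - 2 * (q * (p * p)); 3 / 4 * (p * p); 3 / 4 * (q * q)] k.
pose b k := nth (fun=> 0) [:: w; (fun x => v x * psi2 x); v; (fun x => psi x * v2 x);
  psi; psi2; v2] k.
have Lb k : L2 m (b k).
  do 7?[case: k => [|k]] => //=; rewrite /b /= nth_nil; exact: (psdV_0 ipsd Lv).
have H := @sg_frozen _ _ _ _ _ _ form sg t 7 c a b t0 Lb.
have sq : continuous (fun p : R => p * p) by move=> p; exact: cvgM.
apply: ae_imp (H _ _ _ _ _ _) => [x /(_ (v x) (psi x))|p q|p q|q p|k p q|k q p|p q y].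
- rewrite !big_ord_recr big_ord0 /= /a /b /= /c /w /v2 /psi2.
  by congr (is_true (0 <= _)); ring.
- by rewrite /c -!expr2; apply: mulr_ge0; [lra | rewrite mulr_ge0 ?sqr_ge0].
- by apply: cvgMl_tmp; apply: cvgMl_tmp; exact: sq.
- by apply: cvgMl_tmp; apply: cvgMr_tmp; exact: sq.
- do 7?[case: k => [|k]]; rewrite /a /= ?nth_nil; do ?exact: cvg_cst;
    apply: cvgMl_tmp; do ?exact: sq; do ?exact: cvg_id.
    by apply: cvgMl_tmp; exact: sq.
  by apply: cvgMr_tmp; exact: cvg_id.
- do 7?[case: k => [|k]]; rewrite /a /= ?nth_nil; do ?exact: cvg_cst;
    apply: cvgMl_tmp; do ?exact: sq; do ?exact: cvg_id.
    by apply: cvgMr_tmp; exact: cvg_id.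
  by apply: cvgMl_tmp; exact: sq.
- rewrite !big_ord_recr big_ord0 /= /a /b /= /c /w /v2 /psi2.
  move: (v y) (psi y) => b' d.
  have : 0 <= 8^-1 * ((p - b') * (q + d) + 2 * ((q - d) * (p + b'))) ^+ 2 +
     5 / 8 * ((p - b') * (q - d)) ^+ 2.
    by rewrite addr_ge0 // mulr_ge0 ?sqr_ge0.
  by congr (is_true (0 <= _)); field.
Qed.

Lemma sg_leibniz t : 0 <= t ->
  0 <= 2^-1 * sg_form_at m P t v (fun x => v x * psi2 x) +
    2 * sg_form_at m P t psi (fun x => psi x * v2 x) +
    - (3 / 4) * sg_form_at m P t v2 psi2.
Proof.
move=> t0.
have [IP PL] := sg_L1 form sg t0 Lw w0 Iw.
have Lp := sgL2 t0 Lvpsi2; have LPv := sgL2 t0 Lv; have Lq := sgL2 t0 Lpsiv2.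
have LPp := sgL2 t0 Lpsi; have LPp2 := sgL2 t0 Lpsi2; have LPv2 := sgL2 t0 Lv2.
have [I1 E1] := Rint_lin 1 IP Iw.
have [I2 E2] := Rint_lin (- 2^-1) (L2_int Lv Lp) I1.
have [I3 E3] := Rint_lin (- 2^-1) (L2_int Lvpsi2 LPv) I2.
have [I4 E4] := Rint_lin (- 2) (L2_int Lpsi Lq) I3.
have [I5 E5] := Rint_lin (- 2) (L2_int Lpsiv2 LPp) I4.
have [I6 E6] := Rint_lin (3 / 4) (L2_int Lv2 LPp2) I5.
have [I7 E7] := Rint_lin (3 / 4) (L2_int Lpsi2 LPv2) I6.
have : 0 <= \int[m]_x (3 / 4 * (psi2 x * P t v2 x) + (3 / 4 * (v2 x * P t psi2 x) +
  (- 2 * ((psi x * v2 x) * P t psi x) + (- 2 * (psi x * P t (fun x => psi x * v2 x) x) +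
  (- 2^-1 * ((v x * psi2 x) * P t v x) + (- 2^-1 * (v x * P t (fun x => v x * psi2 x) x) +
  (1 * P t w x + w x))))))).
  rewrite -[leLHS](_ : \int[m]_(x in [set: borel X]) 0 = 0); last first.
    by rewrite Rintegral_cst ?mul0r.
  apply: ae_le_Rintegral => //.
    exact: integrable0.
  apply: ae_imp (leibniz_ae t0) => x.
  by congr (is_true (0 <= _)); ring.
rewrite E7 E6 E5 E4 E3 E2 E1.
have Ew : \int[m]_x w x = 7 / 4 * inner m v2 psi2.
  by rewrite /w RintegralZl //; exact: L2_int.
rewrite -/(inner m psi2 (P t v2)) -/(inner m v2 (P t psi2)).
rewrite -/(inner m (fun x => psi x * v2 x) (P t psi)).
rewrite -/(inner m psi (P t (fun x => psi x * v2 x))).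
rewrite -/(inner m v (P t (fun x => v x * psi2 x))).
rewrite -/(inner m (fun x => v x * psi2 x) (P t v)).
rewrite !(sg_form_atE sg) //.
rewrite (psd_sym ipsd Lpsi2 LPv2) -(sg_sym sg t0 Lv2 Lpsi2).
rewrite (psd_sym ipsd Lpsiv2 LPp) -(sg_sym sg t0 Lpsi Lpsiv2).
rewrite (psd_sym ipsd Lvpsi2 LPv) -(sg_sym sg t0 Lv Lvpsi2).
have B1 : inner m v (fun x => v x * psi2 x) = inner m v2 psi2 by rewrite inner_mulA.
have B2 : inner m psi (fun x => psi x * v2 x) = inner m v2 psi2.
  by rewrite (psd_sym ipsd Lv2 Lpsi2) (inner_mulA m psi).
by rewrite B1 B2 Ew in PL *; lra.
Qed.

End sg_version.

(* Without locality the identity [E(v, v psi^2) = int psi^2 dGamma(v) +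
   2 int psi v dGamma(v, psi)] fails, but the lower bound that Cauchy-Schwarz
   gives for its right-hand side survives, with the same constants. *)
Lemma form_leibniz (M N : R) v psi : 0 <= M -> 0 <= N ->
  F v -> F psi -> bounded_by M v -> bounded_by N psi ->
  2^-1 * carre E v (fun x => psi x * psi x) - 2 * carre E psi (fun x => v x * v x) <=
  E v (fun x => v x * (psi x * psi x)).
Proof.
move=> M0 N0 Fv Fp vM pN.
have [Fvv _] := form_sqr form sg M0 Fv vM; have [Fpp _] := form_sqr form sg N0 Fp pN.
have vvM : bounded_by (M * M) (fun x => v x * v x) by move=> x; rewrite normrM ler_pM.
have ppN : bounded_by (N * N) (fun x => psi x * psi x) by move=> x; rewrite normrM ler_pM.
have [Fvpp _] := form_mul form sg M0 (mulr_ge0 N0 N0) Fv Fpp vM ppN.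
have [Fpvv _] := form_mul form sg N0 (mulr_ge0 M0 M0) Fp Fvv pN vvM.
have := @form_lim_ge0 _ _ _ _ _ _ sg 2^-1 2 (- (3 / 4)) 0 _ _ _ _ _ _ _ _
  Fv Fvpp Fp Fpvv Fvv Fpp Fv Fv.
rewrite mul0r addr0 => H; rewrite -subr_ge0 /carre.
rewrite (psd_sym epsd Fpp Fvv).
have : 0 <= 2^-1 * E v (fun x => v x * (psi x * psi x)) +
  2 * E psi (fun x => psi x * (v x * v x)) +
  - (3 / 4) * E (fun x => v x * v x) (fun x => psi x * psi x).
  apply: H => t t0; rewrite mul0r addr0.
  exact: (sg_leibniz (FL2 Fv) (FL2 Fp) vM pN (ltW t0)).
by lra.
Qed.

End leibniz.

(** * Locality *)

Section locality.
Context {R : realType} {X : pmetricType R} (m : borel_measure X R).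
Context (F : set (X -> R)) (E : (X -> R) -> (X -> R) -> R).
Context (P : R -> (X -> R) -> (X -> R)).
Hypothesis form : dirichlet_form m F E.
Hypothesis sg : associated_semigroup m F E P.
Hypothesis form_local : strongly_local m F E.
Context (Gamma : (X -> R) -> borel_measure X R).
Hypothesis energy : energy_measure m F E Gamma.
Implicit Types (f g h u v : X -> R) (s t : R).

Let ipsd := inner_psd m.
Let epsd := form_psd form.
Let FL2 := form_L2 form.
Notation meas f := (measurable_fun [set: borel X] (f : borel X -> R)).

Lemma continuous_meas f : continuous f -> meas f.
Proof.
move=> cf; apply: (measurability _ (RGenOInfty.measurableE R)).
move=> _ [_ [a ->] <-]; rewrite setTI; apply: sub_sigma_algebra.
by apply: open_comp; [move=> x _; exact: cf | by rewrite set_itvE; exact: open_gt].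
Qed.

Lemma open_meas (U : set X) : open U -> measurable (U : set (borel X)).
Proof. by move=> oU; exact: sub_sigma_algebra. Qed.

Lemma continuous_quasi_continuous f : continuous f -> quasi_continuous m F E f.
Proof.
move=> cf e e0; exists set0; split; first exact: open0.
- apply: (@le_lt_trans _ _ 0%E); last by rewrite lte_fin.
  apply: ereal_inf_lbound; exists (cst 0).
    by split; [exact: (form_0 form) | apply: ae_all => x []].
  rewrite /E1 (psd0 epsd (form_0 form)) (psd0 ipsd) ?addr0 //.
  exact: (FL2 (form_0 form)).
- by rewrite setC0; apply: continuous_subspaceT.
Qed.

Lemma bounded_Linfty M f : meas f -> bounded_by M f -> Linfty m f.
Proof.
move=> mf fM; apply/andP; split; first by rewrite inE.
rewrite inE /= /finite_norm unlock /=; case: ifP => _; last by rewrite ltry.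
apply: (@le_lt_trans _ _ M%:E); last by rewrite ltry.
by apply/ess_supP; apply: ae_all => x; rewrite lee_fin; exact: fM.
Qed.

Lemma energy_carre M N f g : F f -> bounded_by M f -> F g -> bounded_by N g ->
  continuous g -> (\int[Gamma f]_x (g x)%:E = (carre E f g)%:E)%E.
Proof.
move=> Ff fM Fg gN cg.
have := energy_bounded energy Ff _ Fg _ (continuous_quasi_continuous cg).
apply; apply: bounded_Linfty; first exact: (L2_meas (FL2 Ff)).
- exact: fM.
- exact: (L2_meas (FL2 Fg)).
- exact: gN.
Qed.

Section supports.
Variables (Q : set X).
Hypotheses (closedQ : closed Q) (compactQ : compact Q).

(** For closed [A] this places [msupport m f] inside [A]. One compact set [Q] then supplies the
    compactness of every support to which strong locality is applied. *)
Definition vanish_off (A : set X) f := forall x, ~ A x -> f x = 0.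

Lemma msupport_sub (K : set X) f : closed K -> vanish_off K f -> msupport m f `<=` K.
Proof.
move=> cK f0 x; apply: contra_notP => nKx; exists (~` K) => //=.
split; first exact: closed_openC.
by apply: ae_all => y /= nKy; exact: f0.
Qed.

Lemma closed_msupport f : closed (msupport m f).
Proof. by apply: open_closedC; apply: bigcup_open => V []. Qed.

Lemma compact_msupport f : vanish_off Q f -> compact (msupport m f).
Proof.
move=> f0; apply: (subclosed_compact (@closed_msupport f) compactQ).
exact: msupport_sub.
Qed.

Lemma form_local0 (K W : set X) (c : R) f g : F f -> F g ->
  vanish_off Q f -> vanish_off Q g -> closed K -> vanish_off K f ->
  open W -> K `<=` W -> (forall x, W x -> g x = c) -> E f g = 0.
Proof.
move=> Ff Fg fQ gQ cK fK oW KW gc; apply: (form_local (W := W) (c := c)) => //.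
- exact: compact_msupport.
- exact: compact_msupport.
- by apply: subset_trans KW; exact: msupport_sub.
- exact: ae_all.
Qed.

End supports.

Lemma L2_cvg_le (K : R) (w u : nat -> X -> R) g f : (forall n, L2 m (w n)) -> L2 m g ->
  (forall n, L2 m (u n)) -> L2 m f -> 0 <= K ->
  (forall n x, `|w n x - g x| <= K * `|u n x - f x|) -> L2_cvg m u f -> L2_cvg m w g.
Proof.
move=> Lw Lg Lu Lf K0 H uf.
have : K ^+ 2 * inner m (fun x => u n x - f x) (fun x => u n x - f x) @[n --> \oo] --> K ^+ 2 * 0.
  exact: cvgMl_tmp.
rewrite mulr0; apply: squeeze_cvg0 => n.
have Ld := psdV_sub ipsd (Lw n) Lg; have Le := psdV_sub ipsd (Lu n) Lf.
rewrite (psd_ge0 ipsd) //= expr2 -mulrA -(psdZr ipsd) // -(psdZ ipsd) //; last exact: (psdV_scale ipsd).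
apply: inner_ae_le => //; do ?exact: (psdV_scale ipsd).
apply: ae_all => x; rewrite -!expr2 -(@ger0_norm _ (_ ^+ 2)) ?sqr_ge0 //.
rewrite -[leRHS]ger0_norm ?sqr_ge0 // !normrX ler_pXn2r ?nnegrE //.
by rewrite normrM (ger0_norm K0).
Qed.

Lemma form_mul_cvg M N (C : R) (u : nat -> X -> R) f g h : 0 <= M -> 0 <= N ->
  (forall n, F (u n)) -> (forall n, bounded_by M (u n)) -> (forall n, E (u n) (u n) <= C) ->
  F f -> bounded_by M f -> F g -> bounded_by N g -> F h -> L2_cvg m u f ->
  E (fun x => u n x * g x) h @[n --> \oo] --> E (fun x => f x * g x) h.
Proof.
move=> M0 N0 Fu uM EC Ff fM Fg gN Fh uf.
have Fug n := (form_mul form sg M0 N0 (Fu n) Fg (uM n) gN).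
have Ffg := (form_mul form sg M0 N0 Ff Fg fM gN).
apply: (@form_weak_cvg _ _ _ _ _ _ form sg (fun n x => u n x * g x) (fun x => f x * g x) h
  ((M + N) ^+ 2 * (C + E g g))) => //.
- by move=> n; case: (Fug n).
- move=> n; apply: le_trans (Fug n).2 _.
  by rewrite ler_wpM2l ?sqr_ge0 // lerD2r.
- by case: Ffg.
- apply: (@L2_cvg_le N _ u _ f) => //.
  + by move=> n; apply: FL2; case: (Fug n).
  + by apply: FL2; case: Ffg.
  + by move=> n; exact: FL2.
  + exact: FL2.
  + by move=> n x; rewrite -mulrBl normrM mulrC ler_wpM2r.
Qed.

(** In [E (u n) (u n * g)] both arguments move. The difference [u n - f] tends to 0 strongly while
    [u n * g] stays bounded in energy; for the other terms weak convergence suffices. *)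
Lemma carre_cvg M N (C : R) (u : nat -> X -> R) f g : 0 <= M -> 0 <= N ->
  (forall n, F (u n)) -> (forall n, bounded_by M (u n)) -> (forall n, E (u n) (u n) <= C) ->
  F f -> bounded_by M f -> F g -> bounded_by N g -> L2_cvg m u f ->
  E (fun x => u n x - f x) (fun x => u n x - f x) @[n --> \oo] --> 0 ->
  carre E (u n) g @[n --> \oo] --> carre E f g.
Proof.
move=> M0 N0 Fu uM EC Ff fM Fg gN uf Euf.
have Fug n := (form_mul form sg M0 N0 (Fu n) Fg (uM n) gN).
have Ffg := (form_mul form sg M0 N0 Ff Fg fM gN).
have Fuu n := (form_sqr form sg M0 (Fu n) (uM n)).
have Fff := (form_sqr form sg M0 Ff fM).
have Fd n := psdV_sub epsd (Fu n) Ff.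
have H3 : E (fun x => u n x * u n x) g @[n --> \oo] --> E (fun x => f x * f x) g.
  apply: (@form_weak_cvg _ _ _ _ _ _ form sg (fun n x => u n x * u n x) (fun x => f x * f x) g
    ((2 * M) ^+ 2 * C)) => //.
  - by move=> n; case: (Fuu n).
  - by move=> n; apply: le_trans (Fuu n).2 _; rewrite ler_wpM2l ?sqr_ge0.
  - by case: Fff.
  - apply: (@L2_cvg_le (2 * M) _ u _ f) => //.
    + by move=> n; apply: FL2; case: (Fuu n).
    + by apply: FL2; case: Fff.
    + by move=> n; exact: FL2.
    + exact: FL2.
    + by rewrite mulr_ge0.
    + move=> n x; have -> : u n x * u n x - f x * f x = (u n x + f x) * (u n x - f x) by ring.
      rewrite normrM ler_wpM2r // (le_trans (ler_normD _ _)) //.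
      by have := uM n x; have := fM x; lra.
have H1 : E (fun x => u n x - f x) (fun x => u n x * g x) @[n --> \oo] --> 0.
  have H : E (fun x => u n x - f x) (fun x => u n x - f x) *
    ((M + N) ^+ 2 * (C + E g g)) @[n --> \oo] --> 0 * ((M + N) ^+ 2 * (C + E g g)).
    exact: cvgMr_tmp.
  rewrite mul0r in H; apply: (@sqr_cvg0 _ _ _ 1 _ H) => n; rewrite mulr1.
  apply: le_trans (psd_CS epsd (Fd n) (Fug n).1) _.
  rewrite ler_wpM2l ?(psd_ge0 epsd) //; apply: le_trans (Fug n).2 _.
  by rewrite ler_wpM2l ?sqr_ge0 // lerD2r.
have H2 := form_mul_cvg M0 N0 Fu uM EC Ff fM Fg gN Ff uf.
rewrite (_ : (fun n => carre E (u n) g) = (fun n => E (fun x => u n x - f x) (fun x => u n x * g x)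
  + E (fun x => u n x * g x) f - 2^-1 * E (fun x => u n x * u n x) g)); last first.
  apply/funext => n; rewrite (psdN1 epsd (Fu n) Ff (Fug n).1) /carre.
  by rewrite (psd_sym epsd (Fug n).1 Ff); ring.
rewrite (_ : carre E f g = 0 + E (fun x => f x * g x) f - 2^-1 * E (fun x => f x * f x) g).
  by apply: cvgB; [exact: cvgD | exact: cvgMl_tmp].
by rewrite add0r (psd_sym epsd Ffg.1 Ff).
Qed.

End locality.

(** * Additivity of the carre du champ for functions constant on each other's support *)

Section cutoff_carre.
Context {R : realType} {X : pmetricType R} (m : borel_measure X R).
Context (F : set (X -> R)) (E : (X -> R) -> (X -> R) -> R).
Context (P : R -> (X -> R) -> (X -> R)).
Hypothesis form : dirichlet_form m F E.
Hypothesis sg : associated_semigroup m F E P.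
Hypothesis form_local : strongly_local m F E.
Variables (Q : set X).
Hypotheses (closedQ : closed Q) (compactQ : compact Q).
Implicit Types (f g h u v : X -> R) (s t : R).

Let epsd := form_psd form.
Let FL2 := form_L2 form.

Lemma clip01_contr (a b : R) : `|clip01 a - clip01 b| <= `|a - b|.
Proof.
suff H (c d : R) : c <= d -> `|clip01 c - clip01 d| <= `|c - d|.
  case: (leP a b) => [|/ltW] ab; first exact: H.
  by rewrite distrC [leRHS]distrC; exact: H.
move=> cd; have cd' := clip01_homo cd.
rewrite distrC [leRHS]distrC !ger0_norm ?subr_ge0 //.
case: (leP c 0) => c0; last case: (leP 1 c) => c1.
- rewrite (clip01_0 c0); case: (leP d 0) => d0; first by rewrite (clip01_0 d0); lra.
  by case: (leP d 1) => d1; [rewrite clip01_id ?d1 ?(ltW d0) //|rewrite (clip01_1 (ltW d1))]; lra.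
- by rewrite !clip01_1 ?(le_trans c1) //; lra.
- rewrite (@clip01_id _ c) ?(ltW c0) ?(ltW c1) //.
  by case: (leP d 1) => d1; [rewrite clip01_id ?d1 ?(le_trans (ltW c0)) //|
    rewrite (clip01_1 (ltW d1))]; lra.
Qed.

Lemma lipschitz0_clip01 (L : R) (A : R -> R) : (forall a b, `|A a - A b| <= L * `|a - b|) ->
  A 0 <= 0 -> lipschitz0 L (fun s => clip01 (A s)).
Proof.
move=> AL A0; split; first exact: clip01_0.
by move=> a b; apply: le_trans (clip01_contr _ _) (AL a b).
Qed.

Lemma soft_lipschitz (e : R) : 0 <= e -> lipschitz0 1 (fun s => s - clipM e s).
Proof.
move=> e0; split; first by rewrite clipM_id ?normr0 // subrr.
move=> a b; rewrite mul1r.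
suff H (c d : R) : c <= d -> `|c - clipM e c - (d - clipM e d)| <= `|c - d|.
  case: (leP a b) => [|/ltW] ab; first exact: H.
  by rewrite distrC [leRHS]distrC; exact: H.
move=> cd; rewrite [leRHS]distrC (@ger0_norm _ (d - c)) ?subr_ge0 // ler_norml /clipM.
by case: (leP c e) => aM; case: (leP d e) => bM;
  do 2?[case: (leP (- e) _) => ?]; apply/andP; split; lra.
Qed.

Lemma clipM_le_id (e s : R) : 0 <= e -> `|clipM e s| <= `|s|.
Proof. by move=> e0; have := lipschitz0_le s (clipM_lipschitz e0); rewrite mul1r. Qed.

Lemma invS_gt0 (n : nat) : (0 : R) < n.+1%:R^-1.
Proof. by rewrite invr_gt0. Qed.

Lemma cvg_invS : n.+1%:R^-1 @[n --> \oo] --> (0 : R).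
Proof. exact: cvg_harmonic. Qed.

Lemma comp_continuous (T : R -> R) f : continuous T -> continuous f ->
  continuous (fun x => T (f x)).
Proof. by move=> cT cf x; apply: continuous_comp; [exact: cf | exact: cT]. Qed.

Lemma open_preimage_gt f (a : R) : continuous f -> open [set x | a < f x].
Proof. by move=> cf; apply: (@open_comp _ _ f [set y | a < y]) => [x _|]; [exact: cf|exact: open_gt]. Qed.

Lemma open_preimage_lt f (a : R) : continuous f -> open [set x | f x < a].
Proof. by move=> cf; apply: (@open_comp _ _ f [set y | y < a]) => [x _|]; [exact: cf|exact: open_lt]. Qed.

Lemma closed_preimage_ge f (a : R) : continuous f -> closed [set x | a <= f x].
Proof. by move=> cf; apply: (@closed_comp _ _ f [set y | a <= y]) => [x _|]; [exact: cf|exact: closed_ge]. Qed.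

Lemma closed_preimage_le f (a : R) : continuous f -> closed [set x | f x <= a].
Proof. by move=> cf; apply: (@closed_comp _ _ f [set y | y <= a]) => [x _|]; [exact: cf|exact: closed_le]. Qed.

Lemma open_support f : continuous f -> open [set x | f x != 0].
Proof.
move=> cf; rewrite (_ : [set x | _] = [set x | 0 < f x] `|` [set x | f x < 0]).
  by apply: openU; [exact: open_preimage_gt | exact: open_preimage_lt].
by apply/seteqP; split => x /=; rewrite neq_lt orbC => /orP.
Qed.

(* Here [{f <> 0}] need not be a neighbourhood of the support of [f g]; soft
   thresholding of [f] at a level tending to [0] repairs this. *)
Lemma form_local_mul M N f g h (c : R) : 0 <= M -> 0 <= N -> F f -> continuous f ->
  bounded_by M f -> F g -> bounded_by N g -> vanish_off Q g -> F h -> vanish_off Q h ->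
  (forall x, f x != 0 -> h x = c) -> E (fun x => f x * g x) h = 0.
Proof.
move=> M0 N0 Ff cf fM Fg gN gQ Fh hQ hc.
pose e (n : nat) : R := n.+1%:R^-1.
have e0 n : 0 <= e n by exact/ltW/invS_gt0.
pose u n x := f x - clipM (e n) (f x).
have Fu n := form_lipschitz form sg (soft_lipschitz (e0 n)) Ff fM.
have uM n : bounded_by M (u n).
  move=> x; have := lipschitz0_le (f x) (soft_lipschitz (e0 n)); rewrite mul1r.
  by move=> /le_trans; apply; exact: fM.
have EC n : E (u n) (u n) <= E f f by have := (Fu n).2; rewrite expr1n mul1r.
have uf : L2_cvg m u f.
  apply: (@L2_cvg_dominated _ _ _ _ _ f).
  - by move=> n; apply: FL2; case: (Fu n).
  - exact: FL2.
  - exact: FL2.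
  - apply: ae_all => x n; rewrite /u addrC addKr normrN; exact: clipM_le_id.
  - apply: ae_all => x; apply/subr_cvg0.
    rewrite (_ : (fun n => _) = (fun n => - clipM (e n) (f x))); last first.
      by apply/funext => n; rewrite /u addrC addKr.
    rewrite -[X in _ --> X]oppr0; apply: cvgN.
    apply/cvgr0Pnorm_lt => d d0.
    have /cvgr0Pnorm_lt/(_ d d0) := cvg_invS.
    apply: filterS => n; apply: le_lt_trans.
    by rewrite (ger0_norm (e0 n)); exact: clipM_le.
have lim := form_mul_cvg form sg M0 N0 (fun n => (Fu n).1) uM EC Ff fM Fg gN Fh uf.
apply/esym; apply: (cvg_unique _ _ lim) => //.
rewrite (_ : (fun n => _) = cst 0); first exact: cvg_cst.
apply/funext => n.
pose K := Q `&` [set x | e n <= `|f x|].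
apply: (form_local0 form_local closedQ compactQ (K := K) (W := [set x | f x != 0]) (c := c)) => //.
- by case: (form_mul form sg M0 N0 (Fu n).1 Fg (uM n) gN).
- by move=> x xQ; rewrite gQ // mulr0.
- apply: closedI => //; apply: (@closed_preimage_ge (fun x => `|f x|)).
  exact: (comp_continuous (@norm_continuous _ _) cf).
- move=> x; rewrite /K /= => /not_andP[xQ|/negP]; first by rewrite gQ // mulr0.
  by rewrite -ltNge => /ltW fe; rewrite /u clipM_id // subrr mul0r.
- exact: open_support.
- move=> x [_ /=]; rewrite -normr_gt0; apply: lt_le_trans; exact: invS_gt0.
Qed.

(** Since [f2] is constant where [f1] is nonzero, the cross terms vanish by [form_local_mul]. *)
Lemma carreD M N N2 f1 f2 g (c : R) : 0 <= M -> 0 <= N -> 0 <= N2 -> c != 0 ->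
  F f1 -> continuous f1 -> bounded_by M f1 -> vanish_off Q f1 ->
  F f2 -> bounded_by N f2 -> vanish_off Q f2 -> (forall x, f1 x != 0 -> f2 x = c) ->
  F g -> bounded_by N2 g -> vanish_off Q g ->
  carre E (fun x => f1 x + f2 x) g = carre E f1 g + carre E f2 g.
Proof.
move=> M0 N0 N20 c0 F1 cf1 f1M f1Q F2 f2N f2Q f12 Fg gN gQ.
have F1g := (form_mul form sg M0 N20 F1 Fg f1M gN).1.
have F2g := (form_mul form sg N0 N20 F2 Fg f2N gN).1.
have F11 := (form_sqr form sg M0 F1 f1M).1.
have F22 := (form_sqr form sg N0 F2 f2N).1.
have F12 := (form_mul form sg M0 N0 F1 F2 f1M f2N).1.
have Fs := psdV_add epsd F1 F2.
have E12 : (fun x => f1 x * f2 x) = (fun x => c * f1 x).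
  apply/funext => x; have [->|f0] := eqVneq (f1 x) 0; first by rewrite mul0r mulr0.
  by rewrite f12 // mulrC.
have Z1 : E f2 (fun x => f1 x * g x) = 0.
  rewrite (psd_sym epsd) //; exact: (form_local_mul M0 N20 F1 cf1 f1M Fg gN gQ F2 f2Q f12).
have Fcg := psdV_scale epsd c Fg.
(* Because [f1 * f2 = c * f1] and [f2 * g - c * g] vanishes where [f1] does not, locality gives the
   identity multiplied by [c]; it is then divided by [c], which is nonzero. *)
have Z2 : E f1 (fun x => f2 x * g x) = E (fun x => f1 x * f2 x) g.
  have Fk := psdV_sub epsd F2g Fcg.
  have : E (fun x => f1 x * f2 x) (fun x => f2 x * g x - c * g x) = 0.
    apply: (@form_local_mul M N f1 f2 _ 0) => //.
      by move=> x xQ; rewrite gQ // !mulr0 subrr.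
    by move=> x f0; rewrite f12 // subrr.
  rewrite E12 (psdZ epsd) // (psdZ epsd) // (psdBr epsd) // (psdZr epsd) //.
  by move=> /eqP; rewrite mulf_eq0 (negbTE c0) /= subr_eq0 => /eqP.
rewrite /carre.
have -> : (fun x => (f1 x + f2 x) * g x) = (fun x => f1 x * g x + f2 x * g x).
  by apply/funext => x; rewrite mulrDl.
have -> : (fun x => (f1 x + f2 x) * (f1 x + f2 x)) =
  (fun x => (f1 x * f1 x + 2 * (f1 x * f2 x)) + f2 x * f2 x).
  by apply/funext => x; ring.
have F122 := psdV_scale epsd 2 F12.
have Fa := psdV_add epsd F11 F122.
rewrite (psdD epsd) //; last exact: (psdV_add epsd).
rewrite !(psdDr epsd) // Z1 Z2.
rewrite (psdD epsd Fa F22 Fg) (psdD epsd F11 F122 Fg) (psdZ epsd 2 F12 Fg).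
by field.
Qed.

End cutoff_carre.

(** * The carre du champ of a cutoff and its energy on the annulus *)

Section cutoff_energy.
Context {R : realType} {X : pmetricType R} (m : borel_measure X R).
Context (F : set (X -> R)) (E : (X -> R) -> (X -> R) -> R).
Context (P : R -> (X -> R) -> (X -> R)).
Hypothesis form : dirichlet_form m F E.
Hypothesis sg : associated_semigroup m F E P.
Hypothesis form_local : strongly_local m F E.
Context (Gamma : (X -> R) -> borel_measure X R).
Hypothesis energy : energy_measure m F E Gamma.
Variables (Q : set X).
Hypotheses (closedQ : closed Q) (compactQ : compact Q).
Implicit Types (f g h u v : X -> R) (s t : R).

Let ipsd := inner_psd m.
Let epsd := form_psd form.
Let FL2 := form_L2 form.

(** All three are piecewise linear on [[0, 1]]. [plateau e] is constant on [[0, e]] and on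
    [[1 - e, 1]], and its Lipschitz constant tends to 1 with [e]. [tent e] vanishes at 0 and at 1,
    and [tent e + top e = 1] beyond [e / 2], with [top e] carried by [[1 - e / 2, 1]]. *)
Definition plateau (e s : R) := clip01 ((s - e) / (1 - 2 * e)).
Definition tent (e s : R) := clip01 (2 / e * Num.min s (1 - s)).
Let top (e s : R) := clip01 (1 - 2 / e * (1 - s)).

Section level.
Variable e : R.
Hypotheses (e0 : 0 < e) (e3 : e <= 3^-1).

Ltac elra := have := e0; have := e3; lra.

Let d0 : 0 < 1 - 2 * e. Proof. by elra. Qed.
Let ei0 : 0 < 2 / e. Proof. by rewrite divr_gt0. Qed.

Lemma plateau_lipschitz : lipschitz0 (1 - 2 * e)^-1 (plateau e).
Proof.
apply: lipschitz0_clip01 => [a b|].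
  by rewrite -mulrBl normrM mulrC (gtr0_norm (_ : 0 < _^-1)) ?invr_gt0 // opprB addrA subrK.
by rewrite sub0r mulNr oppr_le0 divr_ge0 // ltW.
Qed.

Lemma tent_lipschitz : lipschitz0 (2 / e) (tent e).
Proof.
apply: lipschitz0_clip01 => [a b|]; last by rewrite subr0 min_l ?mulr0.
rewrite -mulrBr normrM gtr0_norm // ler_pM2l // ler_norml.
have := ler_norm (a - b); have := ler_norm (- (a - b)); rewrite normrN.
case: (leP a (1 - a)) => ?; case: (leP b (1 - b)) => ? ? ?; apply/andP; split; elra.
Qed.

Lemma top_lipschitz : lipschitz0 (2 / e) (top e).
Proof.
apply: lipschitz0_clip01 => [a b|].
  rewrite (_ : _ - _ = 2 / e * (a - b)); last by ring.
  by rewrite normrM gtr0_norm.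
rewrite subr0 mulr1 subr_le0 ler_pdivlMr // mul1r; elra.
Qed.

Lemma plateau0 s : s <= e -> plateau e s = 0.
Proof. by move=> se; apply: clip01_0; rewrite pmulr_lle0 ?invr_gt0 // subr_le0. Qed.

Lemma plateau1 s : 1 - e <= s -> plateau e s = 1.
Proof. by move=> se; apply: clip01_1; rewrite ler_pdivlMr //; elra. Qed.

Lemma plateau_dist s : 0 <= s <= 1 -> `|plateau e s - s| <= e.
Proof.
move=> /andP[s0 s1]; rewrite ler_distl.
case: (leP s e) => se; first by rewrite plateau0 //; apply/andP; split; elra.
case: (leP (1 - e) s) => se1; first by rewrite plateau1 //; apply/andP; split; elra.
rewrite /plateau clip01_id; last by rewrite ler_pdivrMr // ler_pdivlMr // mul0r mul1r; apply/andP; split; elra.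
rewrite ler_pdivrMr // ler_pdivlMr //.
have p1 : 0 <= e * (s - e) by rewrite mulr_ge0 //; elra.
have p2 : 0 <= e * (1 - e - s) by rewrite mulr_ge0 //; elra.
have p3 : 0 <= e * e by rewrite mulr_ge0 //; elra.
by apply/andP; split; elra.
Qed.

Lemma tent_top s : 0 <= s <= 1 -> e / 2 < s -> tent e s + top e s = 1.
Proof.
move=> /andP[s0 s1] es; rewrite /tent /top.
case: (leP s (1 - e / 2)) => se.
  rewrite (clip01_1 (_ : 1 <= _)) ?(clip01_0 (_ : _ <= 0)) ?addr0 //.
    by rewrite subr_le0 mulrC mulrA ler_pdivlMr //; elra.
  by rewrite mulrC mulrA ler_pdivlMr // mul1r; case: (leP s (1 - s)) => ?; elra.
rewrite min_r; last by elra.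
have H : 0 <= 2 / e * (1 - s) <= 1.
  by rewrite mulr_ge0 /= ?(ltW ei0) ?subr_ge0 // mulrC mulrA ler_pdivrMr //; elra.
rewrite !clip01_id //; first by ring.
by case/andP: H => ? ?; apply/andP; split; elra.
Qed.

Lemma top_plateau s : s <= 1 -> top e s != 0 -> 1 - e / 2 <= s.
Proof.
move=> s1; apply: contraR; rewrite -ltNge => se; apply/eqP/clip01_0.
by rewrite subr_le0 mulrC mulrA ler_pdivlMr //; elra.
Qed.

Variables (phi g : X -> R) (N : R).
Hypotheses (Fphi : F phi) (cphi : continuous phi) (phi01 : forall x, 0 <= phi x <= 1).
Hypotheses (phiQ : vanish_off Q phi) (N0 : 0 <= N).
Hypotheses (Fg : F g) (gN : bounded_by N g) (gQ : vanish_off Q g).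

Lemma bounded01 f : (forall x, 0 <= f x <= 1) -> bounded_by 1 f.
Proof. by move=> f01 x; have /andP[f0 f1] := f01 x; rewrite ger0_norm. Qed.

Let phi1 := bounded01 phi01.

Lemma form_mul_lipschitz (L : R) (A : R -> R) : lipschitz0 L (fun s => clip01 (A s)) ->
  F (fun x => g x * clip01 (A (phi x))).
Proof.
move=> AL; apply: (form_mul form sg N0 ler01 Fg _ gN _).1.
  by case: (form_lipschitz form sg AL Fphi phi1).
by apply: bounded01 => x; exact: clip01_itv.
Qed.

(* [plateau e \o phi] is constant near [{phi = 0}] and near [{phi = 1}], so its carre
   du champ only sees the part of [g] carried by [{0 < phi < 1}]. *)
Lemma carre_plateau :
  carre E (fun x => plateau e (phi x)) g =
  carre E (fun x => plateau e (phi x)) (fun x => g x * tent e (phi x)).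
Proof.
have Fgt := form_mul_lipschitz tent_lipschitz.
have Fgp := form_mul_lipschitz top_lipschitz.
have [FT _] := form_lipschitz form sg plateau_lipschitz Fphi phi1.
have T01 : bounded_by 1 (fun x => plateau e (phi x)).
  by apply: bounded01 => x; exact: clip01_itv.
have [FTT _] := form_sqr form sg ler01 FT T01.
have FTg := (form_mul form sg ler01 N0 FT Fg T01 gN).1.
(* Of the three pieces of [g], [g0] lives on [{phi <= e / 2}] and the [top] piece on
   [{phi >= 1 - e / 2}]. Around both sets [plateau e \o phi] is constant, so only the [tent] piece
   contributes. *)
pose g0 x := g x - g x * tent e (phi x) - g x * top e (phi x).
have Fg0 : F g0 by apply: (psdV_sub epsd) => //; exact: (psdV_sub epsd).
have TQ : vanish_off Q (fun x => plateau e (phi x)).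
  by move=> x xQ; rewrite phiQ // plateau0 // ltW.
have gNb (A : R -> R) : bounded_by N (fun x => g x * clip01 (A (phi x))).
  move=> x; rewrite normrM -[leRHS]mulr1; apply: ler_pM => //.
  by case/andP: (clip01_itv (A (phi x))) => ? ?; rewrite ger0_norm.
have FTgt := (form_mul form sg ler01 N0 FT Fgt T01 (gNb (fun s => 2 / e * Num.min s (1 - s)))).1.
have FTgp := (form_mul form sg ler01 N0 FT Fgp T01 (gNb (fun s => 1 - 2 / e * (1 - s)))).1.
have g0Q : vanish_off Q g0 by move=> x xQ; rewrite /g0 gQ // !mul0r !subr0.
have g00 x : e / 2 < phi x -> g0 x = 0.
  move=> ex; rewrite /g0 -addrA -opprD -mulrDr tent_top // mulr1 subrr //.
have Z0 : E g0 (fun x => plateau e (phi x) * plateau e (phi x)) = 0.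
  apply: (form_local0 form_local closedQ compactQ (K := [set x | phi x <= e / 2])
    (W := [set x | phi x < e]) (c := 0)) => //.
  - by move=> x xQ; rewrite TQ // mul0r.
  - exact: closed_preimage_le.
  - by move=> x /= /negP; rewrite -ltNge; exact: g00.
  - exact: open_preimage_lt.
  - by move=> x /= xe; apply: le_lt_trans xe _; elra.
  - by move=> x /= xe; rewrite plateau0 ?mul0r // ltW.
have Z0' : E (fun x => plateau e (phi x)) (fun x => plateau e (phi x) * g0 x) = 0.
  rewrite (_ : (fun x => plateau e (phi x) * g0 x) = (fun=> 0)); first exact: (psd0r epsd).
  apply/funext => x; case: (leP (phi x) e) => xe; first by rewrite plateau0 // mul0r.
  by rewrite g00 ?mulr0 //; elra.
have topW h : (forall x, 1 - e < phi x -> h x = 1) -> F h -> vanish_off Q h ->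
    E (fun x => g x * top e (phi x)) h = 0.
  move=> h1 Fh hQ.
  apply: (form_local0 form_local closedQ compactQ (K := [set x | 1 - e / 2 <= phi x])
    (W := [set x | 1 - e < phi x]) (c := 1)) => //.
  - by move=> x xQ; rewrite gQ // mul0r.
  - exact: closed_preimage_ge.
  - move=> x /= nx; have [->|t0] := eqVneq (top e (phi x)) 0; first by rewrite mulr0.
    by case: nx; apply: top_plateau => //; case/andP: (phi01 x).
  - exact: open_preimage_gt.
  - by move=> x /= xe; apply: lt_le_trans xe; elra.
have Z1 : E (fun x => g x * top e (phi x)) (fun x => plateau e (phi x) * plateau e (phi x)) = 0.
  apply: topW => // [x xe|x xQ]; last by rewrite TQ // mul0r.
  by rewrite plateau1 ?mulr1 // ltW.
have Z1' : E (fun x => plateau e (phi x)) (fun x => plateau e (phi x) * (g x * top e (phi x))) = 0.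
  rewrite (_ : (fun x => _ * _) = (fun x => g x * top e (phi x))).
    by rewrite (psd_sym epsd) //; apply: topW => // x xe; rewrite plateau1 // ltW.
  apply/funext => x; have [->|t0] := eqVneq (top e (phi x)) 0; first by rewrite !mulr0.
  rewrite plateau1 ?mul1r //; apply: le_trans (top_plateau _ t0); first by elra.
  by case/andP: (phi01 x).
have FTg0 : F (fun x => plateau e (phi x) * g0 x).
  have := psdV_sub epsd (psdV_sub epsd FTg FTgt) FTgp.
  by congr F; apply/funext => x; rewrite /g0 /tent /top; ring.
have gE : g = (fun x => (g0 x + g x * top e (phi x)) + g x * tent e (phi x)).
  by apply/funext => x; rewrite /g0; ring.
have TgE : (fun x => plateau e (phi x) * g x) =
    (fun x => (plateau e (phi x) * g0 x + plateau e (phi x) * (g x * top e (phi x))) +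
      plateau e (phi x) * (g x * tent e (phi x))).
  by apply/funext => x; rewrite /g0; ring.
rewrite /carre TgE (psdDr epsd (psdV_add epsd FTg0 FTgp) FTgt FT) (psdDr epsd FTg0 FTgp FT).
rewrite Z0' Z1' !add0r; congr (_ - _ * _).
rewrite {1}gE (psdDr epsd (psdV_add epsd Fg0 Fgp) Fgt FTT) (psdDr epsd Fg0 Fgp FTT).
by rewrite !(psd_sym epsd FTT) // Z0 Z1 !add0r.
Qed.

End level.

(** Rather than determining how [Gamma phi] charges the level sets 0 and 1 of [phi], the proof
    replaces [phi] by [plateau e \o phi]. For that function [g] may be multiplied by a tent
    vanishing off [U]; the contraction inequality returns to [phi] with a factor tending to 1, and
    strong convergence removes [e]. *)
Lemma carre_le_energy phi g N (U : set (borel X)) : F phi -> continuous phi ->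
  (forall x, 0 <= phi x <= 1) -> vanish_off Q phi ->
  F g -> continuous g -> 0 <= N -> bounded_by N g -> (forall x, 0 <= g x) -> vanish_off Q g ->
  measurable U -> (forall x, 0 < phi x < 1 -> U x) ->
  ((carre E phi g)%:E <= \int[Gamma phi]_(x in U) (g x)%:E)%E.
Proof.
move=> Fphi cphi phi01 phiQ Fg cg N0 gN g0 gQ mU phiU.
have phi1 := bounded01 phi01.
(* Starting at [1/3] keeps every level admissible for the plateaus and the Lipschitz constants at
   most 3. *)
pose e (n : nat) : R := n.+3%:R^-1.
have e0 n : 0 < e n by rewrite invr_gt0.
have e3 n : e n <= 3^-1 by rewrite lef_pV2 ?posrE // ler_nat.
have ecvg : e n @[n --> \oo] --> 0.
  have := cvg_invS (R := R); rewrite -(cvg_shiftn 2) /=.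
  by under eq_fun do rewrite addn2.
pose L n := (1 - 2 * e n)^-1.
have L0 n : 0 <= L n by rewrite invr_ge0; have := e3 n; lra.
have L3 n : L n <= 3.
  rewrite /L -[leRHS]invrK lef_pV2 ?posrE ?invr_gt0 //; have := e3 n; lra.
pose u n x := plateau (e n) (phi x).
have Fu n := form_lipschitz form sg (plateau_lipschitz (e0 n) (e3 n)) Fphi phi1.
have u01 n x : 0 <= u n x <= 1 by exact: clip01_itv.
have u1 n := bounded01 (u01 n).
have uphi : L2_cvg m u phi.
  apply: (@L2_cvg_dominated _ _ _ _ _ (fun x => 4 * phi x)).
  - by move=> n; apply: FL2; case: (Fu n).
  - exact: FL2.
  - by apply: (psdV_scale ipsd); exact: FL2.
  - apply: ae_all => x n; have := lipschitz0_le (phi x) (plateau_lipschitz (e0 n) (e3 n)).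
    move=> H; apply: le_trans (ler_normB _ _) _.
    have : L n * `|phi x| <= 3 * `|phi x| by rewrite ler_wpM2r.
    by rewrite normrM (@ger0_norm _ 4) //; rewrite -/(u n x) -/(L n) in H; lra.
  - apply: ae_all => x; apply/subr_cvg0; apply/cvgr0Pnorm_lt => d d0.
    have /cvgr0Pnorm_lt/(_ d d0) := ecvg.
    apply: filterS => n; apply: le_lt_trans.
    by rewrite (gtr0_norm (e0 n)); exact: plateau_dist.
have Ep0 : 0 <= E phi phi by exact: (form_ge0 form).
have EL n : E (u n) (u n) <= L n ^+ 2 * E phi phi by case: (Fu n).
have LC n : L n ^+ 2 * E phi phi <= 9 * E phi phi.
  rewrite ler_wpM2r // (_ : 9 = 3 ^+ 2); last by ring.
  by rewrite ler_pXn2r ?nnegrE.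
have Lcvg : L n ^+ 2 @[n --> \oo] --> (1 : R).
  have H : L n @[n --> \oo] --> (1 : R).
    rewrite -[X in _ --> X]invr1; apply: cvgV; first exact: oner_neq0.
    rewrite -[X in _ --> X](subr0 (1 : R)) -(mulr0 (2 : R)).
    by apply: cvgB; [exact: cvg_cst | exact: cvgMl_tmp].
  by rewrite -[X in _ --> X](mulr1 (1 : R)); under eq_fun do rewrite expr2; exact: cvgM.
have Estrong : E (fun x => u n x - phi x) (fun x => u n x - phi x) @[n --> \oo] --> 0.
  apply: (@form_strong_cvg _ _ _ _ _ _ form sg u phi (fun n => L n ^+ 2 * E phi phi) (9 * E phi phi)) => //.
    by move=> n; case: (Fu n).
  by rewrite -[X in _ --> X]mul1r; exact: cvgMr_tmp.
have cc := carre_cvg form sg ler01 N0 (fun n => (Fu n).1) u1 (fun n => le_trans (EL n) (LC n))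
  Fphi phi1 Fg gN uphi Estrong.
have key n : ((carre E (u n) g)%:E <=
    (L n ^+ 2)%:E * \int[Gamma phi]_(x in U) (g x)%:E)%E.
  have [e0n e3n] := (e0 n, e3 n).
  rewrite (carre_plateau e0n e3n Fphi cphi phi01 phiQ N0 Fg gN gQ).
  have Fgt := form_mul_lipschitz Fphi phi01 N0 Fg gN (tent_lipschitz e0n e3n).
  have t01 x : 0 <= tent (e n) (phi x) <= 1 by exact: clip01_itv.
  have gtN : bounded_by N (fun x => g x * tent (e n) (phi x)).
    move=> x; rewrite normrM -[leRHS]mulr1; apply: ler_pM => //.
    by case/andP: (t01 x) => ? ?; rewrite ger0_norm.
  have gt0 x : 0 <= g x * tent (e n) (phi x).
    by rewrite mulr_ge0 //; case/andP: (t01 x).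
  have cgt : continuous (fun x => g x * tent (e n) (phi x)).
    move=> x; apply: cvgM; first exact: cg.
    apply: (comp_continuous (lipschitz0_continuous (tent_lipschitz e0n e3n)) cphi).
  have := carre_lipschitz form sg (plateau_lipschitz e0n e3n) Fphi phi1 Fgt gtN gt0 ler01 N0.
  rewrite -lee_fin => /le_trans; apply.
  rewrite EFinM -(energy_carre form energy Fphi phi1 Fgt gtN cgt).
  apply: lee_pmul => //.
  - by rewrite lee_fin sqr_ge0.
  - by apply: integral_ge0 => x _; rewrite lee_fin.
  have mg : measurable_fun [set: borel X] (fun x : borel X => (g x)%:E).
    by apply/measurable_EFinP; exact: (continuous_meas cg).
  rewrite [leRHS]integral_mkcond; apply: ge0_le_integral => //.
  - by move=> x _; rewrite lee_fin.
  - by apply/measurable_EFinP; exact: (continuous_meas cgt).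
  - by apply/(measurable_restrictT _ mU); exact: measurable_funS mg.
  - move=> x _; rewrite patchE; case: ifPn => [_|xU].
      by rewrite lee_fin -[leRHS]mulr1 ler_wpM2l //; case/andP: (t01 x).
    rewrite lee_fin (_ : clip01 _ = 0) ?mulr0 //.
    apply: clip01_0; move: xU; rewrite notin_setE => xU.
    have : ~~ (0 < phi x < 1) by apply/negP => /phiU.
    have /andP[p0 p1] := phi01 x.
    rewrite negb_and -!leNgt => /orP[p|p].
      by rewrite mulr_ge0_le0 ?ge_min ?p // divr_ge0 // ltW.
    by rewrite mulr_ge0_le0 ?ge_min ?subr_le0 ?p ?orbT // divr_ge0 // ltW.
have I0 : (0 <= \int[Gamma phi]_(x in U) (g x)%:E)%E.
  by apply: integral_ge0 => x _; rewrite lee_fin.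
(* Only a finite integral needs the limit in [n]; an infinite one is trivially an upper bound. *)
move: I0 key; case: (integral _ _ _) => [r r0 key|_ _|//]; last by rewrite leey.
rewrite lee_fin.
have H1 : L n ^+ 2 * r @[n --> \oo] --> 1 * r by exact: cvgMr_tmp.
rewrite mul1r in H1.
by apply: (ler_cvg_to cc H1); apply: nearW => n; rewrite -lee_fin EFinM; exact: key.
Qed.

End cutoff_energy.

(** * Weighted inner products *)

Section weighted_products.
Context {R : realType} {X : pmetricType R} (m : borel_measure X R).
Implicit Types (f g h v : X -> R).

Let ipsd := inner_psd m.
Notation meas f := (measurable_fun [set: borel X] (f : borel X -> R)).

Definition weighted (q : X -> R) f g := inner m (fun x => f x * q x) g.

Section weighted_form.
Variables (q : X -> R) (K : R).
Hypotheses (mq : meas q) (q0 : forall x, 0 <= q x) (qK : bounded_by K q).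

Lemma L2_weight f : L2 m f -> L2 m (fun x => f x * q x).
Proof. by move=> Lf; apply: L2_mul qK. Qed.

Lemma weighted_psd : psd (L2 m) (weighted q).
Proof.
split.
- exact: psd_lin ipsd.
- move=> a f g h Lf Lg Lh; rewrite /weighted -(psd_bilin ipsd) //; do ?exact: L2_weight.
  by congr inner; apply/funext => x; ring.
- move=> f g Lf Lg; rewrite /weighted (inner_mulA m f) (psd_sym ipsd) //; last first.
    by rewrite (_ : (fun x => _) = (fun x => g x * q x)); [exact: L2_weight | apply/funext => x; rewrite mulrC].
  by congr inner; apply/funext => x; rewrite mulrC.
- move=> f Lf; apply: Rintegral_ge0 => x _.
  by rewrite mulrAC -expr2 mulr_ge0 ?sqr_ge0.
Qed.

Lemma weighted_le f : L2 m f -> weighted q f f <= K * inner m f f.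
Proof.
move=> Lf; rewrite -(psdZ ipsd) //; apply: inner_ae_le => //; do ?exact: L2_weight.
  exact: (psdV_scale ipsd).
apply: ae_all => x; have -> : f x * q x * f x = q x * f x ^+ 2 by ring.
have -> : K * f x * f x = K * f x ^+ 2 by ring.
rewrite ler_wpM2r ?sqr_ge0 //.
exact: le_trans (ler_norm _) (qK x).
Qed.

End weighted_form.

Section mass.
Variable A : set (borel X).
Hypothesis mA : measurable A.

Definition mass := weighted (\1_A : X -> R).

Let mind : meas (\1_A : X -> R) := measurable_indic mA.
Let ind0 x : 0 <= \1_A x :> R.
Proof. by rewrite indicE. Qed.
Let ind1 : bounded_by 1 (\1_A : X -> R).
Proof. by move=> x; rewrite indicE; case: (x \in A); rewrite ?normr1 // normr0. Qed.

Lemma L2_indic f : L2 m f -> L2 m (fun x => f x * \1_A x).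
Proof. exact: (L2_weight mind ind1). Qed.

Lemma mass_psd : psd (L2 m) mass.
Proof. exact: (weighted_psd mind ind0 ind1). Qed.

Lemma mass_le f : L2 m f -> mass f f <= inner m f f.
Proof. by move=> Lf; rewrite -[leRHS]mul1r; exact: weighted_le. Qed.

Lemma mass_integral f : L2 m f ->
  (\int[m]_(x in A) (f x ^+ 2)%:E = (mass f f)%:E)%E.
Proof.
move=> Lf; rewrite /mass /weighted /inner /Rintegral fineK; last first.
  by apply: integrable_fin_num => //; apply: L2_int => //; exact: L2_indic.
rewrite [LHS]integral_mkcond; apply: eq_integral => x _.
rewrite patchE indicE; case: (x \in A); rewrite ?mulr1 ?expr2 //.
by rewrite mulr0 mul0r.
Qed.

Lemma mass_le_measure v (C : R) : L2 m v -> bounded_by 1 v ->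
  (m A <= C%:E)%E -> mass v v <= C.
Proof.
move=> Lv v1 mAC; rewrite -lee_fin -(mass_integral Lv); apply: le_trans mAC.
rewrite -[leRHS]mul1e -integral_cst //; apply: ge0_le_integral => //.
- by move=> x _; rewrite lee_fin sqr_ge0.
- apply/measurable_EFinP/measurable_funX; exact: (measurable_funS measurableT _ (L2_meas Lv)).
- by move=> x _; rewrite lee_fin -[leLHS]ger0_norm ?sqr_ge0 // normrX exprn_ile1.
Qed.

End mass.

Lemma cvg_sum_nat (k j : nat) (a : nat -> nat -> R) (l : nat -> R) :
  (forall i, (k <= i)%N -> a n i @[n --> \oo] --> l i) ->
  \sum_(k <= i < j) a n i @[n --> \oo] --> \sum_(k <= i < j) l i.
Proof.
move=> al; elim: j => [|j IH].
  by rewrite big_geq //; under eq_fun do rewrite big_geq //; exact: cvg_cst.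
case: (leqP k j) => kj; last first.
  by rewrite big_geq //; under eq_fun do rewrite big_geq //; exact: cvg_cst.
rewrite big_nat_recr //=; under eq_fun do rewrite big_nat_recr //=.
by apply: cvgD => //; exact: al.
Qed.

Lemma Cc_bounded f : Cc f -> exists2 M, 0 <= M & bounded_by M f.
Proof.
move=> [cf cK]; set K := closure _ in cK.
have := continuous_compact (continuous_subspaceT cf) cK.
move=> /compact_bounded[M [_ HM]].
exists (Num.max (M + 1) 0); first by rewrite le_max lexx orbT.
move=> x; have [->|f0] := eqVneq (f x) 0; first by rewrite normr0 le_max lexx orbT.
rewrite le_max; apply/orP; left; apply: (HM (M + 1)); first by rewrite ltrDl.
by exists x => //; exact: subset_closure.
Qed.

End weighted_products.

(** * Reduction of stochastic completeness to a mass estimate *)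

Section conservativeness.
Context {R : realType} {X : pmetricType R} (m : borel_measure X R).
Context (F : set (X -> R)) (E : (X -> R) -> (X -> R) -> R).
Context (P : R -> (X -> R) -> (X -> R)).
Hypothesis form : dirichlet_form m F E.
Hypothesis sg : associated_semigroup m F E P.
Implicit Types (f g h v : X -> R) (s t : R).

Let ipsd := inner_psd m.
Let sgL2 t f (t0 : 0 <= t) (Lf : L2 m f) := sgL sg t0 Lf.

Notation approximates_one u :=
  [/\ forall n, L2 m (u n) /\ {ae m, forall x, 0 <= u n x},
      {ae m, forall x, nondecreasing_seq (fun n => u n x)} &
      {ae m, forall x, (fun n => u n x) @ \oo --> (1 : R)}].

Lemma L2_norm f : L2 m f -> L2 m (fun x => `|f x|).
Proof.
move=> Lf; apply: (L2_le _ _ Lf) => [|x]; last by rewrite normr_id.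
exact: (measurableT_comp (@normr_measurable _ _) (L2_meas Lf)).
Qed.

Lemma ae_le1 (u : nat -> X -> R) : approximates_one u ->
  {ae m, forall x, forall n, 0 <= u n x <= 1}.
Proof.
move=> [u0 umono ucvg].
have u0' : {ae m, forall x, forall n, 0 <= u n x} by apply: ae_forall_nat => n; case: (u0 n).
apply: ae_imp2 (ae_imp2 (fun x A B => conj A B) umono ucvg) u0' => x [um uc] ux n.
rewrite ux /=; have := nondecreasing_cvgn_le um (cvgP _ uc) n.
by rewrite (cvg_lim _ uc).
Qed.

Lemma sg_approximates (u : nat -> X -> R) s : 0 <= s -> approximates_one u ->
  [/\ forall n, L2 m (P s (u n)) /\ {ae m, forall x, 0 <= P s (u n) x},
      {ae m, forall x, nondecreasing_seq (fun n => P s (u n) x)} &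
      {ae m, forall x, forall n, P s (u n) x <= 1}].
Proof.
move=> s0 au; have u1 := ae_le1 au; case: au => u0 um uc.
have Lu n : L2 m (u n) by case: (u0 n).
have M n : {ae m, forall x, 0 <= P s (u n) x <= 1}.
  by apply: (sg_markov form sg) => //; apply: ae_imp u1 => x; exact.
split.
- move=> n; split; first exact: sgL2.
  by apply: ae_imp (M n) => x /andP[].
- have : {ae m, forall x, forall n, P s (u n) x <= P s (u n.+1) x}.
    apply: ae_forall_nat => n; apply: (sg_mono form sg) => //.
    by apply: ae_imp um => x; apply.
  by apply: ae_imp => x /nondecreasing_seqP.
- by apply: ae_imp (ae_forall_nat M) => x Mx n; case/andP: (Mx n).
Qed.

(** The property at [t] covers every approximating sequence, in particular [P s (u n)], which
    increases to 1 by the property at [s]. *)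
Lemma monotone_extensionD s t : 0 <= s -> 0 <= t ->
  monotone_extension m P s (cst 1) (cst 1) -> monotone_extension m P t (cst 1) (cst 1) ->
  monotone_extension m P (t + s) (cst 1) (cst 1).
Proof.
move=> s0 t0 Hs Ht u u0 um uc.
have au : approximates_one u by [].
have [P0 Pm _] := sg_approximates s0 au.
have H := Ht (fun n => P s (u n)) P0 Pm (Hs u u0 um uc).
have A : {ae m, forall x, forall n, P (t + s) (u n) x = P t (P s (u n)) x}.
  by apply: ae_forall_nat => n; apply: ae_eq_onT; apply: (sg_add sg) => //; case: (u0 n).
apply: ae_imp2 A H => x Ax.
by rewrite (_ : (fun n => P (t + s) (u n) x) = (fun n => P t (P s (u n)) x)) //; apply/funext.
Qed.

Lemma monotone_extension_small t0 : 0 < t0 ->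
  (forall t, 0 < t -> t <= t0 -> monotone_extension m P t (cst 1) (cst 1)) ->
  stochastically_complete m P.
Proof.
move=> t00 H t tp.
pose q := (Num.truncn (t / t0)).+1.
have q0 : (0 : R) < q%:R by rewrite ltr0n.
pose s := t / q%:R.
have s0 : 0 < s by rewrite divr_gt0.
have st0 : s <= t0.
  by rewrite /s ler_pdivrMr // mulrC -ler_pdivrMr // ltW // truncnS_gt.
have K (j : nat) : monotone_extension m P (j.+1%:R * s) (cst 1) (cst 1).
  elim: j => [|j IH]; first by rewrite mul1r; exact: H.
  have -> : j.+2%:R * s = s + j.+1%:R * s by rewrite -[j.+2%:R]natr1; ring.
  apply: monotone_extensionD => //; [|exact: ltW | exact: H].
  by rewrite mulr_ge0 // ltW.
have := K (Num.truncn (t / t0)).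
by rewrite -/q mulrC /s divfK // gt_eqF.
Qed.

Variables (D : nat -> set (borel X)) (eta : nat -> X -> R).
Hypothesis D_meas : forall k, (1 <= k)%N -> measurable (D k).
Hypothesis D_covers : forall x, exists2 k, (1 <= k)%N & D k x.
Hypothesis eta_L2 : forall n, (1 <= n)%N -> L2 m (eta n).
Hypothesis eta01 : forall n x, (1 <= n)%N -> 0 <= eta n x <= 1.
Hypothesis eta1 : forall k n x, (1 <= k)%N -> (k <= n)%N -> D k x -> eta n x = 1.

(* For fixed [e], the set where [P t (u j)] stays below [1 - e] is null, its
   measure being controlled by [mass m (D k) (eta n - P t (eta n))]. *)
Lemma conservative_of_mass t : 0 <= t ->
  (forall k e, (1 <= k)%N -> 0 < e -> exists2 n, (k <= n)%N &
     mass m (D k) (fun x => eta n x - P t (eta n) x) (fun x => eta n x - P t (eta n) x) <= e) ->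
  monotone_extension m P t (cst 1) (cst 1).
Proof.
move=> t0 small u u0 um uc.
have au : approximates_one u by [].
have u1 := ae_le1 au.
have [P0 Pm P1] := sg_approximates t0 au.
have Lu n : L2 m (u n) by case: (u0 n).
have LPu n : L2 m (P t (u n)) by exact: sgL2.
have null k e : (1 <= k)%N -> 0 < e ->
    {ae m, forall x, D k x -> exists j, 1 - e < P t (u j) x}.
move=> k1 e0.
pose A : set (borel X) := D k `&` \bigcap_j [set x | P t (u j) x <= 1 - e].
have mA : measurable A.
  apply: measurableI; first exact: D_meas.
  apply: bigcapT_measurable => j.
  have mp : measurable ([set: borel X] `&` P t (u j) @^-1` [set` `]-oo, (1 - e)]]).
    by apply: (L2_meas (LPu j)) => //; exact: measurable_itv.
  rewrite setTI in mp.
  rewrite (_ : [set x | _] = P t (u j) @^-1` [set` `]-oo, (1 - e)]]) //.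
pose f x : R := e * \1_A x.
have etaA x : A x -> eta k x = 1 by move=> [Dx _]; exact: (eta1 k1 (leqnn _) Dx).
have Lind : L2 m (fun x => \1_A x).
  apply: (L2_le _ _ (eta_L2 k1)) => [|x]; first exact: measurable_indic.
  rewrite indicE; case: (boolP (x \in A)) => [|_]; last by rewrite normr0.
  by rewrite inE => Ax; rewrite etaA.
have Lf : L2 m f by exact: (psdV_scale ipsd).
have mDk := D_meas k1.
have mpsd := mass_psd m mDk.
have f0 : inner m f f <= 0.
  apply/ler_addgt0Pr => d d0; rewrite add0r.
  have d4 : 0 < d / 4 by rewrite divr_gt0.
  have [n kn Hn] := small k _ k1 d4.
  have n1 := leq_trans k1 kn.
  have Ln := eta_L2 n1; have LPn := sgL2 t0 Ln.
  (* This minimum lies below [u j] and converges to [eta n] in L^2, so a lower bound on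
     [P t (eta n)] becomes one on [P t (u j)], whereas [u j] need not be comparable with [eta n]. *)
  pose sj j x := Num.min (u j x) (eta n x).
  have Lsj j : L2 m (sj j).
    apply: (L2_le _ _ (psdV_add ipsd (L2_norm (Lu j)) (L2_norm Ln))) => [|x].
      by apply: measurable_minr; [exact: (L2_meas (Lu j)) | exact: (L2_meas Ln)].
    rewrite [leRHS]ger0_norm ?addr_ge0 // /sj /Num.min; case: ifP => _.
      by rewrite lerDl.
    by rewrite lerDr.
  have sj_cvg : L2_cvg m sj (eta n).
    apply: (L2_cvg_dominated Lsj Ln Ln).
      apply: ae_imp u1 => x ux j; have /andP[u0x _] := ux j.
      have /andP[e0x _] := eta01 x n1.
      rewrite distrC !ger0_norm // /sj ?subr_ge0 ?ge_min ?lexx ?orbT //.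
      by rewrite gerBl le_min u0x e0x.
    apply: ae_imp2 u1 uc => x ux /cvg_seqP ucx; apply/cvg_seqP => e1 e10.
    have [N HN] := ucx e1 e10; exists N => j Nj; apply: le_lt_trans (HN j Nj).
    have /andP[u0x u1x] := ux j; have /andP[e0x e1x] := eta01 x n1.
    rewrite /= /sj /Num.min; case: ifP => H; last by rewrite subrr normr0.
    rewrite distrC [leRHS]distrC !ger0_norm ?subr_ge0 ?(ltW H) //.
    by lra.
  have /cvg_seqP/(_ _ d4)[j0 Hj] := sg_cvg sg t0 Lsj Ln sj_cvg.
  have LPs := sgL2 t0 (Lsj j0).
  have Lh := psdV_sub ipsd Ln LPs.
  have {}Hj := Hj j0 (leqnn _).
  rewrite subr0 in Hj; have {}Hj := le_lt_trans (ler_norm _) Hj.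
  have La := psdV_sub ipsd Ln LPn; have Lb := psdV_sub ipsd LPn LPs.
  have L1 : mass m (D k) (fun x => eta n x - P t (sj j0) x) (fun x => eta n x - P t (sj j0) x) <= d.
    have := psd_le_add mpsd La Lb.
    rewrite (_ : (fun x => _ + _) = (fun x => eta n x - P t (sj j0) x)); last first.
      by apply/funext => x; ring.
    have := mass_le mDk Lb.
    rewrite (psd_subC ipsd LPn LPs).
    by lra.
  apply: le_trans L1; apply: inner_ae_le => //; first exact: L2_indic.
  have : {ae m, forall x, P t (sj j0) x <= P t (u j0) x}.
    apply: (sg_mono form sg) => //; apply: ae_all => x.
    by rewrite ge_min lexx.
  apply: ae_imp => x sx; rewrite /f !indicE.
  case: (boolP (x \in A)) => [|_]; last first.
    by rewrite !mulr0 mulrAC -expr2 mulr_ge0 ?sqr_ge0.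
  rewrite inE => -[Dx Ax]; rewrite mem_set // !mulr1 -!expr2.
  have := Ax j0 I; rewrite /= (eta1 k1 kn Dx) => A1.
  have A2 : e <= 1 - P t (sj j0) x by lra.
  by rewrite ler_pXn2r ?nnegrE //; lra.
have f00 : inner m f f = 0 by apply/eqP; rewrite eq_le f0 (psd_ge0 ipsd Lf).
apply: ae_imp (inner_eq0 Lf f00) => x fx Dx.
apply: contrapT => H.
have Ax : A x.
  by split => // j _ /=; rewrite leNgt; apply/negP => ?; apply: H; exists j.
move: fx; rewrite /f indicE mem_set // mulr1 => e00.
by rewrite e00 ltxx in e0.
have nullS : {ae m, forall x, forall k i, D k.+1 x -> exists j, 1 - i.+1%:R^-1 < P t (u j) x}.
  apply: ae_forall_nat => k; apply: ae_forall_nat => i.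
  by apply: null => //; rewrite invr_gt0.
apply: ae_imp2 (ae_imp2 (fun x A B => conj A B) Pm P1) nullS => x [Pmx P1x] Hx.
apply/cvg_seqP => e e0.
have [k k1 Dx] := D_covers x.
have [i ie] : exists i : nat, i.+1%:R^-1 < e.
  exists (Num.truncn e^-1); rewrite -[ltRHS]invrK ltf_pV2 ?posrE ?invr_gt0 //.
  exact: truncnS_gt.
have Dx' : D k.-1.+1 x by rewrite prednK.
have [j Hj] := Hx k.-1 i Dx'.
exists j => n jn.
have A1 : P t (u j) x <= P t (u n) x := Pmx _ _ jn.
have A2 : P t (u n) x <= 1 := P1x n.
rewrite /= distrC ger0_norm ?subr_ge0 //.
move: Hj ie A1; set a := P t (u j) x; set b := P t (u n) x; set c := _^-1.
by lra.
Qed.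

End conservativeness.

(** * Products of growth factors *)

Section real_estimates.
Context {R : realType}.
Implicit Types (r : nat -> R) (k n : nat) (a x : R).

Lemma limn_einf_eq0_lt (u : nat -> \bar R) k (e : \bar R) : limn_einf u = 0%E -> (0 < e)%E ->
  exists2 n, (k <= n)%N & (u n < e)%E.
Proof.
move=> u0 e0; have : (einfs u k < e)%E.
  apply: le_lt_trans e0; rewrite -u0 limn_einf_lim (cvg_lim _ (@cvg_einfs_sup _ u)) //.
  by apply: ereal_sup_ubound; exists k.
by move=> /ereal_inf_lt[_ [n /= kn <-] H]; exists n.
Qed.

Lemma prod_rate_ge1 r k n : (forall i, (k <= i)%N -> 0 <= r i) -> 1 <= \prod_(k <= i < n) (1 + r i).
Proof.
move=> r0; rewrite big_nat_cond; apply: (@big_ind _ (fun x : R => 1 <= x)) => //.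
  by move=> x y x1 y1; rewrite (le_trans x1) // ler_peMr // (le_trans ler01).
by move=> i; rewrite andbT => /andP[ki _]; rewrite lerDl r0.
Qed.

Lemma prod_rate_ge_exp2 r k n : (forall i, (k <= i)%N -> 1 <= r i) ->
  2 ^+ (n - k) <= \prod_(k <= i < n) (1 + r i).
Proof.
move=> r1; rewrite -prodr_const_nat big_nat_cond [leRHS]big_nat_cond; apply: ler_prod => i.
by rewrite andbT => /andP[/r1 ? _]; apply/andP; split => //; lra.
Qed.

Lemma expR_half_le x : 0 <= x -> x <= 1 -> expR (x / 2) <= 1 + x.
Proof.
move=> x0 x1; have H := expR_ge1Dx (- (x / 2)).
have p : 0 < 1 + - (x / 2) by lra.
rewrite -[x / 2]opprK expRN -[leRHS]invrK lef_pV2 ?posrE ?invr_gt0 ?expR_gt0 //; last by lra.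
apply: le_trans H; rewrite -(ler_pM2r (x := 1 + x)); last by lra.
rewrite mulVf; last by rewrite gt_eqF //; lra.
have : 0 <= x * (1 - x) by rewrite mulr_ge0 // subr_ge0.
by lra.
Qed.

(** From [N] on the rate [a / i] is at most 1, so each factor is at least [expR (a / (2 * i))]; then
    [1 / i >= ln (i + 1) - ln i] telescopes. *)
Lemma prod_rate_ge_expR a N n : 0 <= a -> a <= N%:R -> (1 <= N)%N -> (N <= n)%N ->
  expR (a / 2 * (ln n%:R - ln N%:R)) <= \prod_(N <= i < n) (1 + a / i%:R).
Proof.
move=> a0 aN N1; elim: n => [|n IH]; first by rewrite leqn0 => /eqP N0; rewrite N0 in N1.
rewrite leq_eqVlt => /orP[/eqP <-|]; first by rewrite subrr mulr0 expR0 big_geq.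
rewrite ltnS => Nn; have n1 : (0 < n)%N := leq_trans N1 Nn.
have n0 : 0 < n%:R :> R by rewrite ltr0n.
rewrite big_nat_recr //=.
have -> : a / 2 * (ln n.+1%:R - ln N%:R) =
    a / 2 * (ln n%:R - ln N%:R) + a / 2 * (ln n.+1%:R - ln n%:R) by ring.
rewrite expRD; apply: ler_pM; rewrite ?expR_ge0 ?IH //.
have L : ln n.+1%:R - ln n%:R <= n%:R^-1 :> R.
  rewrite -ln_div ?posrE ?ltr0n // -natr1 mulrDl mulfV ?gt_eqF // mul1r.
  by apply: le_ln1Dx; rewrite (@lt_le_trans _ _ 0) // invr_ge0 ltW.
apply: le_trans (expR_half_le _ _).
- rewrite ler_expR mulrAC ler_pM2r ?invr_gt0 // ler_wpM2l //.
- by rewrite divr_ge0 // ltW.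
- by rewrite ler_pdivrMr // mul1r (le_trans aN) // ler_nat.
Qed.

End real_estimates.

Section weights.
Context {R : realType}.
Variables (r : nat -> R) (k n : nat).
Hypothesis r0 : forall i, (k <= i)%N -> 0 < r i.

(** This solves [w i = r i * \sum_(l > i) w l] downwards from [w n = 1]. The value 1 outside the
    range keeps every weight positive. *)
Definition growth_weight i : R :=
  if (k <= i < n)%N then r i * \prod_(i.+1 <= l < n) (1 + r l) else 1.

Lemma prod_rate_gt0 i : (k <= i)%N -> 0 < \prod_(i <= l < n) (1 + r l).
Proof.
move=> ki; rewrite big_nat_cond; apply: prodr_gt0 => l; rewrite andbT => /andP[il _].
by rewrite addr_gt0 // r0 // (leq_trans ki).
Qed.

Lemma growth_weight_gt0 i : 0 < growth_weight i.
Proof.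
rewrite /growth_weight; case: ifP => // /andP[ki _].
by rewrite mulr_gt0 ?r0 // prod_rate_gt0 // leqW.
Qed.

Lemma growth_weight_sum i : (k <= i <= n)%N ->
  \sum_(i <= l < n.+1) growth_weight l = \prod_(i <= l < n) (1 + r l).
Proof.
move=> /andP[ki]; move=> le_in; rewrite -(subKn le_in); move: ki; rewrite -{1}(subKn le_in).
elim: (n - i)%N => [|j IH] ki.
  rewrite subn0 big_nat1 big_geq // /growth_weight ltnn andbF //.
have [nj|jn] := leqP n j.
  have /eqP Ea : (n - j == 0)%N by rewrite subn_eq0.
  have /eqP Eb : (n - j.+1 == 0)%N by rewrite subn_eq0 leqW.
  by move: IH ki; rewrite Ea Eb.
have E1 : ((n - j.+1).+1 = n - j)%N by rewrite subnSK.
have lt1 : (n - j.+1 < n)%N by rewrite E1 leq_subr.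
rewrite [LHS]big_ltn; last exact: leqW.
rewrite [RHS]big_ltn // E1 IH; last by rewrite -E1 leqW.
rewrite {1}/growth_weight ki lt1 E1 /=.
by ring.
Qed.

End weights.

(** * Exhaustions with cutoff functions *)

(** The inequality of CSD with its cutoff exposed, so that one sequence of cutoffs can be fixed for
    the whole argument. *)
Definition csd_with (R : realType) (X : pmetricType R) (m : borel_measure X R)
    (F : set (X -> R)) (E : (X -> R) -> (X -> R) -> R) (Gamma : (X -> R) -> borel_measure X R)
    (U : set (borel X)) (phi : X -> R) (theta : R) : Prop :=
  forall f, F f -> quasi_continuous m F E f ->
    (\int[Gamma phi]_(x in U) (f x ^+ 2)%:E <=
       (8^-1)%:E * \int[Gamma f]_(x in U) (phi x ^+ 2)%:E +
       theta%:E * \int[m]_(x in U) (f x ^+ 2)%:E)%E.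

Section exhaustion.
Context {R : realType} {X : pmetricType R} (m : borel_measure X R).
Context (F : set (X -> R)) (E : (X -> R) -> (X -> R) -> R).
Context (P : R -> (X -> R) -> (X -> R)).
Hypothesis form : dirichlet_form m F E.
Hypothesis sg : associated_semigroup m F E P.
Hypothesis form_regular : regular_form m F E.
Hypothesis form_local : strongly_local m F E.
Context (D : nat -> set X).
Hypothesis D_open : forall n, (1 <= n)%N -> open (D n).
Hypothesis D_compact : forall n, (1 <= n)%N -> compact (closure (D n)).
Hypothesis D_incr : forall n, (1 <= n)%N -> closure (D n) `<=` D n.+1.
Hypothesis D_cover : \bigcup_(n in [set n | (1 <= n)%N]) D n = [set: X].
Context (phi : nat -> X -> R).
Hypothesis phi_cutoff : forall n, (1 <= n)%N -> cutoff m F (D n) (D n.+1) (phi n).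
Context (Gamma : (X -> R) -> borel_measure X R).
Hypothesis energy : energy_measure m F E Gamma.
Context (theta : nat -> R).
Hypothesis theta_gt0 : forall n, (1 <= n)%N -> 0 < theta n.
Hypothesis phi_csd : forall n, (1 <= n)%N ->
  csd_with m F E Gamma (D n.+1 `\` closure (D n)) (phi n) (theta n).
Implicit Types (f g h u v : X -> R) (s t : R).

Let epsd := form_psd form.
Let FL2 := form_L2 form.
Let ipsd := inner_psd m.
Let sgL2 t f (t0 : 0 <= t) (Lf : L2 m f) := sgL sg t0 Lf.
Notation meas f := (measurable_fun [set: borel X] (f : borel X -> R)).

Lemma exhaustion_mono i j : (1 <= i)%N -> (i <= j)%N -> D i `<=` D j.
Proof.
move=> i1 /subnK <-; elim: (j - i)%N => [|k IH] //=.
rewrite addSn => x /IH /subset_closure Dx; apply: D_incr Dx.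
by rewrite (leq_trans i1) ?leq_addl.
Qed.

Lemma closure_exhaustion_mono i j : (1 <= i)%N -> (i <= j)%N -> closure (D i) `<=` closure (D j).
Proof. by move=> i1 ij; apply: closureS; exact: exhaustion_mono. Qed.

Lemma compact_sub_exhaustion (K : set X) : compact K -> exists2 N, (1 <= N)%N & K `<=` D N.
Proof.
move=> cK; have := cK; rewrite compact_cover => /(_ nat [set n | (1 <= n)%N] D).
case.
- by move=> n; exact: D_open.
- by move=> x _; have : [set: X] x by []; rewrite -D_cover.
move=> S SD KS.
exists (\max_(i <- finmap.enum_fset S) i).+1 => // x /KS [i /= iS Dx].
have i1 : (1 <= i)%N by have := SD _ iS; rewrite inE.
apply: (exhaustion_mono i1 _ Dx); apply/leqW; exact: leq_bigmax_seq.
Qed.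

Section cutoffs.
Variable n : nat.
Hypothesis n1 : (1 <= n)%N.

Lemma cutoff_continuous : continuous (phi n).
Proof. by case: (phi_cutoff n1). Qed.

Lemma cutoff_itv x : 0 <= phi n x <= 1.
Proof. by case: (phi_cutoff n1). Qed.

Lemma cutoff1 x : D n x -> phi n x = 1.
Proof. by case: (phi_cutoff n1) => _ _ _ + _; exact. Qed.

Lemma cutoff0 x : ~ D n.+1 x -> phi n x = 0.
Proof. by case: (phi_cutoff n1) => _ _ _ _; exact. Qed.

Lemma cutoff_closure x : closure (D n) x -> phi n x = 1.
Proof.
have cl := closed_preimage_ge (a := 1) cutoff_continuous.
have sub : D n `<=` [set x | 1 <= phi n x] by move=> y /cutoff1 /= ->.
move=> /(closureS sub); rewrite -(closure_id _).1 //= => H.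
by apply/eqP; rewrite eq_le H andbT; case/andP: (cutoff_itv x).
Qed.

Lemma cutoff_annulus x : 0 < phi n x < 1 -> (D n.+1 `\` closure (D n)) x.
Proof.
move=> /andP[p0 p1]; split.
  by apply: contrapT => /cutoff0 p; rewrite p ltxx in p0.
by move=> /cutoff_closure p; rewrite p ltxx in p1.
Qed.

Lemma cutoff_vanish k : (n < k)%N -> vanish_off (closure (D k)) (phi n).
Proof.
move=> nk x xk; apply: cutoff0; apply: contra_not xk => Dx.
by apply: subset_closure; apply: exhaustion_mono Dx.
Qed.

Lemma cutoff_bounded : bounded_by 1 (phi n).
Proof. exact: bounded01 cutoff_itv. Qed.

End cutoffs.

Lemma cutoff_Cc n : (1 <= n)%N -> Cc (phi n).
Proof.
move=> n1; split; first exact: cutoff_continuous.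
apply: (subclosed_compact (@closed_closure _ _) (D_compact (ltn0Sn n))).
apply: closureS => x /= /eqP; apply: contra_notP; exact: cutoff0.
Qed.

(* [phi n.+1] is only uniformly close to an element of [F]; truncating the latter
   away from 0 and 1 makes it equal to 1 on [D n.+1] and to 0 off [D n.+2]. *)
Lemma cutoff_F n : (1 <= n)%N -> F (phi n).
Proof.
move=> n1; have n1' : (1 <= n.+1)%N by [].
have e4 : (0 : R) < 4^-1 by rewrite invr_gt0.
have [c0 [Fc0 Cc0 c0h]] := form_regular.2 _ _ (cutoff_Cc n1') e4.
(* [A] sends values below [1/4] to negative ones and values above [3/4] to ones above 1, matching an
   approximation error below [1/4]. *)
pose A (s : R) := 2 * s - 2^-1.
have AL : lipschitz0 2 (fun s => clip01 (A s)).
  apply: lipschitz0_clip01 => [a b|]; last by rewrite /A mulr0 sub0r oppr_le0 invr_ge0.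
  have -> : A a - A b = 2 * (a - b) by rewrite /A; ring.
  by rewrite normrM ger0_norm.
have c0M : bounded_by 2 c0.
  move=> x; have := c0h x; rewrite distrC => H.
  have := ler_normD (c0 x - phi n.+1 x) (phi n.+1 x); rewrite subrK => H1.
  have := cutoff_bounded n1' x; lra.
pose c x := clip01 (A (c0 x)).
have [Fc _] := form_lipschitz form sg AL Fc0 c0M.
have c1 x : D n.+1 x -> c x = 1.
  move=> Dx; apply: clip01_1; have := c0h x; rewrite cutoff1 //.
  by rewrite ltr_distl /A => /andP[_ ?]; lra.
have c00 x : ~ D n.+2 x -> c x = 0.
  move=> Dx; apply: clip01_0; have := c0h x; rewrite cutoff0 //.
  by rewrite ltr_distl /A => /andP[? _]; lra.
have n3 : (1 <= n.+3)%N by [].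
case: (phi_cutoff n1) => _ [mphi phil] _ _ _.
have [g Fg gphi] := phil _ (D_open n3) (D_compact n3).
have Fg1 := form_clip01 form Fg.
have cM : bounded_by 1 c by apply: bounded01 => x; exact: clip01_itv.
have gM : bounded_by 1 (fun x => clip01 (g x)) by apply: bounded01 => x; exact: clip01_itv.
(* This product equals [phi n] almost everywhere: on [D n.+3] because [g] does and [c = 1] wherever
   [phi n] is nonzero, and elsewhere because [c] and [phi n] both vanish. *)
have [Fcg _] := form_mul form sg ler01 ler01 Fc Fg1 cM gM.
have phic x : phi n x = phi n x * c x.
  have [Dx|Dx] := pselect (D n.+1 x); first by rewrite c1 // mulr1.
  by rewrite cutoff0 // mul0r.
have Lphi : L2 m (phi n).
  apply: (L2_le mphi _ (FL2 Fc)) => x; rewrite phic normrM -[leRHS]mul1r ler_wpM2r //.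
  exact: cutoff_bounded.
apply: (form_ae form Fcg Lphi _).1.
apply: ae_imp gphi => x gx _.
have [Dx|Dx] := pselect (D n.+3 x).
  by rewrite -gx // (clip01_id (cutoff_itv n1 x)) mulrC -/(c x) -phic.
rewrite -/(c x) c00 ?mul0r ?cutoff0 //.
  by apply: contra_not Dx; exact: (exhaustion_mono (ltn0Sn _) (leqW (leqnSn _))).
by apply: contra_not Dx; exact: (exhaustion_mono (ltn0Sn _) (leqnSn _)).
Qed.

(** * Weighted sums of cutoffs *)

Definition radial (w : nat -> R) (k j : nat) x := \sum_(k <= i < j) w i * phi i x.

Lemma radialS w k j x : (k <= j)%N -> radial w k j.+1 x = radial w k j x + w j * phi j x.
Proof. by move=> kj; rewrite /radial big_nat_recr. Qed.

Lemma radial_geq w k j x : (j <= k)%N -> radial w k j x = 0.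
Proof. by move=> jk; rewrite /radial big_geq. Qed.

Section radial_functions.
Variables (w : nat -> R) (k : nat).
Hypotheses (k1 : (1 <= k)%N) (w0 : forall i, 0 < w i).

Lemma radial_ind (Pr : nat -> (X -> R) -> Prop) : Pr k (fun=> 0) ->
  (forall j, (k <= j)%N -> Pr j (radial w k j) ->
     Pr j.+1 (fun x => radial w k j x + w j * phi j x)) ->
  forall j, (k <= j)%N -> Pr j (radial w k j).
Proof.
move=> P0 PS j /subnK <-; elim: (j - k)%N => [|i IH].
  rewrite add0n (_ : radial w k k = (fun=> 0)) //.
  by apply/funext => x; rewrite radial_geq.
rewrite addSn (_ : radial w k (i + k).+1 =
  (fun x => radial w k (i + k) x + w (i + k)%N * phi (i + k)%N x)).
  by apply: PS => //; rewrite leq_addl.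
by apply/funext => x; rewrite radialS ?leq_addl.
Qed.

Lemma radial_ge0 j x : 0 <= radial w k j x.
Proof.
rewrite /radial big_nat_cond; apply: sumr_ge0 => i /andP[/andP[ki _] _].
rewrite mulr_ge0 ?(ltW (w0 i)) //.
by case/andP: (cutoff_itv (leq_trans k1 ki) x).
Qed.

Lemma radial_le j x : radial w k j x <= \sum_(k <= i < j) w i.
Proof.
rewrite /radial big_nat_cond [leRHS]big_nat_cond; apply: ler_sum => i /andP[/andP[ki _] _].
rewrite -[leRHS]mulr1 ler_wpM2l ?(ltW (w0 i)) //.
by case/andP: (cutoff_itv (leq_trans k1 ki) x).
Qed.

Lemma radial_bounded j : bounded_by (\sum_(k <= i < j) w i) (radial w k j).
Proof. by move=> x; rewrite ger0_norm ?radial_ge0 // radial_le. Qed.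

Lemma weight_sum_ge0 j : 0 <= \sum_(k <= i < j) w i.
Proof. by apply: sumr_ge0 => i _; exact: ltW. Qed.

Lemma radial_vanish j x : (k <= j)%N -> ~ D j x -> radial w k j x = 0.
Proof.
move=> kj Dx; rewrite /radial big_nat_cond big1 // => i /andP[/andP[ki ij] _].
rewrite cutoff0 ?mulr0 //; first exact: leq_trans ki.
by apply: contra_not Dx; exact: exhaustion_mono.
Qed.

Lemma radial_F j : (k <= j)%N -> F (radial w k j).
Proof.
apply: (radial_ind (Pr := fun _ => F)) => [|{}j kj Fj]; first exact: (form_0 form).
apply: (psdV_add epsd) => //; apply: (psdV_scale epsd); apply: cutoff_F.
exact: leq_trans kj.
Qed.

Lemma radial_continuous j : (k <= j)%N -> continuous (radial w k j).
Proof.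
apply: (radial_ind (Pr := fun _ f => continuous f)) => [x|{}j kj cj x]; first exact: cvg_cst.
apply: cvgD; first exact: cj.
by apply: cvgMl_tmp; apply: cutoff_continuous; exact: leq_trans kj.
Qed.

Lemma radial_inner i j x : (k <= i)%N -> (i <= j)%N -> D i x ->
  radial w k j x = radial w k i x + \sum_(i <= l < j) w l.
Proof.
move=> ki ij Dx; rewrite /radial (big_cat_nat ki ij) /=; congr (_ + _).
rewrite big_nat_cond [RHS]big_nat_cond; apply: eq_bigr => l /andP[/andP[il _] _].
have i1 := leq_trans k1 ki.
rewrite cutoff1 ?mulr1 //; first exact: leq_trans il.
exact: exhaustion_mono Dx.
Qed.

Lemma carreZ (a : R) f g : F f -> F g -> F (fun x => f x * g x) -> F (fun x => f x * f x) ->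
  carre E (fun x => a * f x) g = a ^+ 2 * carre E f g.
Proof.
move=> Ff Fg Ffg Fff; rewrite /carre.
rewrite (_ : (fun x => a * f x * g x) = (fun x => a * (f x * g x))); last first.
  by apply/funext => x; ring.
rewrite (_ : (fun x => a * f x * (a * f x)) = (fun x => a ^+ 2 * (f x * f x))); last first.
  by apply/funext => x; ring.
rewrite !(psdZ epsd) //; last exact: (psdV_scale epsd).
by rewrite (psdZr epsd) //; ring.
Qed.

(** The sum up to [j] vanishes off [D j], where the next cutoff equals 1, so each step of the
    induction is an instance of [carreD]. *)
Lemma carre_radial (Q : set X) j g (N : R) : closed Q -> compact Q -> (k <= j)%N ->
  closure (D j) `<=` Q -> F g -> 0 <= N -> bounded_by N g -> vanish_off Q g ->
  carre E (radial w k j) g = \sum_(k <= i < j) w i ^+ 2 * carre E (phi i) g.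
Proof.
move=> cQ kQ kj DQ Fg N0 gN gQ; move: kj DQ.
apply: (radial_ind (Pr := fun j f => closure (D j) `<=` Q -> carre E f g =
  \sum_(k <= i < j) w i ^+ 2 * carre E (phi i) g)) => [_|{}j kj IH DQ].
  rewrite big_geq // /carre.
  rewrite (_ : (fun x => 0 * g x) = (fun=> 0)); last by apply/funext => x; rewrite mul0r.
  rewrite (_ : (fun x : X => 0 * 0) = (fun=> 0)); last by apply/funext => x; rewrite mul0r.
  by rewrite !(psd0 epsd) ?mulr0 ?subr0 //; exact: (form_0 form).
have j1 := leq_trans k1 kj.
have DjQ : closure (D j) `<=` Q.
  by apply: subset_trans DQ; exact: closure_exhaustion_mono.
have wj := w0 j.
have wphiN : bounded_by (w j) (fun x => w j * phi j x).
  move=> x; rewrite normrM gtr0_norm // -[leRHS]mulr1 ler_pM2l //; exact: cutoff_bounded.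
rewrite (carreD form sg form_local cQ kQ (weight_sum_ge0 j) (ltW wj) N0 (lt0r_neq0 wj)) //.
- rewrite big_nat_recr //= IH // carreZ //.
  + exact: cutoff_F.
  + by case: (form_mul form sg ler01 N0 (cutoff_F j1) Fg (cutoff_bounded j1) gN).
  + by case: (form_sqr form sg ler01 (cutoff_F j1) (cutoff_bounded j1)).
- exact: radial_F.
- exact: radial_continuous.
- exact: radial_bounded.
- move=> x xQ; apply: radial_vanish => //; apply: contra_not xQ => Dx.
  by apply: DjQ; exact: subset_closure.
- by apply: (psdV_scale epsd); exact: cutoff_F.
- move=> x xQ; rewrite cutoff0 ?mulr0 //; apply: contra_not xQ => Dx.
  by apply: DQ; exact: subset_closure.
- move=> x r0; rewrite cutoff1 ?mulr1 //.
  by apply: contrapT => Dx; rewrite radial_vanish // eqxx in r0.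
Qed.

End radial_functions.


Definition annulus n : set (borel X) := D n.+1 `\` closure (D n).

Lemma annulus_meas n : (1 <= n)%N -> measurable (annulus n).
Proof.
move=> n1; apply: measurableD; first by apply: open_meas; exact: D_open.
by rewrite -[closure _]setCK; apply: measurableC; apply: open_meas; exact/closed_openC/closed_closure.
Qed.

(** The annuli are pairwise disjoint: each omits the closure of the set that contains the preceding
    ones. *)
Lemma annuli_sum_le (mu : borel_measure X R) k j (G : nat -> X -> R) g : (1 <= k)%N -> (k <= j)%N ->
  (forall i, meas (G i)) -> meas g -> (forall i x, (k <= i)%N -> 0 <= G i x) -> (forall x, 0 <= g x) ->
  (forall i x, (k <= i < j)%N -> annulus i x -> G i x <= g x) ->
  (\sum_(k <= i < j) \int[mu]_(x in annulus i) (G i x)%:E <=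
   \int[mu]_(x in (D j : set (borel X))) (g x)%:E)%E.
Proof.
move=> k1 kj mG mg G0 g0; elim: j kj => [|j IH]; first by rewrite leqn0 => /eqP k0; rewrite k0 in k1.
rewrite leq_eqVlt => /orP[/eqP <- _|].
  by rewrite big_geq //; apply: integral_ge0 => x _; rewrite lee_fin.
rewrite ltnS => kj Gg; have j1 := leq_trans k1 kj.
have mD i : (1 <= i)%N -> measurable (D i : set (borel X)) by move=> i1; exact: (open_meas (D_open i1)).
have mga (A : set (borel X)) : measurable A -> measurable_fun A (fun x : borel X => (g x)%:E).
  by move=> mA; apply/measurable_EFinP; exact: measurable_funS mg.
rewrite big_nat_recr //=.
apply: (@le_trans _ _ (\int[mu]_(x in (D j : set (borel X))) (g x)%:E +
   \int[mu]_(x in annulus j) (g x)%:E)%E).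
  apply: leeD.
    apply: IH => // i x /andP[ki ij]; by apply: Gg; rewrite ki /= ltnS ltnW.
  apply: ge0_le_integral.
  - exact: annulus_meas.
  - by move=> x _; rewrite lee_fin; exact: G0.
  - by apply/measurable_EFinP; exact: measurable_funS (mG j).
  - by apply: mga; exact: annulus_meas.
  - by move=> x Ax; rewrite lee_fin; apply: Gg => //; rewrite kj ltnSn.
rewrite -ge0_integral_setU.
- apply: ge0_subset_integral => //.
  + by apply: measurableU; [exact: mD | exact: annulus_meas].
  + exact: mD.
  + by apply: mga; exact: mD.
  + by move=> x _; rewrite lee_fin.
  + move=> x [Dx|[]//]; exact: (exhaustion_mono j1 (leqnSn _)).
- exact: mD.
- exact: annulus_meas.
- by apply: mga; apply: measurableU; [exact: mD | exact: annulus_meas].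
- by move=> x _; rewrite lee_fin.
- apply/disj_setPS => x [Dx [_]]; apply; exact: subset_closure.
Qed.

(** * The weighted Caccioppoli inequality *)

Section weighted_caccioppoli.
Variables (w : nat -> R) (k : nat).
Hypotheses (k1 : (1 <= k)%N) (w0 : forall i, 0 < w i).
Notation psi j := (radial w k j).

Lemma carre_ge0 M N f g : F f -> bounded_by M f -> F g -> bounded_by N g -> continuous g ->
  (forall x, 0 <= g x) -> 0 <= carre E f g.
Proof.
move=> Ff fM Fg gN cg g0; rewrite -lee_fin -(energy_carre form energy Ff fM Fg gN cg).
by apply: integral_ge0 => x _; rewrite lee_fin.
Qed.

(** Continuity makes [v] admissible in CSD and lets both carre du champ terms of [form_leibniz] be
    compared with integrals. CSD then trades the energies of the cutoffs for the energy of [v],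
    annulus by annulus. *)
Lemma caccioppoli_continuous j v (Q : set X) : (k <= j)%N -> F v -> continuous v ->
  bounded_by 1 v -> closed Q -> compact Q -> vanish_off Q v -> closure (D j) `<=` Q ->
  - (2 * \sum_(k <= i < j) w i ^+ 2 * theta i * mass m (annulus i) v v) <=
  E (fun x => v x * (psi j x * psi j x)) v.
Proof.
move=> kj Fv cv v1 cQ kQ vQ DQ.
have Fpsi := radial_F w k1 kj.
have psiM := radial_bounded k1 w0 j.
have M0 := weight_sum_ge0 k w0 j.
have cpsi := radial_continuous (w := w) k1 kj.
set M := \sum_(k <= i < j) w i in psiM M0.
have [Fvv _] := form_sqr form sg ler01 Fv v1.
have [Fpp _] := form_sqr form sg M0 Fpsi psiM.
have vv1 : bounded_by 1 (fun x => v x * v x).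
  by move=> x; rewrite normrM -[leRHS]mulr1 ler_pM.
have ppM : bounded_by (M * M) (fun x => psi j x * psi j x).
  by move=> x; rewrite normrM ler_pM.
have cvv : continuous (fun x => v x * v x) by move=> x; apply: cvgM; exact: cv.
have cpp : continuous (fun x => psi j x * psi j x) by move=> x; apply: cvgM; exact: cpsi.
have vv0 x : 0 <= v x * v x by rewrite -expr2 sqr_ge0.
have pp0 x : 0 <= psi j x * psi j x by rewrite -expr2 sqr_ge0.
have [Fvpp _] := form_mul form sg ler01 (mulr_ge0 M0 M0) Fv Fpp v1 ppM.
have := form_leibniz form sg ler01 M0 Fv Fpsi v1 psiM.
rewrite (psd_sym epsd Fv Fvpp); apply: le_trans.
have vvQ : vanish_off Q (fun x => v x * v x) by move=> x xQ; rewrite vQ // mul0r.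
rewrite (carre_radial k1 w0
  cQ kQ kj DQ Fvv ler01 vv1 vvQ).
have Epsi := energy_carre form energy Fv v1 Fpp ppM cpp.
have cpos := carre_ge0 Fv v1 Fpp ppM cpp pp0.
pose I i := (\int[Gamma v]_(x in annulus i) (phi i x ^+ 2)%:E)%E.
(* Finiteness allows the energies of [v] to be cancelled as real numbers; they are dominated by a
   carre du champ. *)
have Ifin i : (1 <= i)%N -> I i = (fine (I i))%:E.
  move=> i1; rewrite fineK // ge0_fin_numE; last by apply: integral_ge0 => x _; rewrite lee_fin sqr_ge0.
  have Fphi := cutoff_F i1.
  have phi1 := cutoff_bounded i1.
  have [Fphi2 _] := form_sqr form sg ler01 Fphi phi1.
  have phi21 : bounded_by 1 (fun x => phi i x * phi i x).
    by move=> x; rewrite normrM -[leRHS]mulr1 ler_pM.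
  have cphi := cutoff_continuous i1.
  have cphi2 : continuous (fun x => phi i x * phi i x) by move=> x; apply: cvgM; exact: cphi.
  apply: (@le_lt_trans _ _ (carre E v (fun x => phi i x * phi i x))%:E); last by rewrite ltry.
  rewrite -(energy_carre form energy Fv v1 Fphi2 phi21 cphi2).
  apply: ge0_subset_integral => //; do ?exact: annulus_meas.
  - by apply/measurable_EFinP; exact: (continuous_meas cphi2).
  - by move=> x _; rewrite lee_fin sqr_ge0.
have key i : (k <= i < j)%N -> carre E (phi i) (fun x => v x * v x) <=
    8^-1 * fine (I i) + theta i * mass m (annulus i) v v.
  move=> /andP[ki ij]; have i1 := leq_trans k1 ki.
  have Fphi := cutoff_F i1.
  have phiQ : vanish_off Q (phi i).
    move=> x xQ; apply: (cutoff_vanish i1 ij).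
    by apply: contra_not xQ; exact: DQ.
  have H1 := carre_le_energy form sg form_local energy cQ kQ Fphi
    (cutoff_continuous i1) (cutoff_itv i1) phiQ Fvv cvv ler01 vv1 vv0 vvQ
    (annulus_meas i1) (cutoff_annulus i1).
  have H2 := phi_csd i1 Fv (continuous_quasi_continuous form cv).
  rewrite -lee_fin; apply: (le_trans H1).
  rewrite EFinD !EFinM -(Ifin _ i1) -(mass_integral (annulus_meas i1) (FL2 Fv)).
  exact: H2.
have Isum : \sum_(k <= i < j) w i ^+ 2 * fine (I i) <= carre E v (fun x => psi j x * psi j x).
  rewrite -lee_fin -Epsi -sumEFin.
  have kk i : (k <= i)%N -> (1 <= i)%N by move=> ki; exact: leq_trans ki.
  have -> : (\sum_(k <= i < j) (w i ^+ 2 * fine (I i))%:E =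
     \sum_(k <= i < j) \int[Gamma v]_(x in annulus i) ((if (k <= i)%N then w i ^+ 2 * phi i x ^+ 2 else 0))%:E)%E.
    rewrite big_nat_cond [RHS]big_nat_cond; apply: eq_bigr => i /andP[/andP[ki _] _].
    have i1 := kk _ ki.
    rewrite EFinM -(Ifin _ i1) /I -ge0_integralZl //.
    - by apply: eq_integral => x _; rewrite ki EFinM.
    - exact: annulus_meas.
    - apply/measurable_EFinP/measurable_funX.
      by apply: (measurable_funS measurableT) => //; exact: (continuous_meas (cutoff_continuous i1)).
    - by move=> x _; rewrite lee_fin sqr_ge0.
    - by rewrite lee_fin sqr_ge0.
  apply: (@le_trans _ _ (\int[Gamma v]_(x in (D j : set (borel X))) (psi j x * psi j x)%:E)%E).
    apply: (@annuli_sum_le (Gamma v) k j (fun i x => if (k <= i)%N then w i ^+ 2 * phi i x ^+ 2 else 0)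
      (fun x => psi j x * psi j x)) => //.
    - move=> i; case ki: (k <= i)%N; last exact: measurable_cst.
      apply: measurable_funM; first exact: measurable_cst.
      by apply: measurable_funX; exact: (continuous_meas (cutoff_continuous (kk _ ki))).
    - exact: (continuous_meas cpp).
    - by move=> i x ki; rewrite ki mulr_ge0 ?sqr_ge0.
    (* On the [i]-th annulus [psi j] is at least its own summand [w i * phi i], the other summands
       being nonnegative. *)
    - move=> i x /andP[ki ij] [Dx _]; rewrite ki -exprMn -expr2.
      rewrite (radial_inner w k1 (leqW ki) ij Dx) radialS //.
      have p0 : 0 <= w i * phi i x.
        by rewrite mulr_ge0 ?(ltW (w0 i)) //; case/andP: (cutoff_itv (kk _ ki) x).
      have r0 := radial_ge0 k1 w0 i x.
      have s0 := weight_sum_ge0 i.+1 w0 j.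
      by rewrite ler_pXn2r ?nnegrE ?addr_ge0 //; lra.
  apply: ge0_subset_integral => //.
  - by apply: open_meas; apply: D_open; exact: kk.
  - by apply/measurable_EFinP; exact: (continuous_meas cpp).
  - by move=> x _; rewrite lee_fin.
have : \sum_(k <= i < j) w i ^+ 2 * carre E (phi i) (fun x => v x * v x) <=
    8^-1 * \sum_(k <= i < j) w i ^+ 2 * fine (I i) +
    \sum_(k <= i < j) w i ^+ 2 * theta i * mass m (annulus i) v v.
  rewrite mulr_sumr -big_split /= big_nat_cond [leRHS]big_nat_cond.
  apply: ler_sum => i /andP[kij _].
  have := ler_wpM2l (sqr_ge0 (w i)) (key i kij).
  by move=> H; apply: le_trans H _; rewrite le_eqVlt; apply/orP; left; apply/eqP; ring.
(* CSD returns [2 * 1/8 = 1/4] of the weighted energy of [v], less than the [1/2] that the Leibniz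
   inequality provides. *)
by lra.
Qed.

End weighted_caccioppoli.

(** Regularity approximates [v] by continuous functions of compact support in [F]. Both arguments of
    the form on the right depend on [v], so the limit requires strong convergence of the
    approximants. *)
Lemma caccioppoli (w : nat -> R) k j v : (1 <= k)%N -> (forall i, 0 < w i) -> (k <= j)%N ->
  F v -> bounded_by 1 v ->
  - (2 * \sum_(k <= i < j) w i ^+ 2 * theta i * mass m (annulus i) v v) <=
  E (fun x => v x * (radial w k j x * radial w k j x)) v.
Proof.
move=> k1 w0 kj Fv v1; set psi := radial w k j.
have Fpsi := radial_F w k1 kj.
have psiM := radial_bounded k1 w0 j.
have M0 := weight_sum_ge0 k w0 j.
set M := \sum_(k <= i < j) w i in psiM M0.
have [Fpp _] := form_sqr form sg M0 Fpsi psiM.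
have MM0 : 0 <= M * M by exact: mulr_ge0.
have ppM : bounded_by (M * M) (fun x => psi x * psi x).
  by move=> x; rewrite normrM ler_pM.
have [g gP] : {g : nat -> X -> R & forall n, [/\ F (g n), Cc (g n) &
    E1 m E (fun x => v x - g n x) (fun x => v x - g n x) < n.+1%:R^-1]}.
  apply: (@choice _ _ (fun n g => [/\ F g, Cc g &
    E1 m E (fun x => v x - g x) (fun x => v x - g x) < n.+1%:R^-1])) => n.
  exact: (form_regular.1 v _ Fv (invS_gt0 n)).
have Fg n : F (g n) by case: (gP n).
have Eg n : 0 <= E (fun x => g n x - v x) (fun x => g n x - v x) <= n.+1%:R^-1.
  have Fd := psdV_sub epsd Fv (Fg n); have Ld := FL2 Fd.
  rewrite (psd_subC epsd (Fg n) Fv) (psd_ge0 epsd Fd) /=.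
  by case: (gP n) => _ _ /ltW; apply: le_trans; rewrite /E1 lerDl (psd_ge0 ipsd).
have Ig n : 0 <= inner m (fun x => g n x - v x) (fun x => g n x - v x) <= n.+1%:R^-1.
  have Fd := psdV_sub epsd Fv (Fg n); have Ld := FL2 Fd.
  rewrite (psd_subC ipsd (FL2 (Fg n)) (FL2 Fv)) (psd_ge0 ipsd Ld) /=.
  by case: (gP n) => _ _ /ltW; apply: le_trans; rewrite /E1 lerDr (psd_ge0 epsd).
have inv1 n : (n.+1%:R^-1 : R) <= 1 by rewrite invf_le1 ?ltr0n // ler1n.
have EgC n : E (g n) (g n) <= 2 + 2 * E v v.
  have := psd_le_add epsd (psdV_sub epsd (Fg n) Fv) Fv.
  rewrite (_ : (fun x => g n x - v x + v x) = g n); last by apply/funext => x; rewrite subrK.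
  have /andP[_ H] := Eg n; have := le_trans H (inv1 n); lra.
have gv : L2_cvg m g v by exact: (squeeze_cvg0 Ig cvg_invS).
(* Clipping restores the bound 1. It does not increase energies and fixes [v], so strong convergence
   comes back through [form_strong_cvg]. *)
pose u n x := clipM 1 (g n x).
have Fu n : F (u n) /\ E (u n) (u n) <= E (g n) (g n).
  have [Mg Mg0 gM] : exists2 Mg, 0 <= Mg & bounded_by Mg (g n).
    by case: (gP n) => _ /Cc_bounded.
  by have := form_lipschitz form sg (clipM_lipschitz ler01) (Fg n) gM; rewrite expr1n mul1r.
have u1 n : bounded_by 1 (u n) by move=> x; exact: clipM_le.
have uv : L2_cvg m u v.
  apply: (@L2_cvg_le _ _ m 1 u g v v) => //.
  - by move=> n; apply: FL2; case: (Fu n).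
  - exact: FL2.
  - by move=> n; exact: FL2.
  - exact: FL2.
  - move=> n x; rewrite -{1}(clipM_id (v1 x)); exact: (clipM_lipschitz ler01).2.
have Ecvg : E (g n) (g n) @[n --> \oo] --> E v v.
  by apply: (psd_cvg_sqr epsd) => //; exact: (squeeze_cvg0 Eg cvg_invS).
have strong := form_strong_cvg form sg (fun n => (Fu n).1) (fun n => (Fu n).2) EgC Fv uv Ecvg.
have EuC n : E (u n) (u n) <= 2 + 2 * E v v by exact: le_trans (Fu n).2 (EgC n).
have Fup n := form_mul form sg ler01 MM0 (Fu n).1 Fpp (u1 n) ppM.
have Fvp := (form_mul form sg ler01 MM0 Fv Fpp v1 ppM).1.
have Fd n := psdV_sub epsd (Fu n).1 Fv.
have H1 : E (fun x => u n x * (psi x * psi x)) (fun x => u n x - v x) @[n --> \oo] --> 0.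
  pose C := (1 + M * M) ^+ 2 * ((2 + 2 * E v v) + E (fun x => psi x * psi x) (fun x => psi x * psi x)).
  apply: (@sqr_cvg0 _ _ _ C _ strong) => n.
  apply: le_trans (psd_CS epsd (Fup n).1 (Fd n)) _.
  rewrite mulrC ler_wpM2l ?(psd_ge0 epsd) //; apply: le_trans (Fup n).2 _.
  by rewrite ler_wpM2l ?sqr_ge0 // lerD2r.
have H2 := form_mul_cvg form sg ler01 MM0 (fun n => (Fu n).1) u1 EuC Fv v1 Fpp ppM Fv uv.
have H3 : E (fun x => u n x * (psi x * psi x)) (u n) @[n --> \oo] -->
    E (fun x => v x * (psi x * psi x)) v.
  rewrite (_ : (fun n => _) = (fun n => E (fun x => u n x * (psi x * psi x)) (fun x => u n x - v x)
     + E (fun x => u n x * (psi x * psi x)) v)); last first.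
    apply/funext => n; rewrite (psdBr epsd (Fu n).1 Fv (Fup n).1); ring.
  by rewrite -[X in _ --> X]add0r; exact: cvgD.
have masscvg i : (1 <= i)%N -> mass m (annulus i) (u n) (u n) @[n --> \oo] -->
    mass m (annulus i) v v.
  move=> i1; have mA := annulus_meas i1.
  apply: (psd_cvg_sqr (mass_psd m mA)) => //.
  - by move=> n; apply: FL2; case: (Fu n).
  - exact: FL2.
  - apply: (squeeze_cvg0 _ uv) => n.
    by rewrite (psd_ge0 (mass_psd m mA)) ?(mass_le mA) //; exact: FL2.
have H4 : - (2 * \sum_(k <= i < j) w i ^+ 2 * theta i * mass m (annulus i) (u n) (u n))
    @[n --> \oo] --> - (2 * \sum_(k <= i < j) w i ^+ 2 * theta i * mass m (annulus i) v v).
  apply: cvgN; apply: cvgMl_tmp.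
  apply: cvg_sum_nat => i ki; apply: cvgMl_tmp; apply: masscvg; exact: leq_trans ki.
apply: (ler_cvg_to H4 H3); apply: nearW => n.
have [N N1 KN] : exists2 N, (1 <= N)%N & closure [set x | g n x != 0] `<=` D N.
  by case: (gP n) => _ [_ cK] _; exact: (compact_sub_exhaustion cK).
(* One compact set must contain both the support of [g n] and the closure of [D j]. *)
pose N' := maxn N j.
have N'1 : (1 <= N')%N by rewrite leq_max N1.
apply: (caccioppoli_continuous k1 w0 kj (Fu n).1 _ (u1 n) (@closed_closure _ (D N')) (D_compact N'1)).
- apply: (comp_continuous (lipschitz0_continuous (clipM_lipschitz ler01))).
  by case: (gP n) => _ [].
- move=> x xN; rewrite /u (_ : g n x = 0) ?clipM_id ?normr0 //.
  apply: contra_notP xN => /eqP g0; apply: subset_closure.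
  apply: (exhaustion_mono N1 (leq_maxl _ _)); apply: KN; exact: subset_closure.
- exact: (closure_exhaustion_mono (leq_trans k1 kj) (leq_maxr _ _)).
Qed.

(** * Evolution of the weighted norm of the heat loss *)

Section weighted_flow.
Variables (w : nat -> R) (k n : nat) (lambda C : R).
Hypotheses (k1 : (1 <= k)%N) (kn : (k <= n)%N) (w0 : forall i, 0 < w i) (wn : w n = 1).
Hypothesis lambda0 : 0 < lambda.
Hypothesis w_growth : forall i, (k <= i < n)%N ->
  2 * (w i ^+ 2 * theta i) <= lambda * (\sum_(i.+1 <= l < n.+1) w l) ^+ 2.
Hypothesis annulus_C : (m (annulus n) <= C%:E)%E.

Let psi := radial w k n.+1.
Let psi2 x := psi x * psi x.
Let M := \sum_(k <= i < n.+1) w i.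
(** [psi] vanishes off [D n.+1], and strong locality asks [eta] to be constant on a neighbourhood of
    the closure of that set: hence the index [n.+2]. *)
Let eta := phi n.+2.
Let kn1 : (k <= n.+1)%N := leqW kn.
Let n1 : (1 <= n)%N := leq_trans k1 kn.
Let M0 : 0 <= M := weight_sum_ge0 k w0 n.+1.
Let Fpsi : F psi := radial_F w k1 kn1.
Let psiM : bounded_by M psi := radial_bounded k1 w0 n.+1.
Let Feta : F eta := cutoff_F (ltn0Sn _).
Let Leta : L2 m eta := FL2 Feta.
Let Fpsi2 : F psi2 := (form_sqr form sg M0 Fpsi psiM).1.
Let MM0 : 0 <= M * M := mulr_ge0 M0 M0.
Let psi2M : bounded_by (M * M) psi2.
Proof. by move=> x; rewrite normrM ler_pM. Qed.
Let psi20 x : 0 <= psi2 x.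
Proof. by rewrite /psi2 -expr2 sqr_ge0. Qed.
Let mpsi2 : meas psi2 := L2_meas (FL2 Fpsi2).
Let wpsd : psd (L2 m) (weighted m psi2) := weighted_psd m mpsi2 psi20 psi2M.

(** [P t eta] has values in [[0, 1]] only almost everywhere; clipping makes [|v t| <= 1] hold at
    every point without changing the class. *)
Let u t x := clip01 (P t eta x).
Let v t x := eta x - u t x.

Let u_ae t : 0 <= t -> {ae m, forall x, u t x = P t eta x}.
Proof.
move=> t0; apply: ae_imp (sg_markov form sg t0 Leta (ae_all _ (cutoff_itv (ltn0Sn _)))) => x.
exact: clip01_id.
Qed.

Let FP t : 0 <= t -> F (P t eta).
Proof. by move=> t0; case: (sg_F form sg t0 Feta). Qed.

Let Fu t : 0 <= t -> F (u t).
Proof. by move=> t0; exact: (form_clip01 form (FP t0)). Qed.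

Let Fv t : 0 <= t -> F (v t).
Proof. by move=> t0; apply: (psdV_sub epsd) => //; exact: Fu. Qed.

Let v1 t : bounded_by 1 (v t).
Proof.
move=> x; rewrite /v /u; have /andP[? ?] := clip01_itv (P t eta x).
have /andP[? ?] := cutoff_itv (ltn0Sn n.+1) x.
by rewrite ler_norml -/eta; apply/andP; split; rewrite /eta; lra.
Qed.

Let Fvpsi t (t0 : 0 <= t) : F (fun x => v t x * psi2 x) :=
  (form_mul form sg ler01 MM0 (Fv t0) Fpsi2 (@v1 t) psi2M).1.

Let J t := weighted m psi2 (v t) (v t).

Lemma sum_mass_le t : 0 <= t ->
  4 * \sum_(k <= i < n.+1) w i ^+ 2 * theta i * mass m (annulus i) (v t) (v t) <=
  2 * lambda * J t + 4 * theta n * C.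
Proof.
move=> t0; have Lv := FL2 (Fv t0).
have mv := L2_meas Lv.
have kk i : (k <= i)%N -> (1 <= i)%N by move=> ki; exact: leq_trans ki.
have mass0 i : (k <= i)%N -> 0 <= mass m (annulus i) (v t) (v t).
  by move=> ki; apply: (psd_ge0 (mass_psd m (annulus_meas (kk _ ki)))).
pose S i := \sum_(i <= l < n.+1) w l.
have S0 i : 0 <= S i by exact: weight_sum_ge0.
have H1 : \sum_(k <= i < n) S i.+1 ^+ 2 * mass m (annulus i) (v t) (v t) <= J t.
  rewrite -lee_fin -sumEFin.
  have -> : (\sum_(k <= i < n) (S i.+1 ^+ 2 * mass m (annulus i) (v t) (v t))%:E =
     \sum_(k <= i < n) \int[m]_(x in annulus i) (S i.+1 ^+ 2 * v t x ^+ 2)%:E)%E.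
    rewrite big_nat_cond [RHS]big_nat_cond; apply: eq_bigr => i /andP[/andP[ki _] _].
    have mA := annulus_meas (kk _ ki).
    rewrite EFinM -(mass_integral mA Lv) -ge0_integralZl //.
    - apply/measurable_EFinP/measurable_funX; exact: (measurable_funS measurableT _ mv).
    - by move=> x _; rewrite lee_fin sqr_ge0.
    - by rewrite lee_fin sqr_ge0.
  apply: (@le_trans _ _ (\int[m]_(x in (D n : set (borel X))) (v t x * psi2 x * v t x)%:E)%E).
    apply: (@annuli_sum_le m k n (fun i x => S i.+1 ^+ 2 * v t x ^+ 2)
      (fun x => v t x * psi2 x * v t x)) => //.
    - move=> i; apply: measurable_funM; first exact: measurable_cst.
      exact: measurable_funX.
    - apply: measurable_funM => //; exact: measurable_funM.
    - by move=> i x _; rewrite mulr_ge0 ?sqr_ge0.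
    - by move=> x; rewrite mulrAC -expr2 mulr_ge0 ?sqr_ge0.
    - move=> i x /andP[ki lin] [Dx _].
      rewrite [leRHS]mulrAC -expr2 mulrC ler_wpM2l ?sqr_ge0 // /psi2 -expr2 /psi.
      rewrite (radial_inner w k1 (leqW ki) (leqW lin) Dx) -/(S i.+1).
      have r0 := radial_ge0 k1 w0 i.+1 x.
      have s0 := S0 i.+1.
      by rewrite ler_pXn2r ?nnegrE ?addr_ge0 //; lra.
  rewrite /J /weighted /inner /Rintegral fineK; last first.
    by apply: integrable_fin_num => //; apply: L2_int => //; exact: (L2_weight mpsi2 psi2M).
  apply: ge0_subset_integral => //.
  - by apply: open_meas; exact: D_open.
  - by apply/measurable_EFinP; apply: measurable_funM => //; exact: measurable_funM.
  - by move=> x _; rewrite lee_fin mulrAC -expr2 mulr_ge0 ?sqr_ge0.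
have H2 : 4 * \sum_(k <= i < n) w i ^+ 2 * theta i * mass m (annulus i) (v t) (v t) <=
    2 * lambda * \sum_(k <= i < n) S i.+1 ^+ 2 * mass m (annulus i) (v t) (v t).
  rewrite !mulr_sumr big_nat_cond [leRHS]big_nat_cond; apply: ler_sum => i /andP[kin _].
  have ki : (k <= i)%N by case/andP: kin.
  have := ler_wpM2r (mass0 i ki) (w_growth kin); rewrite -/(S i.+1).
  by lra.
have H3 := mass_le_measure (annulus_meas n1) Lv (@v1 t) annulus_C.
have H4 : theta n * mass m (annulus n) (v t) (v t) <= theta n * C.
  by rewrite ler_wpM2l // ltW // theta_gt0.
rewrite big_nat_recr //= wn expr1n mul1r mulrDr.
have : 2 * lambda * \sum_(k <= i < n) S i.+1 ^+ 2 * mass m (annulus i) (v t) (v t) <=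
  2 * lambda * J t by rewrite ler_wpM2l // mulr_ge0 // ltW.
by lra.
Qed.

(** [v t * psi^2] lives where [eta] is locally 1, so its form with [eta] vanishes and [E (P t eta)]
    on it is minus the quantity bounded below by [caccioppoli]. *)
Lemma form_flow_le t : 0 <= t -> 2 * E (P t eta) (fun x => v t x * psi2 x) <=
  2 * lambda * J t + 4 * theta n * C.
Proof.
move=> t0; apply: le_trans (sum_mass_le t0).
have Lu := FL2 (Fu t0).
have ueq : ae_eq_on m setT (P t eta) (u t) by apply: ae_imp (u_ae t0) => x -> _.
have [_ Eu] := form_ae form (FP t0) Lu ueq.
rewrite (Eu _ (Fvpsi t0)).
have cac := caccioppoli k1 w0 kn1 (Fv t0) (@v1 t).
have Z : E (fun x => v t x * psi2 x) eta = 0.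
  have n3 : (1 <= n.+3)%N by [].
  apply: (form_local0 form_local (@closed_closure _ (D n.+3)) (D_compact n3)
    (K := closure (D n.+1)) (W := D n.+2) (c := 1)) => //.
  - exact: Fvpsi.
  - move=> x xD; rewrite /psi2 /psi (radial_vanish w k1) ?mulr0 //.
    apply: contra_not xD => Dx; apply: subset_closure.
    exact: (exhaustion_mono (ltn0Sn _) (leqW (leqnSn _)) Dx).
  - exact: (cutoff_vanish (ltn0Sn _)).
  - exact: closed_closure.
  - move=> x xD; rewrite /psi2 /psi (radial_vanish w k1) ?mulr0 //.
    by apply: contra_not xD => Dx; exact: subset_closure.
  - exact: D_open.
  - exact: D_incr.
  - by move=> x; exact: (cutoff1 (ltn0Sn _)).
have : E (fun x => v t x * psi2 x) (v t) = E (fun x => v t x * psi2 x) eta -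
    E (u t) (fun x => v t x * psi2 x).
  by rewrite (psdBr epsd Feta (Fu t0) (Fvpsi t0)) (psd_sym epsd (Fu t0) (Fvpsi t0)).
rewrite Z sub0r => H; rewrite -/psi -/psi2 in cac.
move: cac; rewrite (_ : E _ (v t) = E (fun x => v t x * psi2 x) (v t)) // H.
by lra.
Qed.

Let diff s t x := u s x - u t x.

Let Ldiff s t : 0 <= s -> 0 <= t -> L2 m (diff s t).
Proof. by move=> s0 t0; apply: (psdV_sub ipsd); apply: FL2; exact: Fu. Qed.

Let J_diff s t : 0 <= s -> 0 <= t ->
  J t = J s + 2 * weighted m psi2 (v s) (diff s t) + weighted m psi2 (diff s t) (diff s t).
Proof.
move=> s0 t0; rewrite /J (_ : v t = (fun x => v s x + diff s t x)).
  by rewrite (psd_sqrD wpsd) //; [exact: FL2 (Fv s0) | exact: Ldiff].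
by apply/funext => x; rewrite /v /diff; ring.
Qed.

Let diff_le s t : 0 <= s -> 0 <= t ->
  weighted m psi2 (diff s t) (diff s t) <=
  M * M * inner m (fun x => P s eta x - P t eta x) (fun x => P s eta x - P t eta x).
Proof.
move=> s0 t0; apply: le_trans (weighted_le mpsi2 psi2M (Ldiff s0 t0)) _.
rewrite ler_wpM2l //; have Ld := Ldiff s0 t0.
have Lp := psdV_sub ipsd (sgL2 s0 Leta) (sgL2 t0 Leta).
apply: inner_ae_le => //; apply: ae_imp2 (u_ae s0) (u_ae t0) => x us ut.
by rewrite /diff us ut.
Qed.

(** Expanding [J] at time [s + r] leaves a linear term, which is [2 * sg_form_at r] and so
    asymptotic to [2 * r * E], and a quadratic term that is negligible by [sg_increment_small]. *)
Lemma heat_flow_bound t : 0 <= t ->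
  J t <= 4 * theta n * C / (2 * lambda) * expR (2 * lambda * t).
Proof.
have C0 : 0 <= C by rewrite -lee_fin; apply: le_trans annulus_C.
apply: dini_gronwall => [||s s0||s e s0 e0|s e s0 e0].
- by rewrite mulr_gt0.
- by rewrite !mulr_ge0 // ltW // theta_gt0.
- exact: (psd_ge0 wpsd (FL2 (Fv s0))).
- have v0 : {ae m, forall x, v 0 x = 0}.
    apply: ae_imp2 (u_ae (lexx 0)) (ae_eq_onT (sg_0 sg Leta)) => x E1 E2.
    by rewrite /v E1 E2 subrr.
  have Lv := FL2 (Fv (lexx 0)); have L0 := psdV_0 ipsd Lv.
  rewrite /J /weighted (psd_sym ipsd (L2_weight mpsi2 psi2M Lv) Lv).
  by rewrite (inner_ae Lv L0 (L2_weight mpsi2 psi2M Lv) v0) (psd0 ipsd (L2_weight mpsi2 psi2M Lv)).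
- pose K := M * M + 1; have K0 : 0 < K by rewrite /K; have := MM0; lra.
  pose N := 4 * inner m eta eta + 1.
  have N0 : 0 < N by have := psd_ge0 ipsd Leta; rewrite /N; lra.
  (* [K * N] bounds [J r] for every [r >= 0], so Young's inequality with this parameter costs at
     most [e / 2]. *)
  pose e1 := e / (2 * (K * N)).
  have KN0 : 0 < K * N by rewrite mulr_gt0.
  have e10 : 0 < e1 by rewrite divr_gt0 // mulr_gt0.
  have c0 : 0 < (e1^-1 + 1) * K by rewrite mulr_gt0 // addr_gt0 // invr_gt0.
  have e20 : 0 < e / 2 / ((e1^-1 + 1) * K) by rewrite !divr_gt0.
  have [d d0 Hd] := sg_left_cvg sg s Leta e20.
  exists d => // r r0 rd rs; have := Hd r r0 rd rs.
  have s0' := ltW s0.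
  rewrite (psd_subC ipsd (sgL2 s0' Leta) (sgL2 r0 Leta)) ltr_pdivlMr // => H.
  rewrite (J_diff r0 s0').
  have Y := psd_young wpsd e10 (FL2 (Fv r0)) (Ldiff r0 s0').
  have A := ler_norm (weighted m psi2 (v r) (diff r s)).
  have Dle := diff_le r0 s0'.
  set x := inner m _ _ in H Dle.
  have x0 : 0 <= x by apply: (psd_ge0 ipsd); apply: (psdV_sub ipsd); exact: sgL2.
  have Dle' : weighted m psi2 (diff r s) (diff r s) <= K * x.
    by apply: le_trans Dle _; rewrite ler_wpM2r // /K; lra.
  have Jr : J r <= K * N.
    apply: le_trans (weighted_le mpsi2 psi2M (FL2 (Fv r0))) _.
    apply: ler_pM => //; first exact: (psd_ge0 ipsd (FL2 (Fv r0))).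
      by rewrite /K; lra.
    apply: le_trans (psd_le_sub ipsd Leta (FL2 (Fu r0))) _.
    have : inner m (u r) (u r) <= inner m eta eta.
      apply: le_trans (sg_contraction sg r0 Leta).
      apply: inner_ae_le; do ?[exact: (FL2 (Fu r0)) | exact: sgL2].
      by apply: ae_imp (u_ae r0) => y ->.
    by rewrite /N; lra.
  have e1J : e1 * J r <= e / 2.
    apply: (@le_trans _ _ (e1 * (K * N))); first by rewrite ler_pM2l.
    by rewrite /e1 le_eqVlt; apply/orP; left; apply/eqP; field; rewrite !gt_eqF.
  have e1D : (e1^-1 + 1) * weighted m psi2 (diff r s) (diff r s) <= (e1^-1 + 1) * (K * x).
    by rewrite ler_pM2l // addr_gt0 // invr_gt0.
  by rewrite -/(J r) in Y; lra.
- have Le := form_flow_le s0.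
  have e4 : 0 < e / 4 by rewrite divr_gt0.
  have K0 : 0 < M * M + 1 by have := MM0; lra.
  have e5 : 0 < e / 2 / (M * M + 1) by rewrite !divr_gt0.
  have [d1 d10 Hd1] := sg_increment_small form sg (FP s0) e5.
  have [d2 d20 Hd2] := sg_form_cvg sg (FP s0) (Fvpsi s0) e4.
  exists (Num.min d1 d2) => [|r r0]; first by rewrite lt_min d10.
  rewrite lt_min => /andP[rd1 rd2].
  have := Hd1 r r0 rd1; have := Hd2 r r0 rd2.
  have sr : 0 <= s + r by rewrite addr_ge0 // ltW.
  have LU := sgL2 s0 Leta; have LrU := sgL2 (ltW r0) LU; have LsrU := sgL2 sr Leta.
  rewrite ltr_distl => /andP[_ H1] H2.
  have {}H1 : sg_form_at m P r (P s eta) (fun x => v s x * psi2 x) <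
      r * (E (P s eta) (fun x => v s x * psi2 x) + e / 4).
    by rewrite -ltr_pdivrMl.
  have add_ae : {ae m, forall x, P (s + r) eta x = P r (P s eta) x}.
    by rewrite addrC; exact: (ae_eq_onT (sg_add sg (ltW r0) s0 Leta)).
  have W1 : weighted m psi2 (v s) (diff s (s + r)) =
      sg_form_at m P r (P s eta) (fun x => v s x * psi2 x).
    have Lvp := FL2 (Fvpsi s0).
    rewrite /weighted (psd_sym ipsd Lvp (Ldiff s0 sr)) /sg_form_at.
    apply: inner_ae => //; [exact: Ldiff | exact: (psdV_sub ipsd) |].
    apply: ae_imp2 (ae_imp2 (fun x A B => conj A B) (u_ae s0) (u_ae sr)) add_ae => x [E1 E2] E3.
    by rewrite /diff E1 E2 E3.
  have W2 : weighted m psi2 (diff s (s + r)) (diff s (s + r)) <= (M * M) * (e / 2 / (M * M + 1) * r).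
    apply: le_trans (diff_le s0 sr) _; rewrite ler_wpM2l //; apply: le_trans H2.
    have La := psdV_sub ipsd LU LsrU; have Lb := psdV_sub ipsd LU LrU.
    by apply: inner_ae_le => //; apply: ae_imp add_ae => x ->.
  have W3 : (M * M) * (e / 2 / (M * M + 1) * r) <= e / 2 * r.
    rewrite mulrA ler_pM2r // mulrC mulrAC ler_pdivrMr // ler_pM2l ?divr_gt0 //; lra.
  rewrite (J_diff s0 sr) W1.
  have W4 : r * (2 * E (P s eta) (fun x => v s x * psi2 x)) <= r * (2 * lambda * J s + 4 * theta n * C).
    by rewrite ler_pM2l.
  by lra.
Qed.

Lemma heat_content_bound t : 0 <= t ->
  M ^+ 2 * mass m (D k) (v t) (v t) <= 2 * theta n * C / lambda * expR (2 * lambda * t).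
Proof.
move=> t0; have Lv := FL2 (Fv t0).
have mDk : measurable (D k : set (borel X)) by apply: open_meas; exact: D_open.
have -> : 2 * theta n * C / lambda = 4 * theta n * C / (2 * lambda).
  by field; rewrite gt_eqF.
apply: le_trans (heat_flow_bound t0).
rewrite /mass -(psdZ ipsd) //; last exact: L2_indic.
apply: inner_ae_le => //; [exact: (psdV_scale ipsd _ (L2_indic mDk Lv)) | exact: (L2_weight mpsi2 psi2M) |].
apply: ae_all => x; rewrite indicE; case: (boolP (x \in D k)) => [|_].
  rewrite inE => Dx; rewrite /psi2 /psi (radial_inner w k1 (leqnn _) kn1 Dx).
  rewrite radial_geq // add0r -/M le_eqVlt; apply/orP; left; apply/eqP => /=.
  by rewrite mulr1; ring.
by rewrite !mulr0 mul0r mulrAC -expr2 mulr_ge0 ?sqr_ge0.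
Qed.

End weighted_flow.

(** * Loss of heat on a fixed set under the two growth conditions *)

Definition heat_loss k n t : R :=
  mass m (D k) (fun x => phi n.+2 x - P t (phi n.+2) x) (fun x => phi n.+2 x - P t (phi n.+2) x).

(* The weights [w i] solve [w i ^+ 2 * 2 * theta i = lambda * (\sum_(l > i) w l) ^+ 2],
   so that each step multiplies the partial sums by [1 + sqrt (lambda / (2 * theta i))]. *)
Lemma heat_loss_bound k n lambda C t : (1 <= k)%N -> (k <= n)%N -> 0 < lambda -> 0 <= t ->
  (m (D n.+1 `\` D n) <= C%:E)%E ->
  (\prod_(k <= i < n) (1 + Num.sqrt (lambda / (2 * theta i)))) ^+ 2 * heat_loss k n t <=
  2 * theta n * C / lambda * expR (2 * lambda * t).
Proof.
move=> k1 kn l0 t0 mC.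
pose r i := Num.sqrt (lambda / (2 * theta i)).
have q0 i : (k <= i)%N -> 0 < lambda / (2 * theta i).
  by move=> ki; rewrite divr_gt0 // mulr_gt0 // theta_gt0 // (leq_trans k1).
have r0 i : (k <= i)%N -> 0 < r i by move=> ki; rewrite sqrtr_gt0 q0.
have n1 := leq_trans k1 kn.
have mC' : (m (annulus n) <= C%:E)%E.
  apply: le_trans mC; apply: le_measure; rewrite ?inE.
  - exact: (annulus_meas n1).
  - by apply: measurableD; apply: open_meas; exact: D_open.
  - by move=> x [Dx nDx]; split => // Dnx; apply: nDx; exact: subset_closure.
have w0 := growth_weight_gt0 n r0.
have wn : growth_weight r k n n = 1 by rewrite /growth_weight ltnn andbF.
have wg i : (k <= i < n)%N -> 2 * (growth_weight r k n i ^+ 2 * theta i) <=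
    lambda * (\sum_(i.+1 <= l < n.+1) growth_weight r k n l) ^+ 2.
  move=> kin; have /andP[ki lin] := kin.
  rewrite growth_weight_sum; last by rewrite lin leqW.
  rewrite /growth_weight kin exprMn sqr_sqrtr; last exact/ltW/q0.
  rewrite le_eqVlt; apply/orP; left; apply/eqP; field.
  by rewrite gt_eqF // theta_gt0 // (leq_trans k1).
have := heat_content_bound k1 kn w0 wn l0 wg mC' t0.
rewrite growth_weight_sum ?leqnn //.
apply: le_trans; rewrite ler_wpM2l ?sqr_ge0 // /heat_loss.
have mDk : measurable (D k : set (borel X)) by apply: open_meas; exact: D_open.
have n2 : (1 <= n.+2)%N by [].
have Leta := form_L2 form (cutoff_F n2).
have LP := sgL sg t0 Leta.
have M := sg_markov form sg t0 Leta (ae_all _ (cutoff_itv n2)).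
have Lc : L2 m (fun x => clip01 (P t (phi n.+2) x)) := L2_clip01 LP.
have La := psdV_sub ipsd Leta LP; have Lb := psdV_sub ipsd Leta Lc.
apply: inner_ae_le; do ?[exact: La | exact: Lb | exact: L2_indic].
by apply: ae_imp M => x /clip01_id ->.
Qed.


Let Leta n : L2 m (phi n.+2).
Proof.
by apply: (form_L2 form (cutoff_F _)).
Qed.

Lemma heat_loss_ge0 k n t : (1 <= k)%N -> 0 <= t -> 0 <= heat_loss k n t.
Proof.
move=> k1 t0; have mD : measurable (D k : set (borel X)) by apply: open_meas; exact: D_open.
by apply: (psd_ge0 (mass_psd m mD)); apply: (psdV_sub ipsd) => //; exact: (sgL sg).
Qed.

Lemma conservative_of_heat_loss t : 0 <= t ->
  (forall k e, (1 <= k)%N -> 0 < e -> exists2 n, (k <= n)%N & heat_loss k n t <= e) ->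
  monotone_extension m P t (cst 1) (cst 1).
Proof.
move=> t0 H.
apply: (conservative_of_mass form sg (D := D) (eta := fun n => phi n.+2)) => //.
- by move=> k k1; apply: open_meas; exact: D_open.
- move=> x; have : [set: X] x by [].
  by rewrite -D_cover => -[k k1 Dx]; exists k.
- by move=> n x _; exact: (cutoff_itv).
- move=> k n x k1 kn Dx; apply: (cutoff1) => //.
  by apply: (exhaustion_mono k1 _ Dx); rewrite !leqW.
Qed.

Hypothesis U_finite : forall n, (1 <= n)%N -> (m (D n.+1 `\` D n) < +oo)%E.

Lemma complete_of_liminf :
  (exists c1 : R, forall n, (1 <= n)%N -> theta n <= c1) ->
  limn_einf (fun n => ((theta n)%:E * m (D n.+1 `\` D n) * ((4 ^+ n)^-1)%:E)%E) = 0%E ->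
  stochastically_complete m P.
Proof.
move=> [c theta_c] liminf0 t tp; have t0 := ltW tp.
have c0 : 0 < c := lt_le_trans (theta_gt0 (leqnn 1)) (theta_c _ (leqnn 1)).
apply: conservative_of_heat_loss => // k e k1 e0.
pose B := expR (2 * (2 * c) * t); have B0 : 0 < B := expR_gt0 _.
(* With [lambda = 2 * c] the squared product is at least [4 ^ (n - k)]. Passing from [4 ^ n] to this
   power costs [4 ^ k], and the Gronwall factor costs [B]; [d] compensates both. *)
pose d := e * c / (4 ^+ k * B).
have d0 : 0 < d by rewrite divr_gt0 ?mulr_gt0 // exprn_gt0.
have d0' : (0 < d%:E)%E by rewrite lte_fin.
have [n kn Hn] := limn_einf_eq0_lt k liminf0 d0'.
have n1 := leq_trans k1 kn; exists n => //.
pose C := fine (m (D n.+1 `\` D n)).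
have mC : m (D n.+1 `\` D n) = C%:E.
  by rewrite fineK // ge0_fin_numE // U_finite.
have C0 : 0 <= C by apply: fine_ge0.
rewrite /= mC -!EFinM lte_fin in Hn.
have l0 : 0 < 2 * c by rewrite mulr_gt0.
have := heat_loss_bound k1 kn l0 t0 (eq_ind _ (fun y => (y <= C%:E)%E) (lexx _) _ (esym mC)).
set G := \prod_(_ <= _ < _) _ => HG.
have G2 : 2 ^+ (n - k) <= G.
  apply: prod_rate_ge_exp2 => i ki; have i1 := leq_trans k1 ki.
  rewrite -[leLHS]sqrtr1 ler_wsqrtr // -mulf_div divff // mul1r.
  by rewrite ler_pdivlMr ?theta_gt0 // mul1r theta_c.
have h0 := heat_loss_ge0 n k1 t0.
have p4 (j : nat) : (0 : R) < 4 ^+ j by rewrite exprn_gt0.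
have G4 : 4 ^+ (n - k) * heat_loss k n t <= theta n * C / c * B.
  have -> : theta n * C / c * B = 2 * theta n * C / (2 * c) * B by field; rewrite gt_eqF.
  apply: le_trans HG; rewrite ler_wpM2r //.
  have -> : (4 : R) = 2 ^+ 2 by rewrite expr2; ring.
  by rewrite exprAC ler_pXn2r // nnegrE ?exprn_ge0 // (le_trans _ G2) ?exprn_ge0.
have E1 : (4 : R) ^+ n = 4 ^+ (n - k) * 4 ^+ k by rewrite -exprD subnK.
have H1 : theta n * C < d * 4 ^+ n.
  by move: Hn; rewrite ltr_pdivrMr.
have H2 : d * 4 ^+ n / c * B = 4 ^+ (n - k) * e.
  rewrite E1 /d; field; rewrite !gt_eqF //.
rewrite -(ler_pM2l (p4 (n - k)%N)) -H2; apply: le_trans G4 _.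
by rewrite ler_pM2r // ler_pM2r ?invr_gt0 // ltW.
Qed.

Lemma complete_of_quadratic_rate :
  (exists2 c0 : R, 0 < c0 & forall n, (1 <= n)%N -> theta n = c0 ^+ 2 * n%:R ^+ 2) ->
  (exists2 b : R, 0 < b &
    forall n, (1 <= n)%N -> (m (D n.+1 `\` D n) <= (expR (2 * b * ln n%:R ^+ 2))%:E)%E) ->
  stochastically_complete m P.
Proof.
move=> [c c0 theta_c] [b b0 mU].
(* The squared product has exponent [2 * A * L^2 = (8 * b + 8) * L^2]. It must beat [8 * b * L^2]
   from the measure bound, [4 * L] from [theta n] and [L^2] from Gronwall. *)
pose A := 4 * b + 4; have A4 : 4 <= A by rewrite /A; lra.
have A0 : 0 < A by lra.
(* For [t <= T] the Gronwall exponent [2 * lambda * t] is at most [L^2], uniformly in [n]. *)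
pose T := (16 * c ^+ 2 * A ^+ 2)^-1.
have cA0 : 0 < 16 * c ^+ 2 * A ^+ 2 by rewrite !mulr_gt0 ?exprn_gt0.
have T0 : 0 < T by rewrite invr_gt0.
apply: (monotone_extension_small form sg T0) => t tp tT; have t0 := ltW tp.
apply: conservative_of_heat_loss => // k e k1 e0.
have [M HM] : exists M : nat, 4 * A + k%:R + expR (1 + e^-1) <= M%:R.
  exists (Num.truncn (4 * A + k%:R + expR (1 + e^-1))).+1; apply: ltW; exact: truncnS_gt.
have ex0 : 0 < expR (1 + e^-1) := expR_gt0 _.
have k0 : (0 : R) < k%:R by rewrite ltr0n.
have M0 : 0 < M%:R :> R by lra.
have M1 : (1 <= M)%N by rewrite -(ltr0n R).
have kM : (k <= M)%N by rewrite -(ler_nat R); lra.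
(* With [n = N^2], the logarithm still grows by [L], half of [ln n], between [N] and [n]. With
   [N = M^2], the rate parameter [A * ln n = 4 * A * ln M] is at most [N]. *)
pose N := (M ^ 2)%N; pose n := (N ^ 2)%N.
have MN : (M <= N)%N by rewrite /N -[leqLHS]expn1 leq_pexp2l.
have N1 := leq_trans M1 MN.
have Nn : (N <= n)%N by rewrite /n -[leqLHS]expn1 leq_pexp2l.
have kN := leq_trans kM MN; have kn := leq_trans kN Nn; have n1 := leq_trans k1 kn.
have N0 : 0 < N%:R :> R by rewrite ltr0n.
have n0 : 0 < n%:R :> R by rewrite ltr0n.
exists n => //.
pose L := ln (N%:R : R).
have LE : L = 2 * ln (M%:R : R) by rewrite /L natrX lnXn // mulr_natl.
have lnnE : ln (n%:R : R) = 2 * L by rewrite natrX lnXn // mulr_natl.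
have lnM : 1 + e^-1 <= ln (M%:R : R).
  by rewrite -ler_expR lnK ?posrE //; lra.
have ei : 0 < e^-1 by rewrite invr_gt0.
have L1 : 1 <= L by rewrite LE; lra.
have Le : e^-1 <= L by rewrite LE; lra.
have lnM2 := ln_sublinear M0.
have L0 : 0 < L by lra.
(* As [2 * L = ln n], the rate at [i] becomes [A * ln n / i]. *)
pose lambda := 2 * c ^+ 2 * (A * (2 * L)) ^+ 2.
have AL0 : 0 < A * (2 * L) by rewrite mulr_gt0 //; lra.
have l0 : 0 < lambda by rewrite !mulr_gt0.
have := heat_loss_bound k1 kn l0 t0 (mU n n1).
rewrite lnnE theta_c //; set G := \prod_(_ <= _ < _) _ => HG.
have ratE i : (1 <= i)%N -> Num.sqrt (lambda / (2 * theta i)) = A * (2 * L) / i%:R.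
  move=> i1; have i0 : (0 : R) < i%:R by rewrite ltr0n.
  rewrite (_ : lambda / _ = (A * (2 * L) / i%:R) ^+ 2).
    by rewrite sqrtr_sqr ger0_norm // divr_ge0 // ltW.
  by rewrite theta_c // /lambda; field; rewrite !gt_eqF.
have G0 : expR (A * (2 * L) / 2 * L) <= G.
  have -> : A * (2 * L) / 2 * L = A * (2 * L) / 2 * (ln n%:R - ln N%:R).
    by rewrite lnnE -/L; ring.
  have AN : A * (2 * L) <= N%:R.
    rewrite natrX LE; apply: (@le_trans _ _ (4 * A * M%:R)).
      have : A * ln M%:R <= A * M%:R by rewrite ler_pM2l // ltW.
      by lra.
    by rewrite expr2 ler_pM2r //; lra.
  (* The factors with index below [N] are at least 1 and are dropped. *)
  apply: le_trans (prod_rate_ge_expR (ltW AL0) AN N1 Nn) _.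
  rewrite /G (big_cat_nat kN Nn) /=.
  rewrite (_ : \prod_(N <= i < n) (1 + A * (2 * L) / i%:R) =
     \prod_(N <= i < n) (1 + Num.sqrt (lambda / (2 * theta i)))); last first.
    rewrite big_nat_cond [RHS]big_nat_cond; apply: eq_bigr => i /andP[/andP[Ni _] _].
    by rewrite ratE // (leq_trans N1).
  rewrite ler_peMl //.
    by rewrite (le_trans ler01) // prod_rate_ge1 // => i _; exact: sqrtr_ge0.
  by rewrite prod_rate_ge1 // => i _; exact: sqrtr_ge0.
have h0 := heat_loss_ge0 n k1 t0.
have G2 : expR (2 * A * L ^+ 2) * heat_loss k n t <= G ^+ 2 * heat_loss k n t.
  rewrite ler_wpM2r // (_ : 2 * A * L ^+ 2 = 2%:R * (A * (2 * L) / 2 * L)); last by field.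
  by rewrite expRM_natl ler_pXn2r ?nnegrE ?expR_ge0 // (le_trans _ G0) ?expR_ge0.
have nE : n%:R ^+ 2 = expR (4 * L) :> R.
  by rewrite -[n%:R]lnK ?posrE // lnnE -expRM_natl; congr expR; ring.
have K0 : 0 < 4 * A ^+ 2 * L ^+ 2 by rewrite !mulr_gt0 ?exprn_gt0.
have RE : 2 * (c ^+ 2 * n%:R ^+ 2) * expR (2 * b * (2 * L) ^+ 2) / lambda * expR (2 * lambda * t) =
   (4 * A ^+ 2 * L ^+ 2)^-1 * expR (4 * L + 8 * b * L ^+ 2 + 2 * lambda * t).
  rewrite !expRD nE (_ : 2 * b * (2 * L) ^+ 2 = 8 * b * L ^+ 2); last by ring.
  by rewrite /lambda; field; rewrite !gt_eqF.
rewrite RE in HG; have {}HG := le_trans G2 HG.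
have lt : 2 * lambda * t <= L ^+ 2.
  have : 16 * c ^+ 2 * A ^+ 2 * t <= 1.
    by apply: le_trans (_ : 16 * c ^+ 2 * A ^+ 2 * T <= 1); rewrite ?ler_pM2l // /T mulfV // gt_eqF.
  move=> H; rewrite (_ : 2 * lambda * t = (16 * c ^+ 2 * A ^+ 2 * t) * L ^+ 2).
    by rewrite ler_piMl // sqr_ge0.
  by rewrite /lambda; ring.
have LL : L <= L ^+ 2 by rewrite expr2 ler_peMl // ltW.
have : expR (2 * A * L ^+ 2) * heat_loss k n t <= expR (2 * A * L ^+ 2) * (4 * A ^+ 2 * L ^+ 2)^-1.
  apply: le_trans HG _; rewrite mulrC ler_wpM2r ?invr_ge0 ?(ltW K0) // ler_expR /A.
  have : 0 <= b * L ^+ 2 by rewrite mulr_ge0 ?sqr_ge0 // ltW.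
  have := sqr_ge0 L.
  by lra.
rewrite ler_pM2l ?expR_gt0 // => /le_trans; apply.
(* Once the exponentials are cancelled, the smallness comes from the factor [1 / lambda], that is,
   from [L >= e^-1]. *)
rewrite -[leRHS]invrK lef_pV2 ?posrE // ?invr_gt0 //; apply: le_trans Le _.
apply: le_trans LL _; rewrite ler_peMl ?sqr_ge0 //.
have : 4 ^+ 2 <= A ^+ 2 by rewrite ler_pXn2r // nnegrE ltW.
by rewrite expr2; lra.
Qed.

End exhaustion.

Theorem theorem1p16 (R : realType) (X : pmetricType R)
  (locally_compact_X : locally_compact [set: X])
  (m : borel_measure X R) (m_radon : radon_measure m)
  (m_support : full_support m)
  (F : set (X -> R)) (E : (X -> R) -> (X -> R) -> R)
  (form : dirichlet_form m F E) (form_regular : regular_form m F E)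
  (form_local : strongly_local m F E)
  (P : R -> (X -> R) -> (X -> R)) (semigroup : associated_semigroup m F E P)
  (Gamma : (X -> R) -> borel_measure X R)
  (energy : energy_measure m F E Gamma)
  (D : nat -> set X) (theta : nat -> R)
  (D_open : forall n, (1 <= n)%N -> open (D n))
  (D_compact : forall n, (1 <= n)%N -> compact (closure (D n)))
  (D_incr : forall n, (1 <= n)%N -> closure (D n) `<=` D n.+1)
  (D_cover : \bigcup_(n in [set n | (1 <= n)%N]) D n = [set: X])
  (theta_gt0 : forall n, (1 <= n)%N -> 0 < theta n)
  (csd : forall n, (1 <= n)%N -> CSD m F E Gamma (D n) (D n.+1) (theta n)) :
  let U n := D n.+1 `\` D n in
  ((exists c1 : R, forall n, (1 <= n)%N -> theta n <= c1) ->
   limn_einf (fun n => ((theta n)%:E * m (U n) * ((4 ^+ n)^-1)%:E)%E) = 0%E ->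
   stochastically_complete m P)
  /\
  ((exists2 c0 : R, 0 < c0 &
      forall n, (1 <= n)%N -> theta n = c0 ^+ 2 * n%:R ^+ 2) ->
   (exists2 b : R, 0 < b &
      forall n, (1 <= n)%N -> (m (U n) <= (expR (2 * b * ln n%:R ^+ 2))%:E)%E) ->
   stochastically_complete m P).
Proof.
have /choice[phi phiP] : forall n, exists phi : X -> R, (1 <= n)%N ->
    cutoff m F (D n) (D n.+1) phi /\
    csd_with m F E Gamma (D n.+1 `\` closure (D n)) phi (theta n).
  (* The index 0 carries no condition and receives a dummy function. *)
  case=> [|n]; first by exists (cst 0).
  by have [phi phi_cut phi_csd] := csd n.+1 isT; exists phi.
have phi_cutoff n (n1 : (1 <= n)%N) := (phiP n n1).1.
have phi_csd n (n1 : (1 <= n)%N) := (phiP n n1).2.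
(* A Radon measure is finite on the compact closure of [D n.+1]; finiteness lets the lower limit be
   handled with real numbers. *)
have U_finite n : (1 <= n)%N -> (m (D n.+1 `\` D n) < +oo)%E.
  move=> n1; have n2 : (1 <= n.+1)%N by [].
  have [radon_finite _ _] := m_radon.
  apply: le_lt_trans (radon_finite _ (D_compact _ n2)); apply: le_measure; rewrite ?inE.
  - by apply: measurableD; apply: open_meas; exact: D_open.
  - rewrite -[closure _]setCK; apply: measurableC; apply: open_meas.
    exact/closed_openC/closed_closure.
  - by move=> x [Dx _]; exact: subset_closure.
by split; [apply: (complete_of_liminf form semigroup form_regular form_local D_open D_compact
    D_incr D_cover phi_cutoff energy theta_gt0 phi_csd U_finite)
  | apply: (complete_of_quadratic_rate form semigroup form_regular form_local D_open D_compact
    D_incr D_cover phi_cutoff energy theta_gt0 phi_csd)].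
Qed.
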